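(* Let $W(x,t)$ be a stationary Gaussian process having a.s. continuously differentiable sample paths, let $V=-W_t(0,0)/W_x(0,0)$ be the local velocity at $(x,t)=(0,0)$ and let $v$ denote the velocity of the ship. Then $$F^{\mathrm{enc}}_{W_x}(w)=\frac{\mathsf{E}[(V-v)^+\,W_x(0,0)^-\,\mathbf{1}_{\{W_x(0,0)\le w\}}\mid W(0,0)=0]\,f_{W(0,0)}(0)}{\mathsf{E}[(V-v)^+\,W_x(0,0)^-\mid W(0,0)=0]\,f_{W(0,0)}(0)},\qquad w\in\mathbb{R},$$ where $x^+=\max(x,0)$ and $x^-=\max(-x,0)$.
   Context: Sea model (standing assumption): $W(x,t)$, $(x,t)\in\mathbb{R}^2$, is a real zero-mean stationary Gaussian field whose covariance function $R(\xi,\tau)=\mathsf{E}[W(x,t)W(x+\xi,t+\tau)]$ is $$R(\xi,\tau)=\int_0^\infty\int_0^{2\pi}\cos\Big(\omega\tau+\frac{\omega^2}{g}\xi\cos\theta\Big)S(\omega,\theta)\,d\theta\,d\omega,$$ where $S(\omega,\theta)$, $\omega>0$, $\theta\in[0,2\pi]$, is the directional spectral density and $g>0$ is the gravitational constant. $W_x,W_t$ denote partial derivatives. A ship sails along the $x$-axis in the positive direction with constant speed $v$, starting at $x=0$ at time $0$. The encountered sea is $Z(t)=W(vt,t)$, with derivative $Z_t(t)=vW_x(vt,t)+W_t(vt,t)$. The Gaussian vector $(Z(0),Z_t(0),W_x(0,0))$ is nondegenerate (has a density); equivalently, $(W(0,0),W_x(0,0),W_t(0,0))$ is nondegenerate.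 Encountered Palm distribution of slope (at times when a wave center overtakes the ship): $$F^{\mathrm{enc}}_{W_x}(w)=\frac{\mathsf{E}[\#\{t\in[0,1];\,Z(t)=0,\ Z_t(t)>0,\ W_x(vt,t)<0,\ W_x(vt,t)\le w\}]}{\mathsf{E}[\#\{t\in[0,1];\,Z(t)=0,\ Z_t(t)>0,\ W_x(vt,t)<0\}]}.$$ Notation: $f_X$ is the density of $X$; $\mathsf{E}[\,\cdot\mid W(0,0)=0]f_{W(0,0)}(0)$ is interpreted as an integral against the joint density of $(W_x(0,0),W_t(0,0),W(0,0))$ evaluated at $W(0,0)=0$. *)

(* Defs.v *)
From HB Require Import structures.
From mathcomp Require Import all_boot all_order all_algebra.
From mathcomp Require Import all_classical all_reals all_analysis.
Import Order.TTheory GRing.Theory Num.Theory.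
Import numFieldNormedType.Exports.

Set Implicit Arguments.
Unset Strict Implicit.
Unset Printing Implicit Defensive.

Local Open Scope classical_set_scope.
Local Open Scope ring_scope.

Section Gaussian.
Context {d : measure_display} {T : measurableType d} {R : realType}.
Variable P : probability T R.

(* [normal_prob m 0] is not a point mass in the library, hence the separate
   degenerate case. *)
Definition gaussian_rv (X : T -> R) : Prop :=
  exists m s : R, 0 <= s /\
    forall A : set R, measurable A ->
      P (X @^-1` A) = if s == 0 then \d_m A else normal_prob m s A.

Definition gaussian_field (W : R -> R -> {RV P >-> R}) : Prop :=
  forall (n : nat) (p : 'I_n -> R * R) (a : 'I_n -> R),
    gaussian_rv (fun o => \sum_(i < n) a i * W (p i).1 (p i).2 o).

Definition stationary_field (W : R -> R -> {RV P >-> R}) : Prop :=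
  forall (n : nat) (p : 'I_n -> R * R) (h : R * R) (A : 'I_n -> set R),
    (forall i, measurable (A i)) ->
    P [set o | forall i, A i (W ((p i).1 + h.1) ((p i).2 + h.2) o)] =
    P [set o | forall i, A i (W (p i).1 (p i).2 o)].

(* Almost every path is C^1 on the plane. The partial derivatives are given as
   random fields, since the pointwise derivative of an exceptional path is
   arbitrary and need not depend measurably on the outcome. *)
Definition as_C1_with (W Wx Wt : R -> R -> {RV P >-> R}) : Prop :=
  {ae P, forall o,
    [/\ forall x t : R, is_derive x 1 (fun y : R => W y t o) (Wx x t o),
        forall x t : R, is_derive t 1 (fun s : R => W x s o) (Wt x t o),
        continuous (fun p : R * R => Wx p.1 p.2 o) &
        continuous (fun p : R * R => Wt p.1 p.2 o)] }.

Definition joint_density3 (X Y Z : T -> R) (f : R * R * R -> R) : Prop :=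
  [/\ measurable_fun [set: R * R * R] f,
      forall q, 0 <= f q &
      forall A : set (R * R * R), measurable A ->
        P [set o | A (X o, Y o, Z o)] =
        (\int[((lebesgue_measure \x lebesgue_measure) \x lebesgue_measure)%E]_(q in A)
           (f q)%:E)%E].

Definition has_density3 (X Y Z : T -> R) : Prop :=
  exists f, joint_density3 X Y Z f.

End Gaussian.

Section SeaModel.
Context {R : realType}.

Definition spectral_domain : set (R * R) := `]0, +oo[ `*` `[0, 2 * pi].

Definition directional_spectral_density (S : R -> R -> R) : Prop :=
  (forall omega theta, spectral_domain (omega, theta) -> 0 <= S omega theta) /\
  (lebesgue_measure \x lebesgue_measure)%E.-integrable spectral_domain
    (fun q => (S q.1 q.2)%:E).

Definition sea_covariance (g : R) (S : R -> R -> R) (xi tau : R) : R :=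
  \int[lebesgue_measure]_(omega in `]0, +oo[)
    \int[lebesgue_measure]_(theta in `[0, 2 * pi])
      (cos (omega * tau + omega ^+ 2 / g * xi * cos theta) * S omega theta).

Definition sea_model {d : measure_display} {T : measurableType d}
    (P : probability T R) (g : R) (S : R -> R -> R)
    (W : R -> R -> {RV P >-> R}) : Prop :=
  [/\ gaussian_field W,
      stationary_field W,
      forall x t : R, ('E_P[W x t] = 0)%E &
      forall x t xi tau : R,
        ('E_P[fun o => (W x t o * W (x + xi)%R (t + tau)%R o)%R] =
         (sea_covariance g S xi tau)%:E)%E].

End SeaModel.

Section Encountered.
Context {d : measure_display} {T : measurableType d} {R : realType}.
Variable P : probability T R.
Variables (W Wx Wt : R -> R -> {RV P >-> R}) (v : R).

Definition enc_sea (t : R) (o : T) : R := W (v * t) t o.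

Definition enc_sea_t (t : R) (o : T) : R :=
  v * Wx (v * t) t o + Wt (v * t) t o.

Definition overtaking_times (o : T) : set R :=
  [set t | [/\ t \in `[0, 1], enc_sea t o = 0, 0 < enc_sea_t t o &
               Wx (v * t) t o < 0]].

(* [counting] is [+oo] on infinite sets and the quotient is taken in [\bar R],
   so no finiteness of the expectations is presupposed. *)
Definition F_enc (w : R) : \bar R :=
  (\int[P]_o counting (overtaking_times o `&` [set t | Wx (v * t) t o <= w]%R) /
   \int[P]_o counting (overtaking_times o))%E.

End Encountered.

Section Slice.
Context {R : realType}.

Definition pos_part (x : R) : R := Num.max x 0.
Definition neg_part (x : R) : R := Num.max (- x) 0.

Definition local_velocity (wx wt : R) : R := - wt / wx.

(* E[h(W_x, W_t) | W = 0] f_W(0), where [f] is the continuous version of the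
   joint density of (W_x, W_t, W): conditioning on the null event W = 0 means
   integrating against the slice of [f] at W = 0. *)
Definition cond_expectation_density0 (f : R * R * R -> R) (h : R -> R -> R) :
    \bar R :=
  (\int[lebesgue_measure \x lebesgue_measure]_q
     (h q.1 q.2 * f (q.1, q.2, 0))%:E)%E.

End Slice.

(* Main.v *)
(* Numerators and denominators agree separately: for a suitable test function chi,
   the expected sum of chi(Z'(t), W_x(vt, t)) over the zeros t of Z in ]x, y] is
   (y - x) * \int z' chi(z', w_x) f(w_x, z' - v w_x, 0) (Rice's formula).

   Fix s and let Gaussian regression on Z(s) write every quantity at time t as a part
   independent of Z(s) plus a coefficient times Z(s). For t close to s the coefficient
   rho(t) of Z(t) is positive, so that, writing Z(t) = Y(t) + rho(t) u with u = Z(s)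
   independent of Y, the zeros of Z are the points where G = - Y / rho takes the value u.
   Integrating over u with its Gaussian density, the area formula for the C^1 function G
   turns the sum over the zeros into an integral over t, whose expectation is for each t
   the slice at 0 of the joint density, by continuity in the level. This gives the
   identity on short intervals, and additivity extends it to all intervals. Zeros with
   small slope are cut off by chi; dominated and then monotone limits in chi yield the
   indicator of {z' > 0, w_x < 0, w_x <= w}.

   Laws are compared through characteristic functions: the derivatives W_x and W_t are
   limits of finite combinations of W, and such limits have Gaussian characteristic
   functions determined by the covariance. *)
Require Import Defs.
From HB Require Import structures.
From mathcomp Require Import all_boot all_order all_algebra.
From mathcomp Require Import all_classical all_reals all_analysis.
From mathcomp Require Import measurable_realfun ring lra.
Import Order.TTheory GRing.Theory Num.Theory.
Import numFieldNormedType.Exports.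
Set Implicit Arguments.
Unset Strict Implicit.
Unset Printing Implicit Defensive.
Local Open Scope classical_set_scope.
Local Open Scope ring_scope.

(** Changing variables along a path controls crossing sums only after integration over the level,
    whereas the claim concerns the single level 0. Regression closes this gap: it makes the level
    the Gaussian variable u itself, so that an average over levels is already an expectation, and
    crossing sums at nearby levels never have to be compared. The price is the division by rho,
    which is safe only near s; hence a local formula, extended by bisection. Continuity in the level
    is needed only for integrals of bounded, compactly supported test functions. The second obstacle
    is measurability. On exceptional paths nothing is known, and a number of zeros is not visibly a
    measurable function of the outcome. Crossing sums are therefore represented by the functional
    [Phi], an upper limit of sums over finitely many sampled values, which is defined and measurable
    on all paths; its expectation is determined by the law of the family. Finiteness is proved for
    the compactly supported test functions only; the last monotone limit admits infinite values. *)

(** * Densities and bounded convergence *)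

Section integral_density.
Context d (T : measurableType d) (R : realType).
Variables (mu nu : {measure set T -> \bar R}) (f : T -> R).
Hypothesis f_ge0 : forall x, 0 <= f x.
Hypothesis mf : measurable_fun setT f.
Hypothesis nuE : forall A, measurable A ->
  nu A = (\int[mu]_(x in A) (f x)%:E)%E.
Import HBNNSimple.
Local Open Scope ereal_scope.

(** Both sides pass through the same increasing simple functions; on the indicator of a level set
    the claim is [nuE]. *)
Lemma ge0_integral_density (g : T -> \bar R) :
  measurable_fun setT g -> (forall x, 0 <= g x) ->
  \int[nu]_x g x = \int[mu]_x (g x * (f x)%:E).
Proof.
move=> mg g0; pose h := nnsfun_approx measurableT mg.
have mfE : measurable_fun setT (EFin \o f) by exact/measurable_EFinP.
have -> : \int[nu]_x g x = limn (fun n => \int[nu]_x (EFin \o h n) x).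
  have gE x : g x = limn (fun n => (EFin \o h n) x).
    by apply/esym/cvg_lim => //; exact: cvg_nnsfun_approx.
  under eq_integral do rewrite gE.
  apply: monotone_convergence => //.
  - by move=> n; exact/measurable_EFinP.
  - by move=> n x _; rewrite lee_fin.
  - by move=> x _ a b ab; rewrite lee_fin; exact/lefP/nd_nnsfun_approx.
have -> : \int[mu]_x (g x * (f x)%:E) =
    limn (fun n => \int[mu]_x ((EFin \o h n) x * (f x)%:E)).
  have gE x : g x * (f x)%:E = limn (fun n => (EFin \o h n) x * (f x)%:E).
    by apply/esym/cvg_lim => //; apply: cvgeZr => //; exact: cvg_nnsfun_approx.
  under eq_integral do rewrite gE.
  apply: monotone_convergence => //.
  - by move=> n; apply: emeasurable_funM => //; exact/measurable_EFinP.
  - by move=> n x _; rewrite mule_ge0// lee_fin.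
  - move=> x _ a b ab; rewrite lee_wpmul2r ?lee_fin//.
    exact/lefP/nd_nnsfun_approx.
congr (limn _); apply/funext => n.
transitivity (\int[nu]_x
   (\sum_(y \in range (h n)) (y * \1_(h n @^-1` [set y]) x)%:E)).
  by apply: eq_integral => t _; rewrite /= fimfunE -fsumEFin.
transitivity (\int[mu]_x (\sum_(y \in range (h n))
    (y * \1_(h n @^-1` [set y]) x)%:E * (f x)%:E)); last first.
  apply: eq_integral => x _.
  rewrite -ge0_mule_fsuml => [|y]; last exact: nnfun_muleindic_ge0.
  by rewrite fsumEFin // -(fimfunE _ x).
have indich m r : measurable_fun setT
    (fun x => (r * \1_(h m @^-1` [set r]) x)%:E).
  by apply: (measurable_comp measurableT) => //; exact: measurable_funM.
rewrite ge0_integral_fsum//; last by move=> m y _; exact: nnfun_muleindic_ge0.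
rewrite ge0_integral_fsum//; last 2 first.
  - by move=> y; apply: emeasurable_funM.
  - by move=> m y _; apply: mule_ge0; [exact: nnfun_muleindic_ge0|rewrite lee_fin].
apply: eq_fsbigr => r rhn.
under [LHS]eq_integral do rewrite EFinM.
rewrite integralZl_indic_nnsfun => //.
under [RHS]eq_integral do rewrite EFinM -muleA.
rewrite ge0_integralZl//.
- rewrite integral_indic// setIT nuE; last exact: measurable_sfunP.
  under [in RHS]eq_integral do rewrite muleC.
  rewrite [in RHS](eq_integral ((EFin \o f) \_ (h n @^-1` [set r]))); last first.
    by move=> x xE; rewrite epatch_indic.
  by rewrite -integral_mkcond.
- by apply: emeasurable_funM => //; exact/measurable_EFinP.
- by move=> t _; rewrite mule_ge0 ?lee_fin.
- by move: rhn; rewrite inE => -[t _ <-]; rewrite lee_fin.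
Qed.

Lemma Rintegral_density (g : T -> R) : measurable_fun setT g ->
  (\int[nu]_x g x = \int[mu]_x (g x * f x))%R.
Proof.
move=> mg; rewrite /Rintegral; congr fine.
rewrite integralE [RHS]integralE.
have mgE : measurable_fun setT (EFin \o g) by exact/measurable_EFinP.
rewrite ge0_integral_density//; last exact: measurable_funepos.
rewrite ge0_integral_density//; last exact: measurable_funeneg.
congr (_ - _); apply: eq_integral => x _.
- rewrite !funeposE -EFin_max -!EFinM -EFin_max; congr EFin.
  by rewrite maxr_pMl// mul0r.
- rewrite !funenegE -!EFinN -!EFin_max -EFinM; congr EFin.
  by rewrite maxr_pMl// mul0r mulNr.
Qed.

End integral_density.

Section finite_measure_integral.
Context d (T : measurableType d) (R : realType).
Variable mu : {finite_measure set T -> \bar R}.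

Lemma bounded_integrable (f : T -> R) (C : R) : measurable_fun setT f ->
  (forall x, `|f x| <= C) -> mu.-integrable setT (EFin \o f).
Proof.
move=> mf fC; apply: measurable_bounded_integrable => //.
  by rewrite ltey_eq fin_num_measure.
by exists C; split; [exact: num_real|move=> x Cx y _ /=; exact: le_trans (fC y) (ltW Cx)].
Qed.

Lemma bounded_cvg_Rintegral (f_ : nat -> T -> R) (f : T -> R) (C : R) :
  (forall n, measurable_fun setT (f_ n)) -> measurable_fun setT f ->
  (forall n x, `|f_ n x| <= C) ->
  {ae mu, forall x, f_ n x @[n --> \oo] --> f x} ->
  \int[mu]_x f_ n x @[n --> \oo] --> \int[mu]_x f x.
Proof.
move=> mf_ mf fC cvf.
have [|||||fi _ ficv] := @dominated_convergence _ _ _ mu setT measurableT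
  (fun n => EFin \o f_ n) (EFin \o f) (cst C%:E).
- by move=> n; exact/measurable_EFinP.
- exact/measurable_EFinP.
- by apply: filterS cvf => x fx _; exact: cvg_EFin (nearW _ _) fx.
- by apply: (@bounded_integrable (cst C) `|C|) => // x /=.
- by apply: aeW => x n _ /=; rewrite lee_fin.
apply: fine_cvg.
by rewrite fineK//; exact: integrable_fin_num.
Qed.

End finite_measure_integral.

(** * Fourier transform of the normal law *)

Section calculus.
Context {R : realType}.
Implicit Types F f : R -> R.
Local Notation mu := (@lebesgue_measure R).

Lemma regular_scaleE (a b : R) : a *: (b : R^o) = a * b.
Proof. by []. Qed.

Lemma is_derive_continuous F f : (forall x : R, is_derive x 1 F (f x)) ->
  continuous F.
Proof.
move=> dF x; apply/differentiable_continuous/derivable1_diffP.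
by have [] := dF x.
Qed.

Lemma is_derive_derive1 F f : (forall x : R, is_derive x 1 F (f x)) ->
  F^`()%classic = f.
Proof. by move=> dF; apply/funext => x; rewrite derive1E; have [] := dF x. Qed.

Lemma is_derive_LRcontinuous F f a b : (forall x : R, is_derive x 1 F (f x)) ->
  derivable_oo_LRcontinuous F a b.
Proof.
move=> dF; have cF := is_derive_continuous dF; split.
- by move=> x _; have [] := dF x.
- exact/cvg_at_right_filter/cF.
- exact/cvg_at_left_filter/cF.
Qed.

Lemma integral_is_derive F f a b : a <= b ->
  (forall x : R, is_derive x 1 F (f x)) -> continuous f ->
  (\int[mu]_(x in `[a, b]) (f x)%:E = (F b - F a)%:E)%E.
Proof.
rewrite le_eqVlt => /predU1P[<- _ _|ab dF cf].
  by rewrite set_itv1 integral_set1 subrr.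
rewrite (@continuous_FTC2 _ f F _ _ ab) ?EFinB//.
- exact: continuous_subspaceT.
- exact: is_derive_LRcontinuous dF.
- by move=> x _; rewrite (is_derive_derive1 dF).
Qed.

End calculus.

Section gauss_cf.
Context {R : realType}.
Local Notation mu := (@lebesgue_measure R).
Variables (m s : R).
Hypothesis s0 : s != 0.

Local Notation pdf := (normal_pdf m s).

Let is_derive_pdf (x : R) : is_derive x 1 pdf (- ((x - m) / s ^+ 2) * pdf x).
Proof.
rewrite (normal_pdfE _ s0).
have h : is_derive x 1 (fun x : R => - (x - m) ^+ 2 / (s ^+ 2 *+ 2))
   (- ((x - m) / s ^+ 2)).
  apply: is_derive_eq.
  by rewrite !regular_scaleE; field.
have e := is_derive1_comp (is_derive_expR _) h.
have -> : (fun x : R => normal_peak s * normal_fun m s x) =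
  normal_peak s *: (expR \o (fun x : R => - (x - m) ^+ 2 / (s ^+ 2 *+ 2))).
  by [].
apply: is_derive_eq.
by rewrite !regular_scaleE /normal_fun; ring.
Qed.

Let cpdf : continuous pdf := @continuous_normal_pdf _ m s s0.

(** Half of the exponent absorbs the factor [|x - m|], by [1 + y <= exp y]; the other half is a
    normal density of doubled variance, which serves as integrable bound below. *)
Let pdf_moment_bound : exists2 C, 0 <= C &
  forall x, `|x - m| * pdf x <= C * normal_pdf m (s * Num.sqrt 2) x.
Proof.
have t0 : s * Num.sqrt 2 != 0 by rewrite mulf_neq0// sqrtr_eq0 -ltNge.
exists (`|s| * normal_peak s / normal_peak (s * Num.sqrt 2)).
  by rewrite mulr_ge0 ?invr_ge0 ?mulr_ge0 ?normal_peak_ge0.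
move=> x; rewrite (normal_pdfE _ s0) (normal_pdfE _ t0).
rewrite [leRHS]mulrA divfK ?gt_eqF ?normal_peak_gt0// mulrCA.
rewrite [leRHS]mulrAC [leRHS]mulrC ler_wpM2l ?normal_peak_ge0// /normal_fun.
set y := x - m.
have -> : - y ^+ 2 / ((s * Num.sqrt 2) ^+ 2 *+ 2) = - y ^+ 2 / (s ^+ 2 *+ 4).
  by rewrite exprMn sqr_sqrtr// mulr_natr -mulrnA.
have -> : - y ^+ 2 / (s ^+ 2 *+ 2) =
   - y ^+ 2 / (s ^+ 2 *+ 4) + - y ^+ 2 / (s ^+ 2 *+ 4) by field.
rewrite expRD mulrA ler_wpM2r ?expR_ge0//.
rewrite -ler_pdivlMr ?expR_gt0// -expRN.
apply: le_trans (ler_wpM2l _ (expR_ge1Dx _)) => //.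
have sp : 0 < `|s| by rewrite normr_gt0.
rewrite -(@ler_pM2l _ (`|s|))//.
have -> : `|s| * (`|s| * (1 + - (- y ^+ 2 / (s ^+ 2 *+ 4)))) =
  `|s| ^+ 2 + `|y| ^+ 2 / 4.
  have sn : `|s| != 0 by rewrite gt_eqF.
  by rewrite -(real_normK (num_real s)) -(real_normK (num_real y)); field.
(* This is [|s| |y| <= s^2 + y^2 / 4]. *)
have := sqr_ge0 (`|s| - `|y| / 2).
rewrite sqrrB; lra.
Qed.

Let ipdf1 (f : R -> R) : measurable_fun setT f ->
  (forall x, `|f x| <= `|x - m|) ->
  mu.-integrable setT (fun x => (f x * pdf x)%:E).
Proof.
move=> mf fm; have [C C0 hC] := pdf_moment_bound.
have := integrableZl measurableT C (integrable_normal_pdf m (s * Num.sqrt 2)).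
apply: le_integrable => //.
  apply/measurable_EFinP; apply: measurable_funM => //.
  exact: measurable_normal_pdf.
move=> x _ /=; rewrite lee_fin normrM (ger0_norm (normal_pdf_ge0 _ _ _)).
rewrite [leRHS]ger0_norm ?mulr_ge0 ?normal_pdf_ge0//.
apply: le_trans (hC x); apply: ler_wpM2r => //; exact: normal_pdf_ge0.
Qed.

Let ipdf0 (f : R -> R) : measurable_fun setT f -> (forall x, `|f x| <= 1) ->
  mu.-integrable setT (fun x => (f x * pdf x)%:E).
Proof.
move=> mf fm; have := integrable_normal_pdf m s.
apply: le_integrable => //.
  apply/measurable_EFinP; apply: measurable_funM => //.
  exact: measurable_normal_pdf.
move=> x _ /=; rewrite lee_fin normrM ler_piMl//.
Qed.

Let pdf_cvg0 (h : R) : `|h| = 1 -> pdf (m + h * n%:R) @[n --> \oo] --> (0 : R).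
Proof.
move=> h1; have [C C0 hC] := pdf_moment_bound.
have t0 : s * Num.sqrt 2 != 0 by rewrite mulf_neq0// sqrtr_eq0 -ltNge.
pose K := C * normal_peak (s * Num.sqrt 2).
have pdfK n : pdf (m + h * n.+1%:R) <= K / n.+1%:R.
  rewrite ler_pdivlMr// mulrC; apply: le_trans (le_trans (hC (m + h * n.+1%:R)) _).
    by rewrite addrAC subrr add0r normrM h1 mul1r ger0_norm.
  by rewrite ler_wpM2l// normal_pdf_ub.
rewrite -(cvg_shiftS (fun n => pdf (m + h * n%:R))).
apply: (@squeeze_cvgr _ _ _ _ (cst 0) (fun n => K / n.+1%:R)).
- by apply: nearW => n; rewrite normal_pdf_ge0 /= pdfK.
- exact: cvg_cst.
- rewrite -[X in _ --> X](mulr0 K); apply: cvgMr; exact: cvg_harmonic.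
Qed.

(** The fundamental theorem of calculus on [[m - n, m + n]], followed by dominated convergence. It
    takes the place of integration by parts on the whole line. *)
Let integral_vanish (F f : R -> R) : (forall x : R, is_derive x (1 : R) F (f x)) ->
  continuous f -> mu.-integrable setT (EFin \o f) ->
  F (m + n%:R) @[n --> \oo] --> (0 : R) ->
  F (m - n%:R) @[n --> \oo] --> (0 : R) ->
  \int[mu]_x f x = 0.
Proof.
move=> dF cf intf F1 F2.
pose A n := `[m - n%:R, m + n%:R]%classic : set R.
have mA n : measurable (A n) by exact: measurable_itv.
have [|||||_ _ h] := @dominated_convergence _ _ _ mu setT measurableT
  (fun n => (EFin \o f) \_ (A n)) (EFin \o f) (abse \o (EFin \o f)).
- move=> n; apply/measurable_restrict => //; first exact: mA.
  by apply: (measurable_funS measurableT) => //; exact: measurable_int intf.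
- exact: measurable_int intf.
- apply: aeW => x _; apply: cvg_near_cst.
  near=> n; rewrite /= /restrict ifT// inE /A/= in_itv/=.
  have : `|x - m| <= n%:R by near: n; exact: nbhs_infty_ger.
  rewrite ler_norml => /andP[? ?]; apply/andP; split; lra.
- exact: integrable_abse.
- apply: aeW => x n _ /=; rewrite /restrict; case: ifPn => // _.
  by rewrite (_ : point = 0%E)// abse0 lee_fin.
have e n : (\int[mu]_x ((EFin \o f) \_ (A n)) x = (F (m + n%:R) - F (m - n%:R))%:E)%E.
  rewrite -integral_mkcond -(integral_is_derive _ dF)//.
  have := ler0n R n; lra.
have c0 : (F (m + n%:R) - F (m - n%:R))%:E @[n --> \oo] --> (0 : R)%:E.
  apply: cvg_EFin; first exact: nearW.
  by rewrite -[X in _ --> X](subrr (0:R)); exact: cvgB.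
move: h; under eq_fun do rewrite e; move=> h.
by rewrite /Rintegral (cvg_unique _ h c0).
Unshelve. all: by end_near. Qed.

(** As in [pdf_moment_bound], now with [y^2 <= 4 s^2 exp (y^2 / (4 s^2))]. *)
Let pdf_moment2_bound (x : R) : (x - m) ^+ 2 * pdf x <=
  4 * s ^+ 2 * normal_peak s / normal_peak (s * Num.sqrt 2) *
  normal_pdf m (s * Num.sqrt 2) x.
Proof.
have t0 : s * Num.sqrt 2 != 0 by rewrite mulf_neq0// sqrtr_eq0 -ltNge.
rewrite (normal_pdfE _ s0) (normal_pdfE _ t0).
rewrite [leRHS]mulrA divfK ?gt_eqF ?normal_peak_gt0// mulrCA.
rewrite [leRHS]mulrAC [leRHS]mulrC ler_wpM2l ?normal_peak_ge0// /normal_fun.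
set y := x - m.
have -> : - y ^+ 2 / ((s * Num.sqrt 2) ^+ 2 *+ 2) = - y ^+ 2 / (s ^+ 2 *+ 4).
  by rewrite exprMn sqr_sqrtr// mulr_natr -mulrnA.
have -> : - y ^+ 2 / (s ^+ 2 *+ 2) =
   - y ^+ 2 / (s ^+ 2 *+ 4) + - y ^+ 2 / (s ^+ 2 *+ 4) by field.
rewrite expRD mulrA ler_wpM2r ?expR_ge0//.
rewrite -ler_pdivlMr ?expR_gt0// -expRN.
have s2 : 0 < s ^+ 2 by rewrite exprn_even_gt0.
apply: (le_trans _ (ler_wpM2l _ (expR_ge1Dx _))); last by lra.
have -> : 4 * s ^+ 2 * (1 + - (- y ^+ 2 / (s ^+ 2 *+ 4))) = 4 * s ^+ 2 + y ^+ 2.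
  by field.
lra.
Qed.

Let ipdf2 : mu.-integrable setT (fun x => ((x - m) ^+ 2 * pdf x)%:E).
Proof.
pose C := 4 * s ^+ 2 * normal_peak s / normal_peak (s * Num.sqrt 2).
have := integrableZl measurableT C (integrable_normal_pdf m (s * Num.sqrt 2)).
apply: le_integrable => //.
  apply/measurable_EFinP; apply: measurable_funM; last exact: measurable_normal_pdf.
  by apply: measurable_funX; exact: measurable_funB.
move=> x _ /=; rewrite lee_fin (ger0_norm (mulr_ge0 (sqr_ge0 _) (normal_pdf_ge0 _ _ _))).
by apply: le_trans (pdf_moment2_bound x) _; exact: ler_norm.
Qed.

Let moment_cvg0 (h : R) : `|h| = 1 ->
  h * n%:R * pdf (m + h * n%:R) @[n --> \oo] --> (0 : R).
Proof.
move=> h1.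
have t0 : s * Num.sqrt 2 != 0 by rewrite mulf_neq0// sqrtr_eq0 -ltNge.
pose K := 4 * s ^+ 2 * normal_peak s / normal_peak (s * Num.sqrt 2) * normal_peak (s * Num.sqrt 2).
have pdfK n : `|h * n.+1%:R * pdf (m + h * n.+1%:R)| <= K / n.+1%:R.
  rewrite !normrM h1 mul1r (ger0_norm (normal_pdf_ge0 _ _ _)) (ger0_norm (ler0n _ _)).
  rewrite ler_pdivlMr// mulrAC -expr2.
  have -> : n.+1%:R ^+ 2 = (m + h * n.+1%:R - m) ^+ 2 :> R.
    rewrite addrAC subrr add0r exprMn -(real_normK (num_real h)) h1.
    by rewrite expr1n mul1r.
  apply: le_trans (pdf_moment2_bound _) _.
  rewrite ler_wpM2l ?normal_pdf_ub// divr_ge0 ?normal_peak_ge0// mulr_ge0 ?normal_peak_ge0//.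
  by rewrite mulr_ge0// sqr_ge0.
rewrite -(cvg_shiftS (fun n => h * n%:R * pdf (m + h * n%:R))).
apply: norm_cvg0.
apply: (@squeeze_cvgr _ _ _ _ (cst 0) (fun n => K / n.+1%:R)).
- by apply: nearW => n; rewrite normr_ge0 /= pdfK.
- exact: cvg_cst.
- rewrite -[X in _ --> X](mulr0 K); apply: cvgMr; exact: cvg_harmonic.
Qed.

Lemma Rintegral_normal_prob_id : \int[normal_prob m s]_x x = m.
Proof.
rewrite (@Rintegral_density _ _ _ mu _ pdf)//;
  [|exact: normal_pdf_ge0|exact: measurable_normal_pdf].
have i1 := ipdf1 (measurable_funB (@measurable_id _ _ setT) (measurable_cst m)) (fun x => lexx _).
have i0 := integrableZl measurableT m (integrable_normal_pdf m s).
have v : \int[mu]_x ((x - m) * pdf x) = 0.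
  apply: (@integral_vanish (fun x => - s ^+ 2 * pdf x) (fun x => (x - m) * pdf x)).
  - move=> x; have ? := is_derive_pdf x.
    have -> : (fun x => - s ^+ 2 * pdf x) = (- s ^+ 2) *: pdf by [].
    by apply: is_derive_eq; rewrite !regular_scaleE; field.
  - move=> x; apply: cvgM; last exact: cpdf.
    by apply: cvgB; [exact: cvg_id|exact: cvg_cst].
  - exact: i1.
  - rewrite -[X in _ --> X](mulr0 (- s ^+ 2)); apply: cvgMr.
    by have := pdf_cvg0 (normr1 _); under eq_fun do rewrite mul1r.
  - rewrite -[X in _ --> X](mulr0 (- s ^+ 2)); apply: cvgMr.
    by have := @pdf_cvg0 (-1); rewrite normrN1 => /(_ erefl); under eq_fun do rewrite mulN1r.
transitivity (\int[mu]_x ((x - m) * pdf x + m * pdf x)).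
  by apply: eq_Rintegral => x _; ring.
rewrite RintegralD//.
rewrite v add0r RintegralZl//; last exact: integrable_normal_pdf.
by rewrite /Rintegral integral_normal_pdf mulr1.
Qed.

Lemma integral_normal_prob_sqr :
  (\int[normal_prob m s]_x ((x - m) ^+ 2)%:E = (s ^+ 2)%:E)%E.
Proof.
rewrite (@ge0_integral_density _ _ _ mu _ pdf)//=.
- rewrite -(fineK (integrable_fin_num _ ipdf2))//=; congr EFin.
  rewrite -/(Rintegral mu setT (fun x => (x - m) ^+ 2 * pdf x)).
  have i0 := integrableZl measurableT (s ^+ 2) (integrable_normal_pdf m s).
  have v : \int[mu]_x ((x - m) ^+ 2 * pdf x - s ^+ 2 * pdf x) = 0.
    apply: (@integral_vanish (fun x => - s ^+ 2 * ((x - m) * pdf x))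
      (fun x => (x - m) ^+ 2 * pdf x - s ^+ 2 * pdf x)).
    + move=> x; have ? := is_derive_pdf x.
      have -> : (fun x => - s ^+ 2 * ((x - m) * pdf x)) =
        (- s ^+ 2) *: ((fun x => x - m) * pdf) by [].
      by apply: is_derive_eq; rewrite !regular_scaleE; field.
    + move=> x; apply: cvgB; last by apply: cvgMr; exact: cpdf.
      apply: cvgM; last exact: cpdf.
      apply: (cvg_comp (fun x => x - m) (fun x => x ^+ 2)); last exact: sqr_continuous.
      by apply: cvgB; [exact: cvg_id|exact: cvg_cst].
    + have := integrableB measurableT ipdf2 i0.
      by apply: eq_integrable => // x _; rewrite /= EFinB EFinM.
    + rewrite -[X in _ --> X](mulr0 (- s ^+ 2)); apply: cvgMr.
      have := moment_cvg0 (normr1 _); under eq_fun do rewrite mul1r.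
      by under [X in _ -> X @ _ --> _]eq_fun do rewrite addrAC subrr add0r.
    + rewrite -[X in _ --> X](mulr0 (- s ^+ 2)); apply: cvgMr.
      have := @moment_cvg0 (-1); rewrite normrN1 => /(_ erefl).
      under eq_fun do rewrite mulN1r.
      by under [X in _ -> X @ _ --> _]eq_fun do rewrite addrAC subrr add0r.
  move: v; rewrite RintegralB//.
  rewrite RintegralZl//; last exact: integrable_normal_pdf.
  rewrite {2}/Rintegral integral_normal_pdf mulr1 => v.
  by apply/eqP; rewrite -subr_eq0 v.
- exact: normal_pdf_ge0.
- exact: measurable_normal_pdf.
- apply/measurable_EFinP; apply: measurable_funX; exact: measurable_funB.
- by move=> x; rewrite lee_fin sqr_ge0.
Qed.

Variable b : R.
Let F (a : R) := \int[mu]_x (cos (a * (x - m) + b) * pdf x).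
Let phase (a : R) x := a * (x - m) + b.

Let is_derive_phase_a (a x : R) : is_derive a (1:R) (phase ^~ x) (x - m).
Proof.
apply: is_derive_eq; rewrite !regular_scaleE; ring.
Qed.

Let is_derive_phase_x (a x : R) : is_derive x (1:R) (phase a) a.
Proof.
apply: is_derive_eq; rewrite !regular_scaleE; ring.
Qed.

Let mcos a : measurable_fun setT (fun x => cos (phase a x)).
Proof.
apply: measurable_realfun.continuous_measurable_fun => x.
apply: continuous_comp; last exact: continuous_cos.
exact: (is_derive_continuous (is_derive_phase_x a)).
Qed.

Let msin a : measurable_fun setT (fun x => sin (phase a x)).
Proof.
apply: measurable_realfun.continuous_measurable_fun => x.
apply: continuous_comp; last exact: continuous_sin.
exact: (is_derive_continuous (is_derive_phase_x a)).
Qed.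

Let icos a : mu.-integrable setT (fun x => (cos (phase a x) * pdf x)%:E).
Proof.
apply: ipdf0; first exact: mcos.
by move=> x; rewrite ler_norml cos_geN1 cos_le1.
Qed.

Let ixsin a : mu.-integrable setT (fun x => ((x - m) * sin (phase a x) * pdf x)%:E).
Proof.
apply: ipdf1.
  apply: measurable_funM; [exact: measurable_funB|exact: msin].
by move=> x; rewrite normrM ler_piMr// ler_norml sin_geN1 sin_le1.
Qed.

Let is_derive_integrand (a x : R) : is_derive a (1:R)
  (fun a => cos (phase a x) * pdf x) (- ((x - m) * sin (phase a x) * pdf x)).
Proof.
have h := is_derive1_comp (is_derive_cos _) (is_derive_phase_a a x).
have -> : (fun a => cos (phase a x) * pdf x) = pdf x *: (cos \o phase ^~ x).
  by apply/funext => y /=; rewrite fctE mulrC.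
apply: is_derive_eq; rewrite !regular_scaleE; ring.
Qed.

(** Gaussian integration by parts: since [(x - m) pdf = - s^2 pdf'], the factor [x - m] is traded
    for the derivative of the sine. The function [f] is the derivative of [pdf] times the sine, so
    its integral vanishes. *)
Let ibp a : \int[mu]_x ((x - m) * sin (phase a x) * pdf x) = s ^+ 2 * a * F a.
Proof.
have s20 : s ^+ 2 != 0 by rewrite expf_neq0.
pose f x := (- (s ^+ 2)^-1) * ((x - m) * sin (phase a x) * pdf x) +
  a * (cos (phase a x) * pdf x).
have dH (x : R) : is_derive x (1:R) (fun x => pdf x * sin (phase a x)) (f x).
  have h := is_derive1_comp (is_derive_sin _) (is_derive_phase_x a x).
  have -> : (fun x => pdf x * sin (phase a x)) = pdf * (sin \o phase a).
    by apply/funext => y /=; rewrite fctE.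
  have ? := is_derive_pdf x.
  apply: is_derive_eq; rewrite /f !regular_scaleE /=.
  by field.
have i1 := integrableZl measurableT (- (s ^+ 2)^-1) (ixsin a).
have i2 := integrableZl measurableT a (icos a).
have intf : mu.-integrable setT (EFin \o f).
  have := integrableD measurableT i1 i2.
  by apply: eq_integrable => // x _; rewrite /f/= EFinD !EFinM.
have cf : continuous f.
  move=> x; apply: cvgD.
    apply: cvgMr; apply: cvgM; last exact: cpdf.
    apply: cvgM.
      by apply: cvgB; [exact: cvg_id|exact: cvg_cst].
    apply: continuous_comp; last exact: continuous_sin.
    exact: (is_derive_continuous (is_derive_phase_x a)).
  apply: cvgMr; apply: cvgM; last exact: cpdf.
  apply: continuous_comp; last exact: continuous_cos.
  exact: (is_derive_continuous (is_derive_phase_x a)).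
have lim0 (h : R) : `|h| = 1 ->
    pdf (m + h * n%:R) * sin (phase a (m + h * n%:R)) @[n --> \oo] --> (0 : R).
  move=> h1; apply: norm_cvg0.
  apply: (@squeeze_cvgr _ _ _ _ (cst 0) (fun n => pdf (m + h * n%:R))).
  - apply: nearW => n; rewrite normr_ge0/= normrM (ger0_norm (normal_pdf_ge0 _ _ _)).
    by rewrite ler_piMr ?normal_pdf_ge0// ler_norml sin_geN1 sin_le1.
  - exact: cvg_cst.
  - exact: pdf_cvg0.
have : \int[mu]_x f x = 0.
  apply: (integral_vanish dH cf intf).
  - by have := lim0 1 (normr1 _); under eq_fun do rewrite mul1r.
  - have := lim0 (-1); rewrite normrN1 => /(_ erefl).
    by under eq_fun do rewrite mulN1r.
rewrite /f RintegralD//.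
rewrite (RintegralZl (- s ^- 2) measurableT (ixsin a)).
rewrite (RintegralZl a measurableT (icos a)).
rewrite -/(F a) => e.
set I := Rintegral _ _ _ in e *.
have {}e : (s ^+ 2)^-1 * I = a * F a by lra.
by rewrite -mulrA -e mulVKf.
Qed.

(** Differentiation under the integral sign; the derivative of the integrand is at most
    [|x - m| pdf] for every [a], and [pdf_moment_bound] makes this integrable. *)
Let dF (a : R) : is_derive a (1:R) F (- (s ^+ 2 * a * F a)).
Proof.
have [C C0 hC] := pdf_moment_bound.
have aI : `]a - 1, a + 1[%classic a by rewrite /= in_itv/= ltrBlDr ltrDl ltr01.
pose G x := C * normal_pdf m (s * Num.sqrt 2) x.
have G0 x : 0 <= G x by rewrite mulr_ge0// normal_pdf_ge0.
have iG : mu.-integrable setT (EFin \o G).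
  have := integrableZl measurableT C (integrable_normal_pdf m (s * Num.sqrt 2)).
  by apply: eq_integrable => // x _; rewrite /= EFinM.
have d1E x y : partial1of2 (fun a x => cos (phase a x) * pdf x) x y =
    - ((y - m) * sin (phase x y) * pdf y).
  by rewrite partial1of2E; have [] := is_derive_integrand x y.
have GB x y : `|partial1of2 (fun a x => cos (phase a x) * pdf x) x y| <= G y.
  rewrite d1E normrN !normrM (ger0_norm (normal_pdf_ge0 _ _ _)).
  apply: le_trans (hC y); rewrite ler_wpM2r ?normal_pdf_ge0//.
  by rewrite ler_piMr// ler_norml sin_geN1 sin_le1.
have dd x y : derivable (fun a => cos (phase a y) * pdf y) x 1.
  by have [] := is_derive_integrand x y.
apply: DeriveDef.
  exact: (derivable_under_integral measurableT aI (fun x _ => icos x)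
    (fun x y _ _ => dd x y) G0 iG (fun x y _ _ => GB x y)).
rewrite -derive1E (differentiation_under_integral measurableT aI (fun x _ => icos x)
    (fun x y _ _ => dd x y) G0 iG (fun x y _ _ => GB x y)).
under eq_Rintegral do rewrite d1E -mulN1r.
by rewrite RintegralZl ?ibp ?mulN1r//; exact: ixsin.
Qed.

(** By [dF] the integral solves [F' = - s^2 a F], so that [F] times [exp (s^2 a^2 / 2)] is constant.
    The free phase [b] lets real cosines carry the information of the complex characteristic
    function. *)
Lemma Rintegral_normal_pdf_cos a :
  \int[mu]_x (cos (a * (x - m) + b) * pdf x) = cos b * expR (- (s ^+ 2 * a ^+ 2) / 2).
Proof.
pose K a := F a * expR (s ^+ 2 * a ^+ 2 / 2).
have dK (x : R) : is_derive x (1:R) K 0.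
  have h : is_derive x (1:R) (fun a => s ^+ 2 * a ^+ 2 / 2) (s ^+ 2 * x).
    by apply: is_derive_eq; rewrite !regular_scaleE; field.
  have h2 := is_derive1_comp (is_derive_expR _) h.
  have -> : K = F * (expR \o (fun a => s ^+ 2 * a ^+ 2 / 2)) by [].
  have ? := dF x.
  by apply: is_derive_eq; rewrite !regular_scaleE /=; ring.
have := is_derive_0_is_cst a 0 dK.
rewrite /K expr0n mulr0 mul0r expR0 mulr1 => e.
rewrite -[LHS]/(F a) -[F a](mulfK (lt0r_neq0 (expR_gt0 (s ^+ 2 * a ^+ 2 / 2)))).
rewrite e -expRN -mulNr; congr (_ * _).
rewrite /F; under eq_Rintegral do rewrite mul0r add0r.
rewrite RintegralZl//; last exact: integrable_normal_pdf.
by rewrite /Rintegral integral_normal_pdf mulr1.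
Qed.

Lemma Rintegral_normal_prob_cos a :
  \int[normal_prob m s]_x cos (a * (x - m) + b) = cos b * expR (- (s ^+ 2 * a ^+ 2) / 2).
Proof.
rewrite (@Rintegral_density _ _ _ mu _ pdf).
- exact: Rintegral_normal_pdf_cos.
- exact: normal_pdf_ge0.
- exact: measurable_normal_pdf.
- by [].
- exact: mcos.
Qed.

End gauss_cf.

(** * Uniqueness of the Fourier transform on the line *)

Section bounded_fubini.
Context d1 d2 (T1 : measurableType d1) (T2 : measurableType d2) (R : realType).
Variables (m1 : {finite_measure set T1 -> \bar R})
          (m2 : {finite_measure set T2 -> \bar R}).

Lemma product_measure_lty : ((m1 \x m2) setT < +oo)%E.
Proof.
rewrite -setXTT product_measure1E//.
by rewrite lte_mul_pinfty// ?fin_num_measure// ltey_eq fin_num_measure.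
Qed.

Lemma bounded_integrable2 (f : T1 * T2 -> R) (C : R) : measurable_fun setT f ->
  (forall x, `|f x| <= C) -> (m1 \x m2)%E.-integrable setT (EFin \o f).
Proof.
move=> mf fC; apply: measurable_bounded_integrable => //.
  exact: product_measure_lty.
by exists C; split; [exact: num_real|move=> x Cx y _ /=; exact: le_trans (fC y) (ltW Cx)].
Qed.

Lemma bounded_Fubini (f : T1 * T2 -> R) (C : R) : measurable_fun setT f ->
  (forall x, `|f x| <= C) ->
  \int[m1]_x (\int[m2]_y f (x, y)) = \int[m2]_y (\int[m1]_x f (x, y)).
Proof.
move=> mf fC; have if_ := bounded_integrable2 mf fC.
have fin1 x : (\int[m2]_y (f (x, y))%:E)%E \is a fin_num.
  apply: integrable_fin_num => //; apply: (@bounded_integrable _ _ _ _ _ C) => //.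
  exact: measurableT_comp.
have fin2 y : (\int[m1]_x (f (x, y))%:E)%E \is a fin_num.
  apply: integrable_fin_num => //; apply: (@bounded_integrable _ _ _ _ _ C) => //.
  exact: measurableT_comp.
rewrite /Rintegral; congr fine.
under eq_integral do rewrite fineK//.
under [RHS]eq_integral do rewrite fineK//.
exact: (Fubini if_).
Qed.

End bounded_fubini.

Section normal_concentration.
Context {R : realType}.
Local Notation mu := (@lebesgue_measure R).

(** Beyond distance [r] half of the exponent is spent on [exp (- u) <= 1 / u], where
    [u >= r^2 / (4 s^2)], and the other half is a density of total mass 1. The factor [sqrt 2] is
    the ratio of the two peaks. Only the decay as [s] tends to 0 matters. *)
Lemma normal_prob_tail (x s r : R) : 0 < s -> 0 < r ->
  (normal_prob x s [set y : R | (r <= `|y - x|)%R] <=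
    (Num.sqrt 2 * (4 * s ^+ 2 / r ^+ 2))%:E)%E.
Proof.
move=> s0 r0; set A := [set y : R | _].
have mA : measurable A.
  rewrite (_ : A = (fun y => `|y - x|) @^-1` `[r, +oo[); last first.
    by apply/seteqP; split => y /=; rewrite in_itv/= andbT.
  rewrite -[X in measurable X]setTI.
  apply: (_ : measurable_fun setT (fun y : R => `|y - x|)) => //.
  by apply: measurableT_comp => //; exact: measurable_funB.
have sn0 : s != 0 by rewrite gt_eqF.
have t0 : s * Num.sqrt 2 != 0 by rewrite mulf_neq0// sqrtr_eq0 -ltNge.
pose q := Num.sqrt 2 * (4 * s ^+ 2 / r ^+ 2) : R.
have q0 : 0 <= q by rewrite mulr_ge0// divr_ge0 ?sqr_ge0// mulr_ge0// sqr_ge0.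
have peakE : normal_peak s = Num.sqrt 2 * normal_peak (s * Num.sqrt 2).
  rewrite /normal_peak exprMn sqr_sqrtr//.
  rewrite (_ : s ^+ 2 * 2 * pi *+ 2 = (s ^+ 2 * pi *+ 2) * 2); last by ring.
  rewrite sqrtrM ?invfM 1?mulrC ?divfK//; last first.
    by rewrite mulrn_wge0// mulr_ge0 ?sqr_ge0 ?pi_ge0.
  by rewrite [RHS]mulrCA mulfV ?mulr1// sqrtr_eq0 -ltNge.
have pdfB y : A y -> normal_pdf x s y <= q * normal_pdf x (s * Num.sqrt 2) y.
  move=> Ay; rewrite (normal_pdfE _ sn0) (normal_pdfE _ t0) /normal_fun peakE.
  set z := y - x in Ay *.
  have -> : - z ^+ 2 / ((s * Num.sqrt 2) ^+ 2 *+ 2) = - z ^+ 2 / (s ^+ 2 *+ 4).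
    by rewrite exprMn sqr_sqrtr// mulr_natr -mulrnA.
  have -> : - z ^+ 2 / (s ^+ 2 *+ 2) =
     - z ^+ 2 / (s ^+ 2 *+ 4) + - z ^+ 2 / (s ^+ 2 *+ 4) by field.
  rewrite expRD; set E := expR _; set p := normal_peak _.
  have -> : Num.sqrt 2 * p * (E * E) = Num.sqrt 2 * p * E * E by rewrite !mulrA.
  have -> : q * (p * E) = Num.sqrt 2 * p * E * (4 * s ^+ 2 / r ^+ 2).
    by rewrite /q; ring.
  rewrite ler_wpM2l//; first by rewrite !mulr_ge0 ?normal_peak_ge0 ?expR_ge0.
  rewrite /E.
  set u := z ^+ 2 / (s ^+ 2 *+ 4).
  have u0 : 0 < r ^+ 2 / (s ^+ 2 *+ 4).
    by rewrite divr_gt0 ?exprn_gt0// pmulrn_lgt0// exprn_gt0.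
  have ru : r ^+ 2 / (s ^+ 2 *+ 4) <= u.
    rewrite ler_wpM2r ?invr_ge0 ?mulrn_wge0 ?sqr_ge0//.
    by rewrite -(real_normK (num_real z)) ler_sqr ?nnegrE// ltW.
  rewrite mulNr expRN.
  have -> : 4 * s ^+ 2 / r ^+ 2 = (r ^+ 2 / (s ^+ 2 *+ 4))^-1.
    by field; rewrite sn0 gt_eqF.
  rewrite lef_pV2 ?posrE ?expR_gt0//.
  by apply: le_trans ru _; apply: le_trans (expR_ge1Dx _); rewrite lerDr.
apply: (@le_trans _ _ (\int[mu]_(y in A) (q%:E * (normal_pdf x (s * Num.sqrt 2) y)%:E))%E).
  apply: ge0_le_integral => //=.
  - by move=> y _; rewrite lee_fin normal_pdf_ge0.
  - by apply/measurable_EFinP/measurable_funTS; exact: measurable_normal_pdf.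
  - apply: measurable_funeM; apply/measurable_EFinP/measurable_funTS.
    exact: measurable_normal_pdf.
rewrite ge0_integralZl//; first last.
- by move=> y _; rewrite lee_fin normal_pdf_ge0.
- by apply/measurable_EFinP/measurable_funTS; exact: measurable_normal_pdf.
rewrite -[leRHS]mule1 lee_wpmul2l ?lee_fin//.
rewrite -(integral_normal_pdf x (s * Num.sqrt 2)).
apply: ge0_subset_integral => //=.
- by apply/measurable_EFinP; exact: measurable_normal_pdf.
- by move=> y _; rewrite lee_fin normal_pdf_ge0.
Qed.

Let sigma_ n : R := n.+1%:R^-1.

Lemma normal_prob_cvg0 (x r : R) (A : set R) : 0 < r -> measurable A ->
  (forall y, A y -> r <= `|y - x|) ->
  fine (normal_prob x (sigma_ n) A) @[n --> \oo] --> (0 : R).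
Proof.
move=> r0 mA Ar.
pose K := Num.sqrt 2 * 4 / r ^+ 2 : R.
apply: (@squeeze_cvgr _ _ _ _ (cst 0) (fun n => K * (sigma_ n * sigma_ n))).
- apply: nearW => n; rewrite fine_ge0//= -lee_fin fineK ?fin_num_measure//.
  have s0 : 0 < sigma_ n by rewrite invr_gt0.
  apply: le_trans (le_trans _ (normal_prob_tail x s0 r0)) _.
    apply: le_measure; rewrite ?inE//.
    rewrite (_ : [set y | r <= `|y - x|] = (fun y => `|y - x|) @^-1` `[r, +oo[); last first.
      by apply/seteqP; split => y /=; rewrite in_itv/= andbT.
    rewrite -[X in measurable X]setTI.
    apply: (_ : measurable_fun setT (fun y : R => `|y - x|)) => //.
    by apply: measurableT_comp => //; exact: measurable_funB.
  rewrite lee_fin /K le_eqVlt; apply/orP; left; apply/eqP; field.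
  by rewrite gt_eqF.
- exact: cvg_cst.
- rewrite -[X in _ --> X](mulr0 K); apply: cvgMr.
  by rewrite -[X in _ --> X](mulr0 (0:R)); apply: cvgM; exact: cvg_harmonic.
Qed.

End normal_concentration.

Section smoothing.
Context {R : realType}.
Local Notation leb := (@lebesgue_measure R).
Variable m : {finite_measure set (measurableTypeR R) -> \bar R}.

Let measurable_cos2 (s y : R) :
  measurable_fun setT (fun p : R * R => cos ((y - p.1) / s * p.2)).
Proof.
apply: measurableT_comp => //.
  by apply: measurable_realfun.continuous_measurable_fun; exact: continuous_cos.
by apply: measurable_funM => //; apply: measurable_funM => //; exact: measurable_funB.
Qed.

Let measurable_cos1 (c : R) : measurable_fun setT (fun t : R => cos (c * t)).
Proof.
apply: measurableT_comp => //.
by apply: measurable_realfun.continuous_measurable_fun; exact: continuous_cos.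
Qed.

Let measurable_pdf_mean (s y : R) : s != 0 ->
  measurable_fun setT (fun x => normal_pdf x s y).
Proof.
move=> s0; rewrite /normal_pdf (negbTE s0).
apply: measurable_funM => //; apply: measurableT_comp => //.
apply: measurable_funM => //; apply: measurableT_comp => //.
by apply: measurable_funX; exact: measurable_funB.
Qed.

(** Up to its peak, the normal density is the characteristic function of a standard normal variable
    at [(y - x) / s]. After the integrals are exchanged, the convolution of [m] with a normal law is
    seen to depend on [m] only through its cosine transform. *)
Lemma Rintegral_normal_pdf_fourier (s y : R) : s != 0 ->
  \int[m]_x normal_pdf x s y = normal_peak s *
    \int[normal_prob 0 1]_a (\int[m]_x cos (- (a / s) * x + a * y / s)).
Proof.
move=> s0.
have pdfE x : normal_pdf x s y =
    normal_peak s * \int[normal_prob 0 1]_a cos ((y - x) / s * a).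
  rewrite (normal_pdfE _ s0); congr (_ * _).
  have := Rintegral_normal_prob_cos 0 (oner_neq0 R) 0 ((y - x) / s).
  under eq_Rintegral do rewrite subr0 addr0.
  move=> ->; rewrite cos0 mul1r /normal_fun; congr expR.
  by field.
under eq_Rintegral do rewrite pdfE.
rewrite RintegralZl//.
  congr (_ * _).
  apply: etrans (@bounded_Fubini _ _ _ _ _ m (normal_prob 0 1)
    (fun p : R * R => cos ((y - p.1) / s * p.2)) 1 (measurable_cos2 s y) _) _.
    by move=> p; rewrite ler_norml cos_geN1 cos_le1.
  apply: eq_Rintegral => a _; apply: eq_Rintegral => x _.
  have aux (p q : R) : (y - q) / s * p = - (p / s) * q + p * y / s by field.
  by rewrite /= aux.
apply: (@bounded_integrable _ _ _ _ _ 1).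
  have mp : measurable_fun setT (fun x => (normal_peak s)^-1 * normal_pdf x s y).
    by apply: measurable_funM => //; exact: measurable_pdf_mean.
  apply: eq_measurable_fun mp => x _.
  by rewrite pdfE mulKf// gt_eqF// normal_peak_gt0.
move=> x; apply: le_trans (le_normr_Rintegral _ _) _ => //.
  apply: (@bounded_integrable _ _ _ _ _ 1).
    exact: measurable_cos1.
  by move=> p; rewrite ler_norml cos_geN1 cos_le1.
apply: (@le_trans _ _ (\int[normal_prob 0 1]_(a in [set: R]) (1:R))).
  apply: le_Rintegral => //.
  - apply: (@bounded_integrable _ _ _ _ _ 1).
      apply: measurableT_comp => //.
      exact: measurable_cos1.
    by move=> p; rewrite normr_id ler_norml cos_geN1 cos_le1.
  - by apply: (@bounded_integrable _ _ _ _ _ 1) => // p /=; rewrite normr1.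
  - by move=> p _; rewrite ler_norml cos_geN1 cos_le1.
rewrite Rintegral_cst// [X in fine X](_ : _ = 1%E) ?mul1r//.
exact: integral_normal_pdf.
Qed.

Let measurable_pdf2 (s : R) : s != 0 ->
  measurable_fun setT (fun p : R * R => normal_pdf p.1 s p.2).
Proof.
move=> s0; rewrite /normal_pdf (negbTE s0).
apply: measurable_funM => //; apply: measurableT_comp => //.
apply: measurable_funM => //; apply: measurableT_comp => //.
by apply: measurable_funX; exact: measurable_funB.
Qed.

Let measurable_pdf_patch (s : R) (A : set R) : s != 0 -> measurable A ->
  measurable_fun setT (fun p : R * R => ((EFin \o normal_pdf p.1 s) \_ A) p.2).
Proof.
move=> s0 mA.
rewrite (_ : (fun p : R * R => _) =
     (EFin \o (fun p : R * R => normal_pdf p.1 s p.2)) \_ (snd @^-1` A)).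
    apply/measurable_restrict => //.
      by rewrite -[X in measurable X]setTI; exact: measurable_snd.
    by apply: measurable_funTS; apply/measurable_EFinP; exact: measurable_pdf2.
  apply/funext => p; rewrite /patch.
  have -> : (p \in snd @^-1` A) = (p.2 \in A) by apply/idP/idP; rewrite !inE.
  by [].
Qed.

Lemma integral_normal_prob_fun (s : R) (A : set R) : s != 0 -> measurable A ->
  (\int[m]_x normal_prob x s A =
   \int[leb]_(y in A) (\int[m]_x normal_pdf x s y)%:E)%E.
Proof.
move=> s0 mA; rewrite /normal_prob.
under eq_integral do rewrite integral_mkcond.
rewrite (sfinite_Fubini m leb (fun p => ((EFin \o normal_pdf p.1 s) \_ A) p.2)).
- rewrite [RHS]integral_mkcond; apply: eq_integral => y _.
  rewrite /restrict /=; case: ifPn => yA.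
    rewrite /Rintegral fineK//; apply: integrable_fin_num => //.
    apply: (@bounded_integrable _ _ _ _ _ (normal_peak s)).
      exact: measurable_pdf_mean.
    by move=> x; rewrite ger0_norm ?normal_pdf_ge0// normal_pdf_ub.
  by rewrite integral0.
- move=> p; rewrite /restrict; case: ifPn => // _; rewrite lee_fin.
  exact: normal_pdf_ge0.
- exact: measurable_pdf_patch.
Qed.

Lemma measurable_normal_prob_mean (s : R) (A : set R) : s != 0 -> measurable A ->
  measurable_fun setT (fun x : R => normal_prob x s A).
Proof.
move=> s0 mA; rewrite /normal_prob.
under eq_fun do rewrite integral_mkcond.
apply: (@measurable_fun_fubini_tonelli_F _ _ _ _ _ leb
  (fun p : R * R => ((EFin \o normal_pdf p.1 s) \_ A) p.2)).
- exact: measurable_pdf_patch.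
- move=> p; rewrite /restrict; case: ifPn => // _; rewrite lee_fin.
  exact: normal_pdf_ge0.
Qed.

End smoothing.

Section fourier_uniqueness.
Context {R : realType}.
Implicit Types m : {finite_measure set (measurableTypeR R) -> \bar R}.

Let sigma_ n : R := n.+1%:R^-1.

Let sigma_neq0 n : sigma_ n != 0.
Proof. by rewrite invr_neq0. Qed.

(** The mass given to [A] by the convolution of [m] with the centered normal law of deviation
    [1 / (n + 1)]. *)
Let mass m (A : set R) n := \int[m]_x fine (normal_prob x (sigma_ n) A).

Let mass_eq m1 m2 (A : set R) n : measurable A ->
  (forall a c, \int[m1]_x cos (a * x + c) = \int[m2]_x cos (a * x + c)) ->
  mass m1 A n = mass m2 A n.
Proof.
move=> mA h; rewrite /mass /Rintegral; congr fine.
under eq_integral do rewrite fineK ?fin_num_measure//.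
under [RHS]eq_integral do rewrite fineK ?fin_num_measure//.
rewrite !integral_normal_prob_fun//; apply: eq_integral => y _.
rewrite !Rintegral_normal_pdf_fourier//; congr (_ * _)%:E.
by apply: eq_Rintegral => a _; rewrite h.
Qed.

Let measurable_normal_prob (A : set R) n : measurable A ->
  measurable_fun setT (fun x : R => fine (normal_prob x (sigma_ n) A)).
Proof.
move=> mA; apply: measurableT_comp => //; exact: measurable_normal_prob_mean.
Qed.

Let normal_prob_le1 (A : set R) n (x : R) : measurable A ->
  0 <= fine (normal_prob x (sigma_ n) A) <= 1.
Proof.
move=> mA; rewrite fine_ge0//= -lee_fin fineK ?fin_num_measure//.
exact: probability_le1.
Qed.

(** As the deviation shrinks, the smoothed indicator [F n] of the closed interval tends to 1 on the
    open one and to 0 outside the closed one. The endpoints are left undecided, whence an open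
    interval on one side and a closed one on the other. *)
Let open_le_closed m1 m2 (u w : R) :
  (forall a c, \int[m1]_x cos (a * x + c) = \int[m2]_x cos (a * x + c)) ->
  (m1 `]u, w[%classic <= m2 `[u, w]%classic)%E.
Proof.
move=> h; pose C : set R := `[u, w]%classic; pose U : set R := `]u, w[%classic.
have mC : measurable C by exact: measurable_itv.
have mU : measurable U by exact: measurable_itv.
pose F n (x : R) := fine (normal_prob x (sigma_ n) C).
have F01 n x : 0 <= F n x <= 1 by exact: normal_prob_le1.
have mF n : measurable_fun setT (F n) by exact: measurable_normal_prob.
have iF m n : m.-integrable setT (EFin \o F n).
  apply: (@bounded_integrable _ _ _ _ _ 1); first exact: mF.
  by move=> x; case/andP: (F01 n x) => ? ?; rewrite ger0_norm.
have mFI n (A : set R) : measurable A -> measurable_fun setT (fun x => F n x * \1_A x).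
  by move=> mA; apply: measurable_funM; [exact: mF|exact: measurable_indic].
have FI1 n (A : set R) x : `|F n x * \1_A x| <= 1.
  case/andP: (F01 n x) => ? ?.
  by rewrite normrM !ger0_norm// mulr_ile1// indicE; case: (_ \in _).
have iFI m n (A : set R) : measurable A ->
    m.-integrable setT (EFin \o (fun x => F n x * \1_A x)).
  by move=> mA; apply: (@bounded_integrable _ _ _ _ _ 1) => //; exact: mFI.
have mCC : measurable (~` C) by exact: measurableC.
have FU : \int[m1]_x (F n x * \1_U x) @[n --> \oo] --> \int[m1]_x (\1_U x : R).
  apply: (@bounded_cvg_Rintegral _ _ _ _ _ _ 1) => //.
  - by move=> n; exact: mFI.
  - apply: aeW => x /=; rewrite indicE; case: (boolP (x \in U)) => xU; last first.
      by under eq_fun do rewrite mulr0; exact: cvg_cst.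
    under eq_fun do rewrite mulr1.
    have FC n : F n x = 1 - fine (normal_prob x (sigma_ n) (~` C)).
      by rewrite probability_setC// fineB ?fin_num_measure//= opprB addrC subrK.
    under eq_fun do rewrite FC.
    suff : (1 - fine (normal_prob x (sigma_ n) (~` C))) @[n --> \oo] --> (1 - 0 : R).
      by rewrite subr0.
    apply: cvgB; first exact: cvg_cst.
    move: xU; rewrite inE /U/= in_itv/= => /andP[ux xw].
    apply: (@normal_prob_cvg0 _ x (Num.min (x - u) (w - x))).
    + by rewrite lt_min !subr_gt0 ux.
    + exact: measurableC.
    + move=> y; rewrite /C /= in_itv/= => /negP; rewrite negb_and -!ltNge.
      move=> /orP[yu|wy]; rewrite ge_min; apply/orP.
        by left; rewrite ler_normr; apply/orP; right; lra.
      by right; rewrite ler_normr; apply/orP; left; lra.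
have FC : \int[m2]_x (F n x * \1_(~` C) x) @[n --> \oo] --> \int[m2]_x (0 : R).
  apply: (@bounded_cvg_Rintegral _ _ _ _ _ _ 1) => //.
  - by move=> n; exact: mFI.
  - apply: aeW => x /=; rewrite indicE; case: (boolP (x \in ~` C)) => xC; last first.
      by under eq_fun do rewrite mulr0; exact: cvg_cst.
    under eq_fun do rewrite mulr1.
    move: xC; rewrite inE /C /= in_itv/= => /negP; rewrite negb_and -!ltNge => xC.
    apply: (@normal_prob_cvg0 _ x (Num.max (u - x) (x - w))) => //.
    + by rewrite lt_max !subr_gt0.
    + move=> y; rewrite /C /= in_itv/= => /andP[uy yw].
      rewrite ge_max; apply/andP; split; rewrite ler_normr; apply/orP.
        by left; lra.
      by right; lra.
have i1 (m : {finite_measure set (measurableTypeR R) -> \bar R}) (A : set R) :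
    measurable A -> m A = (\int[m]_x (\1_A x : R))%:E.
  move=> mA; rewrite /Rintegral integral_indic// setIT fineK//.
  exact: fin_num_measure.
have key n : \int[m1]_x (F n x * \1_U x) <=
    \int[m2]_x (\1_C x : R) + \int[m2]_x (F n x * \1_(~` C) x).
  apply: (@le_trans _ _ (mass m1 C n)).
    apply: le_Rintegral => //.
    - exact: iFI.
    - exact: iF.
    - move=> x _; case/andP: (F01 n x) => ? ?.
      by rewrite ler_piMr// indicE; case: (_ \in _).
  rewrite (mass_eq n mC h) -RintegralD//; last 2 first.
  - apply: (@bounded_integrable _ _ _ _ _ 1) => // x.
    by rewrite ger0_norm// indicE; case: (_ \in _).
  - exact: iFI.
  apply: le_Rintegral => //.
  - exact: iF.
  - apply: (@bounded_integrable _ _ _ _ _ 2).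
      by apply: measurable_funD => //; exact: mFI.
    move=> x; apply: le_trans (ler_normD _ _) _.
    by rewrite -[leRHS]/(1 + 1) lerD ?FI1// ger0_norm// indicE; case: (_ \in _).
  - move=> x _; case/andP: (F01 n x) => ? ?.
    by rewrite !indicE in_setC; case: (x \in C); rewrite /= ?mulr0 ?mulr1 ?addr0 ?add0r.
rewrite !i1// lee_fin.
have -> : \int[m2]_x (\1_C x : R) = \int[m2]_x (\1_C x : R) + \int[m2]_x (0 : R).
  by rewrite Rintegral_cst// mul0r addr0.
apply: (ler_cvg_to FU (cvgD (cvg_cst (\int[m2]_x (\1_C x : R))) FC)).
exact: nearW.
Qed.

Lemma fourier_uniqueness m1 m2 :
  (forall a c, \int[m1]_x cos (a * x + c) = \int[m2]_x cos (a * x + c)) ->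
  forall A, measurable A -> m1 A = m2 A.
Proof.
move=> h.
have le12 (n1 n2 : {finite_measure set (measurableTypeR R) -> \bar R}) : (forall a c, \int[n1]_x cos (a * x + c) = \int[n2]_x cos (a * x + c)) ->
    forall u w : R, (n1 `]u, w[%classic <= n2 `]u, w[%classic)%E.
  (* The closure of [F k] still lies in []u, w[], which absorbs the closed interval of
     [open_le_closed]. *)
  move=> h12 u w; pose F k : set R := `]u + sigma_ k, w - sigma_ k[%classic.
  have FE : `]u, w[%classic = \bigcup_k F k.
    apply/seteqP; split => [x|x [k _]]; rewrite /F /= !in_itv/=.
      move=> /andP[ux xw].
      have e0 : 0 < Num.min (x - u) (w - x) by rewrite lt_min !subr_gt0 ux.
      have [k _ /(_ k (leqnn k))] := near_infty_natSinv_lt (PosNum e0).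
      rewrite /= lt_min -/(sigma_ k) => /andP[k1 k2]; exists k => //=.
      rewrite in_itv/=; set e := sigma_ k in k1 k2 *.
      by apply/andP; split; lra.
    have : 0 < sigma_ k by rewrite invr_gt0.
    by move=> s0 /andP[? ?]; apply/andP; split; lra.
  have mF k : measurable (F k) by exact: measurable_itv.
  have ndF : {homo F : n m / (n <= m)%N >-> (n <= m)%O}.
    move=> k l kl; rewrite subsetEset => x; rewrite /F /= !in_itv/= => /andP[? ?].
    have : sigma_ l <= sigma_ k by rewrite lef_pV2 ?posrE// ler_nat.
    by move=> ?; apply/andP; split; lra.
  have := @nondecreasing_cvg_mu _ _ _ n1 F mF; rewrite -FE.
  move=> /(_ (measurable_itv _) ndF) cF.
  rewrite -(cvg_lim _ cF)//; apply: lime_le; first by apply/cvg_ex; eexists; exact: cF.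
  apply: nearW => k /=; apply: le_trans (open_le_closed _ _ h12) _.
  apply: le_measure; rewrite ?inE; [exact: measurable_itv..|].
  have : 0 < sigma_ k by rewrite invr_gt0.
  move=> s0 x; rewrite /= !in_itv/= => /andP[? ?].
  by apply/andP; split; lra.
apply: (@measure_unique _ R (measurableTypeR R) (@RGenOpens.G R)
  (fun n => `](- n%:R)%R, n%:R[%classic)).
- exact: RGenOpens.measurableE.
- move=> _ _ [a [b ->]] [c [e ->]]; exists (Num.max a c), (Num.min b e).
  apply/seteqP; split => x; rewrite /= !in_itv/= gt_max lt_min.
    by move=> [/andP[-> ->] /andP[-> ->]].
  by move=> /andP[/andP[-> ->] /andP[-> ->]].
- by move=> n; exists (- n%:R), n%:R.
- rewrite -subTset => x _; have [n _ /(_ n (leqnn n)) h'] := nbhs_infty_gtr `|x|.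
  by exists n => //=; rewrite in_itv/= -ltr_norml.
- by move=> _ [a [b ->]]; apply/eqP; rewrite eq_le !le12.
- by move=> n; rewrite ltey_eq fin_num_measure//; exact: measurable_itv.
Qed.

End fourier_uniqueness.

(** * Laws of random functions *)

Section image_measure.
Context d1 d2 (X : measurableType d1) (Y : measurableType d2) (R : realType).
Variables (m : {measure set X -> \bar R}) (f : X -> Y).
Hypothesis mf : measurable_fun setT f.

Definition image_measure : {measure set Y -> \bar R} :=
  measure_function_pushforward__canonical__measure_function_Measure m mf.

Lemma ge0_integral_image (g : Y -> \bar R) : measurable_fun setT g ->
  (forall y, 0 <= g y)%E ->
  (\int[image_measure]_y g y = \int[m]_x g (f x))%E.
Proof.
by move=> mg g0; rewrite (ge0_integral_pushforward mf)// preimage_setT.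
Qed.

Lemma Rintegral_image (g : Y -> R) : measurable_fun setT g ->
  \int[image_measure]_y g y = \int[m]_x g (f x).
Proof.
move=> mg; have mgE : measurable_fun setT (EFin \o g) by exact/measurable_EFinP.
rewrite /Rintegral integralE [in RHS]integralE.
rewrite ge0_integral_image//; last exact: measurable_funepos.
rewrite ge0_integral_image//; last exact: measurable_funeneg.
by congr (fine (_ - _)); apply: eq_integral => x _; rewrite ?funeposE ?funenegE.
Qed.

End image_measure.

Section weighted_law.
Context d (T : measurableType d) (R : realType) (P : {finite_measure set T -> \bar R}).

Lemma measure_finite_ex d' (T' : measurableType d') (m : {measure set T' -> \bar R}) :
  (m setT < +oo)%E ->
  exists m' : {finite_measure set T' -> \bar R}, forall A, m' A = m A.
Proof.
move=> mT.
have fm : fin_num_fun m.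
  move=> A mA; rewrite ge0_fin_numE//; apply: le_lt_trans mT.
  by apply: le_measure; rewrite ?inE.
have sg : sigma_finite setT m by apply: fin_num_fun_sigma_finite; rewrite ?measure0.
pose H1 := isFinite.Build _ _ _ _ fm.
pose H2 := isSFinite.Build _ _ _ _ (sfinite_measure_sigma_finite sg).
pose H3 := isSigmaFinite.Build _ _ _ _ sg.
by exists (HB.pack_for (FiniteMeasure.type T' R) (Measure.sort m) H1 H2 H3).
Qed.

Lemma density_measure_ex (U : T -> R) : measurable_fun setT U ->
  (forall o, 0 <= U o) ->
  exists m : {measure set T -> \bar R},
    forall A, measurable A -> m A = (\int[P]_(o in A) (U o)%:E)%E.
Proof.
move=> mU U0; pose m0 (A : set T) := (\int[P]_(o in A) (U o)%:E)%E.
have m00 : m0 set0 = 0%E by rewrite /m0 integral_set0.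
have m0_ge0 A : (0 <= m0 A)%E.
  by apply: integral_ge0 => o _; rewrite lee_fin.
have m0_sa : semi_sigma_additive m0.
  move=> A mA tA mUA; rewrite /m0 ge0_integral_bigcup//.
  - apply: is_cvg_ereal_nneg_natsum_cond => n _ _; exact: m0_ge0.
  - by apply: measurable_funTS; exact/measurable_EFinP.
  - by move=> o _; rewrite lee_fin.
pose M := isMeasure.Build _ _ _ m0 m00 m0_ge0 m0_sa.
by exists (HB.pack_for (Measure.type T R) m0 M).
Qed.

(** The law of [X] under the measure [U dP]. With such weights the one-dimensional uniqueness
    theorem can be applied to one coordinate at a time. *)
Lemma weighted_law_ex (U X : T -> R) (C : R) : measurable_fun setT U ->
  measurable_fun setT X -> (forall o, 0 <= U o <= C) ->
  exists m : {finite_measure set (measurableTypeR R) -> \bar R},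
  forall h : R -> R, measurable_fun setT h ->
    \int[m]_x h x = \int[P]_o (U o * h (X o)).
Proof.
move=> mU mX UC.
have U0 o : 0 <= U o by case/andP: (UC o).
have [m mE] := density_measure_ex mU U0.
have iU : P.-integrable setT (EFin \o U).
  apply: (@bounded_integrable _ _ _ _ _ C) => // o.
  by case/andP: (UC o) => ? ?; rewrite ger0_norm.
have mfin : (m setT < +oo)%E.
  rewrite mE//; case/integrableP: iU => _; apply: le_lt_trans.
  by rewrite le_eqVlt; apply/orP; left; apply/eqP/eq_integral => o _ /=; rewrite ger0_norm.
have [m' m'E] := measure_finite_ex mfin.
have mX' : measurable_fun setT (X : T -> measurableTypeR R) := mX.
have [nu nuE] : exists nu : {finite_measure set (measurableTypeR R) -> \bar R},
    forall A, nu A = image_measure m mX' A.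
  exact: measure_finite_ex.
exists nu => h mh.
transitivity (\int[image_measure m mX']_x h x).
  by rewrite /Rintegral; congr fine; apply: eq_measure_integral => A mA _; exact: nuE.
rewrite Rintegral_image// (@Rintegral_density _ _ _ P _ U)//.
  by apply: eq_Rintegral => o _; rewrite mulrC.
exact: (measurableT_comp mh mX).
Qed.

End weighted_law.

Section path_space.
Variables (R : realType) (I : Type).

(** A list may name a coordinate several times, so concatenation gives intersections; the cylinders
    thus form a pi-system over an arbitrary index type. *)
Fixpoint cylinder (l : seq (I * set R)) : set (I -> R) :=
  if l is p :: l' then [set w | p.2 (w p.1)] `&` cylinder l' else setT.

Fixpoint measurable_base (l : seq (I * set R)) : Prop :=
  if l is p :: l' then measurable p.2 /\ measurable_base l' else True.

Definition cylinders : set (set (I -> R)) :=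
  [set cylinder l | l in measurable_base].

Definition path_space := g_sigma_algebraType cylinders.

Lemma cylinder_cat l1 l2 : cylinder (l1 ++ l2) = cylinder l1 `&` cylinder l2.
Proof. by elim: l1 => [|p l1 IH]/=; rewrite ?setTI// IH setIA. Qed.

Lemma measurable_base_cat l1 l2 :
  measurable_base l1 -> measurable_base l2 -> measurable_base (l1 ++ l2).
Proof. by elim: l1 => [|p l1 IH]//= [? /IH h] /h. Qed.

Lemma measurable_eval (i : I) : measurable_fun setT (fun w : path_space => w i).
Proof.
move=> _ A mA; rewrite setTI; apply: sub_sigma_algebra.
by exists [:: (i, A)] => //=; rewrite setIT.
Qed.

Lemma measurable_to_path d (T : measurableType d) (X : I -> T -> R) :
  (forall i, measurable_fun setT (X i)) ->
  measurable_fun setT (fun o => (X ^~ o) : path_space).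
Proof.
move=> mX; apply: (@measurability _ _ _ path_space _ _ cylinders) => //.
move=> _ [_ [l ml <-] <-]; rewrite setTI.
elim: l ml => [_|p l IH [mp /IH ml]] /=; first by rewrite preimage_setT.
rewrite preimage_setI; apply: measurableI => //.
by rewrite -[X in measurable X]setTI; exact: mX.
Qed.

End path_space.

Section law_equality.
Context d d' (T : measurableType d) (T' : measurableType d') (R : realType).
Variables (P : {finite_measure set T -> \bar R}) (P' : {finite_measure set T' -> \bar R}).
Variables (I : Type) (X : I -> T -> R) (X' : I -> T' -> R).
Hypothesis mX : forall i, measurable_fun setT (X i).
Hypothesis mX' : forall i, measurable_fun setT (X' i).

Definition lin (U : Type) (Y : I -> U -> R) (ls : seq (R * I)) (o : U) : R :=
  \sum_(p <- ls) p.1 * Y p.2 o.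

Hypothesis char_eq : forall ls b,
  \int[P]_o cos (lin X ls o + b) = \int[P']_o cos (lin X' ls o + b).

Let measurable_lin d0 (U : measurableType d0) (Y : I -> U -> R) ls b :
  (forall i, measurable_fun setT (Y i)) ->
  measurable_fun setT (fun o => cos (lin Y ls o + b)).
Proof.
move=> mY; apply: measurableT_comp.
  by apply: measurable_realfun.continuous_measurable_fun; exact: continuous_cos.
apply: measurable_funD => //; rewrite /lin.
by apply: measurable_sum => p; exact: measurable_funM.
Qed.

Let path d0 (U : measurableType d0) (Y : I -> U -> R) (o : U) : path_space R I := Y ^~ o.

Let cylI d0 (U : measurableType d0) (Y : I -> U -> R) l (o : U) : R :=
  \1_(cylinder l) (path Y o).

Let cylI01 d0 (U : measurableType d0) (Y : I -> U -> R) l (o : U) :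
  0 <= cylI Y l o <= 1.
Proof. by rewrite /cylI indicE; case: (_ \in _); rewrite lexx ler01. Qed.

Let measurable_cylI d0 (U : measurableType d0) (Y : I -> U -> R) l :
  (forall i, measurable_fun setT (Y i)) -> measurable_base l ->
  measurable_fun setT (cylI Y l).
Proof.
move=> mY ml; apply: (@measurableT_comp _ _ _ _ _ _ (\1_(cylinder l) : path_space R I -> R)).
  by apply: measurable_indic; apply: sub_sigma_algebra; exists l.
exact: measurable_to_path.
Qed.

Let cosD (x y : R) : cos x * cos y = 2^-1 * cos (x + y) + 2^-1 * cos (x - y).
Proof. by rewrite cosB cosD; field. Qed.

(** The product formula for cosines turns the transform of a weighted law into characteristic
    functions of longer linear combinations, which the induction of [cyl_char_eq] already
    controls. *)
Let weighted_cos d0 (U : measurableType d0) (Q : {finite_measure set U -> \bar R})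
    (Y : I -> U -> R) l ls b i a c :
  (forall i, measurable_fun setT (Y i)) -> measurable_base l ->
  \int[Q]_o (cylI Y l o * (1 + cos (lin Y ls o + b)) * cos (a * Y i o + c)) =
  \int[Q]_o (cylI Y l o * cos (lin Y [:: (a, i)] o + c)) +
  2^-1 * \int[Q]_o (cylI Y l o * cos (lin Y ((a, i) :: ls) o + (b + c))) +
  2^-1 * \int[Q]_o (cylI Y l o * cos (lin Y ((- a, i) :: ls) o + (b - c))).
Proof.
move=> mY ml.
have ii ls' b' : Q.-integrable setT (EFin \o (fun o => cylI Y l o * cos (lin Y ls' o + b'))).
  apply: (@bounded_integrable _ _ _ _ _ 1).
    by apply: measurable_funM; [exact: measurable_cylI|exact: measurable_lin].
  move=> o; case/andP: (cylI01 Y l o) => ? ?.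
  rewrite normrM ger0_norm// mulr_ile1// ?normr_ge0//.
  by rewrite ler_norml cos_geN1 cos_le1.
have ii2 ls' b' : Q.-integrable setT (EFin \o (fun o => 2^-1 * (cylI Y l o * cos (lin Y ls' o + b')))).
  have := integrableZl measurableT (2^-1 : R) (ii ls' b').
  by apply: eq_integrable => // o _; rewrite /= EFinM.
have ii3 ls1 b1 ls2 b2 : Q.-integrable setT (EFin \o (fun o => cylI Y l o * cos (lin Y ls1 o + b1)
    + 2^-1 * (cylI Y l o * cos (lin Y ls2 o + b2)))).
  have := integrableD measurableT (ii ls1 b1) (ii2 ls2 b2).
  by apply: eq_integrable => // o _; rewrite /= EFinD.
rewrite -!RintegralZl// -RintegralD// -RintegralD//.
apply: eq_Rintegral => o _.
rewrite mulrDr mulr1 mulrDl -[X in _ + X]mulrA cosD.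
rewrite /lin !big_cons big_nil addr0 /=.
set L := \sum_(j <- ls) _.
rewrite (_ : L + b + (a * Y i o + c) = a * Y i o + L + (b + c)); last by ring.
rewrite (_ : L + b - (a * Y i o + c) = - a * Y i o + L + (b - c)); last by ring.
by ring.
Qed.

(** Each induction step adds the indicator of a set in one more coordinate. The weight [1 + cos] is
    used instead of [cos] because it is nonnegative: it defines a finite measure, and uniqueness on
    the line applies to the law of the new coordinate under it. *)
Let cyl_char_eq l : measurable_base l -> forall ls b,
  \int[P]_o (cylI X l o * cos (lin X ls o + b)) =
  \int[P']_o (cylI X' l o * cos (lin X' ls o + b)).
Proof.
elim: l => [_|[i A] l IH [/= mA ml]] ls b.
  under eq_Rintegral do rewrite /cylI /= indicT mul1r.
  by under [RHS]eq_Rintegral do rewrite /cylI /= indicT mul1r.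
have {}IH := IH ml.
have key ls' b' :
    \int[P]_o (cylI X l o * (1 + cos (lin X ls' o + b')) * \1_A (X i o)) =
    \int[P']_o (cylI X' l o * (1 + cos (lin X' ls' o + b')) * \1_A (X' i o)).
  pose U0 d0 (U : measurableType d0) (Y : I -> U -> R) (o : U) :=
    cylI Y l o * (1 + cos (lin Y ls' o + b')).
  have U02 d0 (U : measurableType d0) (Y : I -> U -> R) (o : U) :
      0 <= U0 _ _ Y o <= 2.
    case/andP: (cylI01 Y l o) => c0 c1; rewrite /U0.
    have := cos_geN1 (lin Y ls' o + b'); have := cos_le1 (lin Y ls' o + b').
    move=> h1 h2; set e := 1 + _.
    have e0 : 0 <= e by rewrite /e; lra.
    have e2 : e <= 2 by rewrite /e; lra.
    by rewrite mulr_ge0//= -[leRHS]mul1r ler_pM.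
  have mU0 d0 (U : measurableType d0) (Y : I -> U -> R) :
      (forall i, measurable_fun setT (Y i)) -> measurable_fun setT (U0 _ _ Y).
    move=> mY; apply: measurable_funM; first exact: measurable_cylI.
    by apply: measurable_funD => //; exact: measurable_lin.
  have [m mE] := weighted_law_ex P (mU0 _ _ _ mX) (mX i) (U02 _ _ X).
  have [m' m'E] := weighted_law_ex P' (mU0 _ _ _ mX') (mX' i) (U02 _ _ X').
  have mcos (a c : R) : measurable_fun setT (fun x : R => cos (a * x + c)).
    apply: measurableT_comp => //.
      by apply: measurable_realfun.continuous_measurable_fun; exact: continuous_cos.
    by apply: measurable_funD.
  have mm' : forall A, measurable A -> m A = m' A.
    apply: fourier_uniqueness => a c.
    rewrite mE// m'E// /U0 !weighted_cos//.
    by congr (_ + _ * _ + _ * _); exact: IH.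
  rewrite -[LHS](mE (\1_A))// -[RHS](m'E (\1_A))// /Rintegral; congr fine.
  by apply: eq_measure_integral => B mB _; exact: mm'.
(* The cosine is recovered from the weights: for the empty combination the weight is
   [1 + cos 0 = 2], and half of it is subtracted. *)
have split d0 (U : measurableType d0) (Q : {finite_measure set U -> \bar R})
    (Y : I -> U -> R) : (forall i, measurable_fun setT (Y i)) ->
    \int[Q]_o (cylI Y ((i, A) :: l) o * cos (lin Y ls o + b)) =
    \int[Q]_o (cylI Y l o * (1 + cos (lin Y ls o + b)) * \1_A (Y i o)) -
    2^-1 * \int[Q]_o (cylI Y l o * (1 + cos (lin Y [::] o + 0)) * \1_A (Y i o)).
  move=> mY.
  have ii ls' b' : Q.-integrable setT (EFin \o (fun o => cylI Y l o *
      (1 + cos (lin Y ls' o + b')) * \1_A (Y i o))).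
    apply: (@bounded_integrable _ _ _ _ _ 2).
      apply: measurable_funM; last first.
        by apply: (@measurableT_comp _ _ _ _ _ _ (\1_A : R -> R)).
      apply: measurable_funM; first exact: measurable_cylI.
      by apply: measurable_funD => //; exact: measurable_lin.
    move=> o; case/andP: (cylI01 Y l o) => c0 c1.
    have := cos_geN1 (lin Y ls' o + b'); have := cos_le1 (lin Y ls' o + b').
    move=> h1 h2; rewrite indicE; case: (_ \in _); rewrite ?mulr0 ?normr0// mulr1.
    set e := 1 + _.
    have e0 : 0 <= e by rewrite /e; lra.
    have e2 : e <= 2 by rewrite /e; lra.
    by rewrite ger0_norm ?mulr_ge0// -[leRHS]mul1r ler_pM.
  rewrite -RintegralZl// -RintegralB//; last first.
    have := integrableZl measurableT (2^-1 : R) (ii [::] 0).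
    by apply: eq_integrable => // o _; rewrite /= EFinM.
  apply: eq_Rintegral => o _.
  rewrite /lin big_nil addr0 cos0.
  have -> : cylI Y ((i, A) :: l) o = \1_A (Y i o) * cylI Y l o.
    by rewrite /cylI /= indicI /= !indicE; congr ((_ %:R) * _); apply/idP/idP; rewrite !inE.
  rewrite -[1 + 1]/(2%:R).
  by field.
by rewrite !split// !key.
Qed.

Lemma law_eq (Phi : path_space R I -> \bar R) : measurable_fun setT Phi ->
  (forall w, (0 <= Phi w)%E) ->
  (\int[P]_o Phi (X ^~ o) = \int[P']_o Phi (X' ^~ o))%E.
Proof.
move=> mPhi Phi0.
have mp : measurable_fun setT (path X) by exact: measurable_to_path.
have mp' : measurable_fun setT (path X') by exact: measurable_to_path.
rewrite -(ge0_integral_image P mp mPhi Phi0) -(ge0_integral_image P' mp' mPhi Phi0).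
apply: eq_measure_integral => A mA _.
apply: (@measure_unique _ R (path_space R I) (@cylinders R I) (fun=> setT)) => //.
- by move=> _ _ [l1 ml1 <-] [l2 ml2 <-]; exists (l1 ++ l2);
    [exact: measurable_base_cat|rewrite cylinder_cat].
- by move=> _; exists [::].
- by rewrite bigcup_const//; exists 0%N.
- move=> _ [l ml <-].
  have e d0 (U : measurableType d0) (Q : {finite_measure set U -> \bar R})
      (Y : I -> U -> R) : (forall i, measurable_fun setT (Y i)) ->
      Q (path Y @^-1` cylinder l) =
      (\int[Q]_o (cylI Y l o * cos (lin Y [::] o + 0)))%:E.
    move=> mY; have mc : measurable (path Y @^-1` cylinder l).
      rewrite -[X in measurable X]setTI; apply: (measurable_to_path mY) => //.
      by apply: sub_sigma_algebra; exists l.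
    under eq_Rintegral do rewrite /lin big_nil addr0 cos0 mulr1.
    rewrite -[LHS](@fineK _ (Q _)) ?fin_num_measure//.
    rewrite -[in LHS](setIT (path Y @^-1` cylinder l)) -integral_indic//.
  apply: etrans (e _ _ P X mX) _; apply: etrans _ (esym (e _ _ P' X' mX')).
  by rewrite cyl_char_eq.
- move=> _; suff : (P setT < +oo)%E by [].
  by rewrite ltey_eq fin_num_measure.
Qed.

End law_equality.

(** * The Gaussian space of a field *)

Section gaussian_char.
Context d (T : measurableType d) (R : realType) (P : probability T R).
Implicit Types X : T -> R.
Local Notation "'\E' f" := (Rintegral P setT f) (at level 10).

Lemma measurable_fun_cos d0 (U : measurableType d0) (h : U -> R) :
  measurable_fun setT h -> measurable_fun setT (fun o => cos (h o)).
Proof.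
move=> mh; apply: measurableT_comp => //.
by apply: measurable_realfun.continuous_measurable_fun; exact: continuous_cos.
Qed.

Lemma integrable_cos (h : T -> R) : measurable_fun setT h ->
  P.-integrable setT (EFin \o (fun o => cos (h o))).
Proof.
move=> mh; apply: (@bounded_integrable _ _ _ _ _ 1).
  exact: measurable_fun_cos.
by move=> o; rewrite ler_norml cos_geN1 cos_le1.
Qed.

Lemma integral_diracR (m : R) (h : R -> \bar R) : measurable_fun setT h ->
  (\int[\d_(m : measurableTypeR R)]_x h x = h m)%E.
Proof. by move=> mh; rewrite integral_dirac//= /dirac indicE in_setT mul1e. Qed.

(** The centered normal law of variance [q], given by its transform: the point mass [q = 0] is
    included, and almost sure limits stay within the definition. *)
Definition centered_char X (q : R) :=
  forall a b, \int[P]_o cos (a * X o + b) = cos b * expR (- (q * a ^+ 2) / 2).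

Definition square_integrable X := P.-integrable setT (fun o => (X o ^+ 2)%:E).

Lemma gaussian_rv_char X : measurable_fun setT X -> gaussian_rv P X ->
  P.-integrable setT (EFin \o X) -> \int[P]_o X o = 0 ->
  [/\ square_integrable X & centered_char X (\int[P]_o (X o ^+ 2))].
Proof.
move=> mX [m [s [s0 lawX]]] iX EX0.
have mX' : measurable_fun setT (X : T -> measurableTypeR R) := mX.
have [s0'|sn0] := eqVneq s 0.
  pose dm : {measure set (measurableTypeR R) -> \bar R} := \d_(m : measurableTypeR R).
  have law A : measurable A -> image_measure P mX' A = dm A.
    by move=> mA; have := lawX A mA; rewrite s0' eqxx.
  have Eh (h : R -> R) : measurable_fun setT h -> \int[P]_o h (X o) = h m.
    move=> mh; rewrite -(Rintegral_image P mX')//.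
    rewrite /Rintegral (eq_measure_integral dm)//; last by move=> A mA _; exact: law.
    by rewrite integral_diracR//; exact/measurable_EFinP.
  have m0 : m = 0 by rewrite -EX0 -(Eh id).
  have E2 : (\int[P]_o (X o ^+ 2)%:E = 0)%E.
    have m2 : measurable_fun setT (fun x : R => (x ^+ 2)%:E).
      by apply/measurable_EFinP; exact: measurable_funX.
    rewrite -(ge0_integral_image P mX' m2); last by move=> x; rewrite lee_fin sqr_ge0.
    rewrite (eq_measure_integral dm)//; last by move=> A mA _; exact: law.
    by rewrite integral_diracR// m0 expr0n.
  split.
    apply/integrableP; split.
      by apply/measurable_EFinP; exact: measurable_funX.
    under eq_integral do rewrite gee0_abs ?lee_fin ?sqr_ge0//.
    by rewrite E2.
  move=> a b; rewrite (Eh (fun x => cos (a * x + b))).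
    by rewrite m0 mulr0 add0r /Rintegral E2 mul0r oppr0 mul0r expR0 mulr1.
  by apply: measurable_fun_cos; apply: measurable_funD => //; exact: measurable_funM.
have law A : measurable A -> image_measure P mX' A = normal_prob m s A.
  by move=> mA; have := lawX A mA; rewrite (negbTE sn0).
have Eh (h : R -> R) : measurable_fun setT h ->
    \int[P]_o h (X o) = \int[normal_prob m s]_x h x.
  move=> mh; rewrite -(Rintegral_image P mX')//.
  by rewrite /Rintegral; congr fine; apply: eq_measure_integral => A mA _; exact: law.
have m0 : m = 0 by rewrite -EX0 (Eh id)// Rintegral_normal_prob_id.
have E2 : (\int[P]_o (X o ^+ 2)%:E = (s ^+ 2)%:E)%E.
  have m2 : measurable_fun setT (fun x : R => (x ^+ 2)%:E).
    by apply/measurable_EFinP; exact: measurable_funX.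
  rewrite -(ge0_integral_image P mX' m2); last by move=> x; rewrite lee_fin sqr_ge0.
  rewrite (eq_measure_integral (normal_prob m s))//; last by move=> A mA _; exact: law.
  rewrite -(integral_normal_prob_sqr m sn0); apply: eq_integral => x _.
  by rewrite m0 subr0.
split.
  apply/integrableP; split.
    by apply/measurable_EFinP; exact: measurable_funX.
  under eq_integral do rewrite gee0_abs ?lee_fin ?sqr_ge0//.
  by rewrite E2 ltry.
move=> a b; rewrite (Eh (fun x => cos (a * x + b))).
  rewrite /(Rintegral P) E2 /= -(Rintegral_normal_prob_cos m sn0).
  by apply: eq_Rintegral => x _; rewrite m0 subr0.
by apply: measurable_fun_cos; apply: measurable_funD => //; exact: measurable_funM.
Qed.

(** By uniqueness the law of [X] is the point mass or the normal law with the same transform, and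
    its second moment is read off. *)
Lemma centered_char_gaussian X q : measurable_fun setT X -> 0 <= q ->
  centered_char X q ->
  square_integrable X /\ \int[P]_o (X o ^+ 2) = q.
Proof.
move=> mX q0 cX.
have mX' : measurable_fun setT (X : T -> measurableTypeR R) := mX.
have [nu nuE] : exists nu : {finite_measure set (measurableTypeR R) -> \bar R},
    forall A, nu A = image_measure P mX' A.
  apply: measure_finite_ex; suff : (P setT < +oo)%E by [].
  by rewrite ltey_eq fin_num_measure.
have nucos a b : \int[nu]_x cos (a * x + b) = cos b * expR (- (q * a ^+ 2) / 2).
  rewrite -cX -(@Rintegral_image _ _ _ _ _ P _ mX' (fun x => cos (a * x + b))).
    by rewrite /Rintegral; congr fine; apply: eq_measure_integral => A mA _; exact: nuE.
  by apply: measurable_fun_cos; apply: measurable_funD => //; exact: measurable_funM.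
have m2 : measurable_fun setT (fun x : R => (x ^+ 2)%:E).
  by apply/measurable_EFinP; exact: measurable_funX.
suff E2 : (\int[P]_o (X o ^+ 2)%:E = q%:E)%E.
  split; last by rewrite /Rintegral E2.
  apply/integrableP; split.
    by apply/measurable_EFinP; exact: measurable_funX.
  under eq_integral do rewrite gee0_abs ?lee_fin ?sqr_ge0//.
  by rewrite E2 ltry.
rewrite -(ge0_integral_image P mX' m2); last by move=> x; rewrite lee_fin sqr_ge0.
have [q0'|qn0] := eqVneq q 0.
  pose dm : {finite_measure set (measurableTypeR R) -> \bar R} := \d_(0 : measurableTypeR R).
  have law A : measurable A -> nu A = dm A.
    apply: fourier_uniqueness => a c; rewrite nucos q0' mul0r oppr0 mul0r expR0 mulr1.
    rewrite /Rintegral integral_diracR ?mulr0 ?add0r//.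
    apply/measurable_EFinP; apply: measurable_fun_cos.
    by apply: measurable_funD => //; exact: measurable_funM.
  rewrite (eq_measure_integral dm); last first.
    by move=> A mA _; rewrite -nuE; exact: law.
  by rewrite integral_diracR// expr0n q0'.
have s0 : Num.sqrt q != 0 by rewrite sqrtr_eq0 -ltNge lt_neqAle eq_sym qn0.
have law A : measurable A -> nu A = normal_prob 0 (Num.sqrt q) A.
  apply: fourier_uniqueness => a c; rewrite nucos.
  have := Rintegral_normal_prob_cos 0 s0 c a.
  rewrite sqr_sqrtr// => <-; apply: eq_Rintegral => x _.
  by rewrite subr0.
rewrite (eq_measure_integral (normal_prob 0 (Num.sqrt q))); last first.
  by move=> A mA _; rewrite -nuE; exact: law.
have := integral_normal_prob_sqr 0 s0; rewrite sqr_sqrtr// => <-.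
by apply: eq_integral => x _; rewrite subr0.
Qed.

(** The variances are not assumed bounded. The transforms converge to the transform of [X], which is
    positive at some [a = 1 / (k + 1)] because it tends to 1 at the origin; taking logarithms at
    this [a] shows that [q_ n] converges. *)
Lemma centered_char_cvg (X_ : nat -> T -> R) (q_ : nat -> R) X :
  (forall n, measurable_fun setT (X_ n)) -> measurable_fun setT X ->
  (forall n, centered_char (X_ n) (q_ n)) ->
  (forall n, 0 <= q_ n) ->
  {ae P, forall o, X_ n o @[n --> \oo] --> X o} ->
  exists q : R, [/\ 0 <= q, q_ n @[n --> \oo] --> q & centered_char X q].
Proof.
move=> mX_ mX cX_ q0_ X_X.
have mcos (Y : T -> R) a b : measurable_fun setT Y ->
    measurable_fun setT (fun o => cos (a * Y o + b)).
  by move=> mY; apply: measurable_fun_cos; apply: measurable_funD => //; exact: measurable_funM.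
have cos1 (x : R) : `|cos x| <= 1 by rewrite ler_norml cos_geN1 cos_le1.
have cvg_char a b : cos b * expR (- (q_ n * a ^+ 2) / 2) @[n --> \oo] -->
    \int[P]_o cos (a * X o + b).
  under eq_fun do rewrite -cX_.
  apply: (@bounded_cvg_Rintegral _ _ _ _ _ _ 1).
  - by move=> n; exact: mcos.
  - exact: mcos.
  - by move=> n o; exact: cos1.
  - apply: filterS X_X => o X_X.
    apply: (cvg_comp (fun n => a * X_ n o + b) cos); last exact: continuous_cos.
    by apply: cvgD; [exact: cvgMr|exact: cvg_cst].
have small : \int[P]_o cos (n.+1%:R^-1 * X o + 0) @[n --> \oo] --> \int[P]_o (1:R).
  apply: (@bounded_cvg_Rintegral _ _ _ _ _ _ 1).
  - by move=> n; exact: mcos.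
  - exact: measurable_cst.
  - by move=> n o; exact: cos1.
  - apply: aeW => o.
    have h : n.+1%:R^-1 * X o + 0 @[n --> \oo] --> (0 : R).
      rewrite -[X in _ --> X](addr0 (0:R)); apply: cvgD; last exact: cvg_cst.
      by rewrite -[X in _ --> X](mul0r (X o)); apply: cvgMl; exact: cvg_harmonic.
    rewrite -[X in _ --> X](cos0 R).
    by apply: (cvg_comp _ cos h); exact: continuous_cos.
have P1 : \int[P]_o (1:R) = 1.
  by rewrite Rintegral_cst// mul1r; have := @probability_setT _ _ _ P => /= ->.
have [k ck] : exists k, 0 < \int[P]_o cos (k.+1%:R^-1 * X o + 0).
  move: small; rewrite P1 => /cvgr_gt/(_ _ ltr01).
  by move=> [k _ /(_ k (leqnn k)) ?]; exists k.
pose a : R := k.+1%:R^-1; pose c := \int[P]_o cos (a * X o + 0).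
have a0 : a != 0 by rewrite invr_neq0.
have cq : q_ n @[n --> \oo] --> - (ln c * 2 / a ^+ 2).
  have e n : q_ n = - (ln (cos 0 * expR (- (q_ n * a ^+ 2) / 2)) * 2 / a ^+ 2).
    by rewrite cos0 mul1r expRK; field.
  under eq_fun do rewrite e.
  apply: cvgN; apply: cvgMl; apply: cvgMl.
  have lnc : {for c, continuous (@ln R)} by exact: continuous_ln.
  exact: (cvg_comp _ _ (cvg_char a 0) lnc).
exists (- (ln c * 2 / a ^+ 2)); split => //.
  by apply: (ler_cvg_to (cvg_cst (0:R)) cq); exact: nearW.
move=> a' b; apply: (cvg_unique _ (cvg_char a' b)) => //.
apply: cvgMr; apply: (cvg_comp _ expR); last exact: continuous_expR.
by apply: cvgMl; apply: cvgN; apply: cvgMl.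
Qed.

End gaussian_char.

Section gaussian_space.
Context d (T : measurableType d) (R : realType) (P : probability T R).
Variable W : R -> R -> {RV P >-> R}.
Variable K : R -> R -> R.
Hypothesis W_gauss : gaussian_field W.
Hypothesis W_mean : forall x t : R, ('E_P[W x t] = 0)%E.
Hypothesis W_cov : forall x t xi tau : R,
  ('E_P[fun o => (W x t o * W (x + xi)%R (t + tau)%R o)%R] = (K xi tau)%:E)%E.
Implicit Types X Y : T -> R.

Definition field_val (p : R * R) : T -> R := W p.1 p.2.

Lemma measurable_field_val p : measurable_fun setT (field_val p).
Proof. exact: measurable_funP. Qed.

Lemma measurable_lin (I : Type) (Y : I -> T -> R) ls :
  (forall i, measurable_fun setT (Y i)) -> measurable_fun setT (lin Y ls).
Proof.
move=> mY; rewrite (_ : lin Y ls = fun o => \sum_(p <- ls) p.1 * Y p.2 o)//.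
by apply: measurable_sum => p; exact: measurable_funM.
Qed.

(** The integral is a difference of two nonnegative extended reals, and [+oo - +oo] is [-oo] by
    convention; a finite value therefore forces both parts to be finite. *)
Lemma fin_integral_integrable X : measurable_fun setT X ->
  (\int[P]_o (X o)%:E)%E \is a fin_num -> P.-integrable setT (EFin \o X).
Proof.
move=> mX fX; have mXE : measurable_fun setT (EFin \o X) by exact/measurable_EFinP.
apply/integrableP; split => //.
move: fX; rewrite integralE => fX.
have ip : (0 <= \int[P]_o (EFin \o X)^\+ o)%E by exact: integral_ge0.
have im : (0 <= \int[P]_o (EFin \o X)^\- o)%E by exact: integral_ge0.
have : ((\int[P]_o (EFin \o X)^\+ o)%E \is a fin_num) &&
       ((\int[P]_o (EFin \o X)^\- o)%E \is a fin_num).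
  move: fX ip im; rewrite -[(fun x => (X x)%:E)]/(EFin \o X).
  by case: (\int[P]_o _)%E => [r| |]; case: (\int[P]_o _)%E => [r'| |].
move=> /andP[fp fm].
rewrite (_ : (fun x => _) = (fun o => (EFin \o X)^\+ o + (EFin \o X)^\- o)%E); last first.
  exact: fune_abse.
rewrite ge0_integralD//; [|exact: measurable_funepos|exact: measurable_funeneg].
by rewrite lte_add_pinfty// ltey_eq ?fp ?fm.
Qed.

Lemma field_cov_integrable p q :
  P.-integrable setT (EFin \o (fun o => field_val p o * field_val q o)) /\
  \int[P]_o (field_val p o * field_val q o) = K (q.1 - p.1) (q.2 - p.2).
Proof.
have e : (\int[P]_o (field_val p o * field_val q o)%:E = (K (q.1 - p.1) (q.2 - p.2))%:E)%E.
  have := W_cov p.1 p.2 (q.1 - p.1) (q.2 - p.2).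
  by rewrite !subrKC unlock => <-.
split; last by rewrite /Rintegral e.
apply: fin_integral_integrable; last by rewrite e.
by apply: measurable_funM; exact: measurable_field_val.
Qed.

Lemma field_mean_integrable p :
  P.-integrable setT (EFin \o field_val p) /\ \int[P]_o field_val p o = 0.
Proof.
have e : (\int[P]_o (field_val p o)%:E = 0)%E.
  by have := W_mean p.1 p.2; rewrite unlock.
split; last by rewrite /Rintegral e.
by apply: fin_integral_integrable; [exact: measurable_field_val|rewrite e].
Qed.

Definition comb := seq (R * (R * R)).
Definition qform (L : comb) : R :=
  \sum_(a <- L) \sum_(b <- L) a.1 * b.1 * K (b.2.1 - a.2.1) (b.2.2 - a.2.2).

Lemma Rintegral_sum (I : Type) (s : seq I) (F : I -> T -> R) :
  (forall i, P.-integrable setT (EFin \o F i)) ->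
  P.-integrable setT (EFin \o (fun o => \sum_(i <- s) F i o)) /\
  \int[P]_o (\sum_(i <- s) F i o) = \sum_(i <- s) \int[P]_o F i o.
Proof.
move=> iF; elim: s => [|i s [IH1 IH2]].
  split.
    by apply: eq_integrable (@integrable0 _ _ _ P setT) => // o _; rewrite /= big_nil.
  by under eq_Rintegral do rewrite big_nil; rewrite big_nil Rintegral_cst// mul0r.
have ii : P.-integrable setT (EFin \o (fun o => F i o + \sum_(j <- s) F j o)).
  by apply: eq_integrable (integrableD measurableT (iF i) IH1).
split.
  by apply: eq_integrable ii => // o _; rewrite /= big_cons.
under eq_Rintegral do rewrite big_cons.
by rewrite big_cons RintegralD// IH2.
Qed.

Lemma lin_mean L : P.-integrable setT (EFin \o lin field_val L) /\
  \int[P]_o lin field_val L o = 0.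
Proof.
have iF (p : R * (R * R)) : P.-integrable setT (EFin \o (fun o => p.1 * field_val p.2 o)).
  have := integrableZl measurableT p.1 (field_mean_integrable p.2).1.
  by apply: eq_integrable => // o _; rewrite /= EFinM.
have [h1 h2] := Rintegral_sum L iF; split => //.
rewrite h2 big1_seq// => p _; rewrite RintegralZl//.
  by rewrite (field_mean_integrable p.2).2 mulr0.
exact: (field_mean_integrable p.2).1.
Qed.

Lemma lin_qform L : \int[P]_o (lin field_val L o ^+ 2) = qform L.
Proof.
have iF (p q : R * (R * R)) : P.-integrable setT
    (EFin \o (fun o => p.1 * q.1 * (field_val p.2 o * field_val q.2 o))).
  have := integrableZl measurableT (p.1 * q.1) (field_cov_integrable p.2 q.2).1.
  by apply: eq_integrable => // o _; rewrite /= !EFinM.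
pose F (p : R * (R * R)) o := \sum_(q <- L) p.1 * q.1 * (field_val p.2 o * field_val q.2 o).
have [h1 h2] := Rintegral_sum L (fun p => (Rintegral_sum L (iF p)).1 : P.-integrable setT (EFin \o F p)).
transitivity (\int[P]_o (\sum_(p <- L) F p o)).
  apply: eq_Rintegral => o _; rewrite expr2 /lin big_distrlr /=.
  by apply: eq_bigr => p _; apply: eq_bigr => q _; ring.
rewrite h2; apply: eq_bigr => p _.
rewrite (Rintegral_sum L (iF p)).2; apply: eq_bigr => q _.
rewrite RintegralZl//; last exact: (field_cov_integrable p.2 q.2).1.
by rewrite (field_cov_integrable p.2 q.2).2.
Qed.

Lemma qform_ge0 L : 0 <= qform L.
Proof. by rewrite -lin_qform; apply: Rintegral_ge0 => o _; exact: sqr_ge0. Qed.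

Lemma lin_char L : centered_char P (lin field_val L) (qform L).
Proof.
have [iL EL] := lin_mean L.
have mL : measurable_fun setT (lin field_val L).
  by apply: measurable_lin; exact: measurable_field_val.
have gL : gaussian_rv P (lin field_val L).
  have := W_gauss (fun i : 'I_(size L) => (tnth (in_tuple L) i).2)
    (fun i => (tnth (in_tuple L) i).1).
  congr gaussian_rv; apply/funext => o.
  by rewrite /lin /field_val [RHS]big_tnth.
by have [_] := gaussian_rv_char mL gL iL EL; rewrite lin_qform.
Qed.

(** Limits are almost sure rather than in mean square, because derivatives of the paths are limits
    of this kind; [gspace_char] recovers the second moments. *)
Definition in_gspace X := measurable_fun setT X /\
  exists L : nat -> comb, {ae P, forall o, lin field_val (L n) o @[n --> \oo] --> X o}.

Lemma gspace_measurable X : in_gspace X -> measurable_fun setT X.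
Proof. by case. Qed.

Lemma linD L1 L2 o : lin field_val (L1 ++ L2) o = lin field_val L1 o + lin field_val L2 o.
Proof. by rewrite /lin big_cat. Qed.

Lemma linZ a L o :
  lin field_val [seq (a * p.1, p.2) | p <- L] o = a * lin field_val L o.
Proof.
by rewrite /lin big_map mulr_sumr; apply: eq_bigr => p _; rewrite mulrA.
Qed.

Lemma gspace_val p : in_gspace (field_val p).
Proof.
split; first exact: measurable_field_val.
exists (fun=> [:: (1, p)]); apply: aeW => o; rewrite /lin big_seq1 mul1r.
exact: cvg_cst.
Qed.

Lemma gspaceD X Y : in_gspace X -> in_gspace Y -> in_gspace (fun o => X o + Y o).
Proof.
move=> [mX [L1 h1]] [mY [L2 h2]]; split; first exact: measurable_funD.
exists (fun n => L1 n ++ L2 n); apply: filterS2 h1 h2 => o h1 h2.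
by under eq_fun do rewrite linD; exact: cvgD.
Qed.

Lemma gspaceZ a X : in_gspace X -> in_gspace (fun o => a * X o).
Proof.
move=> [mX [L h]]; split; first exact: measurable_funM.
exists (fun n => [seq (a * p.1, p.2) | p <- L n]); apply: filterS h => o h.
by under eq_fun do rewrite linZ; exact: cvgMr.
Qed.

Lemma gspaceB X Y : in_gspace X -> in_gspace Y -> in_gspace (fun o => X o - Y o).
Proof.
move=> gX gY; rewrite (_ : (fun o => _) = (fun o => X o + -1 * Y o)).
  by apply: gspaceD => //; exact: gspaceZ.
by apply/funext => o; rewrite mulN1r.
Qed.

Lemma gspace_lin (I : Type) (Y : I -> T -> R) ls :
  (forall i, in_gspace (Y i)) -> in_gspace (lin Y ls).
Proof.
move=> gY; elim: ls => [|p ls IH].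
  split; first by apply: measurable_lin => i; exact: gspace_measurable.
  by exists (fun=> [::]); apply: aeW => o; rewrite /lin !big_nil; exact: cvg_cst.
rewrite (_ : lin Y _ = (fun o => p.1 * Y p.2 o + lin Y ls o)).
  by apply: gspaceD => //; exact: gspaceZ.
by apply/funext => o; rewrite /lin big_cons.
Qed.

Lemma gspace_char X : in_gspace X ->
  square_integrable P X /\ centered_char P X (\int[P]_o (X o ^+ 2)).
Proof.
move=> [mX [L h]].
have mL n : measurable_fun setT (lin field_val (L n)).
  by apply: measurable_lin; exact: measurable_field_val.
have [q [q0 _ cX]] := centered_char_cvg mL mX (fun n => lin_char (L n))
  (fun n => qform_ge0 (L n)) h.
by have [sX eX] := centered_char_gaussian mX q0 cX; rewrite eX.
Qed.

Lemma gspace_cos X b : in_gspace X ->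
  \int[P]_o cos (X o + b) = cos b * expR (- (\int[P]_o (X o ^+ 2)) / 2).
Proof.
move=> /gspace_char[_ /(_ 1 b)]; rewrite expr1n mulr1 => <-.
by apply: eq_Rintegral => o _; rewrite mul1r.
Qed.

Lemma gspace_integrableM X Y : in_gspace X -> in_gspace Y ->
  P.-integrable setT (EFin \o (fun o => X o * Y o)).
Proof.
move=> gX gY; have [iX _] := gspace_char gX; have [iY _] := gspace_char gY.
have := integrableD measurableT iX iY; apply: le_integrable => //.
  by apply/measurable_EFinP; apply: measurable_funM; exact: gspace_measurable.
move=> o _ /=; rewrite lee_fin [leRHS]ger0_norm ?addr_ge0 ?sqr_ge0//.
have := sqr_ge0 (`|X o| - `|Y o|); rewrite sqrrB !real_normK ?num_real// normrM.
have := sqr_ge0 (X o); have := sqr_ge0 (Y o).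
set z := `|X o| * `|Y o|; have : 0 <= z by rewrite mulr_ge0.
lra.
Qed.

Definition covar X Y : R := \int[P]_o (X o * Y o).

Lemma covarC X Y : covar X Y = covar Y X.
Proof. by rewrite /covar; apply: eq_Rintegral => o _; rewrite mulrC. Qed.

Lemma covarDl X Y Z : in_gspace X -> in_gspace Y -> in_gspace Z ->
  covar (fun o => X o + Y o) Z = covar X Z + covar Y Z.
Proof.
move=> gX gY gZ; rewrite /covar -RintegralD//; [|exact: gspace_integrableM..].
by apply: eq_Rintegral => o _; rewrite mulrDl.
Qed.

Lemma covarZl a X Z : in_gspace X -> in_gspace Z ->
  covar (fun o => a * X o) Z = a * covar X Z.
Proof.
move=> gX gZ; rewrite /covar -RintegralZl//; last exact: gspace_integrableM.
by apply: eq_Rintegral => o _; rewrite mulrA.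
Qed.

Lemma covar_ge0 X : 0 <= covar X X.
Proof. by apply: Rintegral_ge0 => o _; rewrite -expr2 sqr_ge0. Qed.

Lemma covarXX X : \int[P]_o (X o ^+ 2) = covar X X.
Proof. by apply: eq_Rintegral => o _; rewrite expr2. Qed.

Lemma covarDD X Y : in_gspace X -> in_gspace Y ->
  covar (fun o => X o + Y o) (fun o => X o + Y o) =
  covar X X + covar Y Y + 2 * covar X Y.
Proof.
move=> gX gY; have gXY := gspaceD gX gY.
rewrite covarDl// covarC covarDl// [X in _ + X]covarC covarDl//.
by rewrite (covarC Y X); ring.
Qed.

(** For Gaussian limits almost sure convergence already gives convergence of variances
    ([centered_char_cvg]); polarization carries it over to covariances. No uniform integrability has
    to be checked. *)
Lemma covar_cvg (X_ : nat -> T -> R) X Z :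
  (forall n, in_gspace (X_ n)) -> in_gspace X -> in_gspace Z ->
  {ae P, forall o, X_ n o @[n --> \oo] --> X o} ->
  covar (X_ n) Z @[n --> \oo] --> covar X Z.
Proof.
move=> gX_ gX gZ X_X.
have var_cvg (Y_ : nat -> T -> R) Y : (forall n, in_gspace (Y_ n)) -> in_gspace Y ->
    {ae P, forall o, Y_ n o @[n --> \oo] --> Y o} ->
    covar (Y_ n) (Y_ n) @[n --> \oo] --> covar Y Y.
  move=> gY_ gY Y_Y.
  have [q [q0 cq cY]] := centered_char_cvg (fun n => gspace_measurable (gY_ n))
    (gspace_measurable gY) (fun n => (gspace_char (gY_ n)).2)
    (fun n => covar_ge0 (Y_ n)) Y_Y.
  have [_ YE] := centered_char_gaussian (gspace_measurable gY) q0 cY.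
  by rewrite -(covarXX Y) YE; under eq_fun do rewrite -covarXX.
have e Y : in_gspace Y -> covar Y Z = 2^-1 * (covar (fun o => Y o + Z o) (fun o => Y o + Z o)
    - covar Y Y - covar Z Z).
  by move=> gY; rewrite covarDD//; field.
under eq_fun do rewrite e//.
rewrite e//; apply: cvgMr; apply: cvgB; last exact: cvg_cst.
apply: cvgB; last exact: var_cvg.
apply: var_cvg => [n||]; [exact: gspaceD|exact: gspaceD|].
by apply: filterS X_X => o X_X; apply: cvgD => //; exact: cvg_cst.
Qed.

End gaussian_space.

(** * Sums over level crossings *)

Lemma continuous_pair {R : realType} {U : topologicalType} (h : R -> R -> R) (f g : U -> R) :
  continuous (fun p : R * R => h p.1 p.2) -> continuous f -> continuous g ->
  continuous (fun t => h (f t) (g t)).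
Proof.
move=> ch cf cg t.
have fgt := @cvg_pair _ _ _ _ _ _ (nbhs_filter t) (nbhs_filter (f t))
  (nbhs_filter (g t)) _ _ (cf t) (cg t).
exact: (cvg_comp _ _ fgt (ch (f t, g t))).
Qed.

Lemma continuous_near_lt {R : realType} (f : R -> R) (t c : R) : continuous f ->
  f t < c -> exists2 d, 0 < d & forall s, `|t - s| < d -> f s < c.
Proof.
move=> cf ftc.
have : \forall s \near t, f s < c by exact: (cvgr_lt (f t) (cf t)).
by move=> /nbhs_ballP[d /= d0 hd]; exists d.
Qed.

Lemma continuous_near_gt {R : realType} (f : R -> R) (t c : R) : continuous f ->
  c < f t -> exists2 d, 0 < d & forall s, `|t - s| < d -> c < f s.
Proof.
move=> cf ftc.
have : \forall s \near t, c < f s by exact: (cvgr_gt (f t) (cf t)).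
by move=> /nbhs_ballP[d /= d0 hd]; exists d.
Qed.

Section bisection.
Context {R : realType}.
Variable Q : R -> R -> Prop.

(** A form of Cousin's lemma. If [Q] failed on [[a, b]] it would fail on one half, and so on; the
    nested intervals shrink to a point [t], where the local hypothesis is contradicted. *)
Lemma bisection_principle (a b : R) : a <= b ->
  (forall x y, a <= x -> x <= y -> y <= b ->
    Q x ((x + y) / 2) -> Q ((x + y) / 2) y -> Q x y) ->
  (forall t, a <= t <= b -> exists2 d, 0 < d &
    forall x y, a <= x -> x <= t -> t <= y -> y <= b -> y - x < d -> Q x y) ->
  Q a b.
Proof.
move=> ab Qadd Qloc; apply: contrapT => nQab.
(* The half kept is one where [Q] fails: the right one if [Q] holds on the left, the left one
   otherwise. *)
pose step (p : R * R) : R * R := if pselect (Q p.1 ((p.1 + p.2) / 2))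
  then ((p.1 + p.2) / 2, p.2) else (p.1, (p.1 + p.2) / 2).
pose s n := iter n step (a, b).
have inv n : [/\ a <= (s n).1, (s n).1 <= (s n).2, (s n).2 <= b,
    (s n).2 - (s n).1 = (b - a) / 2 ^+ n & ~ Q (s n).1 (s n).2].
  elim: n => [|n [h1 h2 h3 h4 h5]]; first by split => //; rewrite expr0 divr1.
  rewrite /s iterS -/(s n) /step; case: pselect => [q|nq] /=.
    split => //; [lra|lra|rewrite exprS invfM mulrCA -h4; lra|].
    by move=> q2; apply: h5; exact: (Qadd _ _ h1 h2 h3 q q2).
  by split => //; [lra|lra|rewrite exprS invfM mulrCA -h4; lra].
have mono n m : (n <= m)%N -> (s n).1 <= (s m).1 /\ (s m).2 <= (s n).2.
  move=> /subnK <-; elim: (m - n)%N => [//|k [k1 k2]].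
  have [_ h _ _ _] := inv (k + n)%N.
  rewrite addSn /s iterS -/(s _) /step; case: pselect => _ /=; split; lra.
have low_up n m : (s n).1 <= (s m).2.
  have [nm|/ltnW mn] := leqP n m.
    have [? _] := mono _ _ nm; have [_ ? _ _ _] := inv m; lra.
  have [_ ?] := mono _ _ mn; have [_ ? _ _ _] := inv n; lra.
pose A := [set (s n).1 | n in setT]; pose t := sup A.
have A0 : A !=set0 by exists (s 0%N).1, 0%N.
have Aub m : ubound A (s m).2 by move=> _ [n _ <-].
have tl n : (s n).1 <= t by apply: ub_le_sup; [exists (s 0%N).2|exists n].
have tu n : t <= (s n).2 by apply: ge_sup.
have tab : a <= t <= b by rewrite (tl 0%N) (tu 0%N).
have [d d0 Qd] := Qloc t tab.
(* The added 1 keeps the denominator positive when [a = b]. *)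
have r0 : 0 < d / (b - a + 1) by rewrite divr_gt0//; lra.
have [n _ /(_ n (leqnn n)) hn] := near_infty_natSinv_expn_lt (PosNum r0).
have [h1 h2 h3 h4 h5] := inv n.
apply: h5; apply: Qd => //.
rewrite h4; move: hn; rewrite /= mul1r ltr_pdivlMr; last by lra.
apply: le_lt_trans; rewrite mulrC ler_pM2l ?invr_gt0 ?exprn_gt0//; lra.
Qed.

End bisection.

Section monotone.
Context {R : realType}.
Variables F f : R -> R.
Hypothesis dF : forall x : R, is_derive x (1:R) F (f x).

Lemma derive_pos_increasing x y : (forall t, x <= t <= y -> 0 < f t) ->
  forall u v, x <= u -> u < v -> v <= y -> F u < F v.
Proof.
move=> fpos u v xu uv vy.
have cF : {within `[u, v], continuous F}.
  apply: continuous_subspaceT; exact: is_derive_continuous dF.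
have [c + e] := MVT uv (fun t _ => dF t) cF.
rewrite in_itv/= => /andP[uc cv].
by rewrite -subr_gt0 e mulr_gt0 ?subr_gt0// fpos//; apply/andP; split; lra.
Qed.

End monotone.

Section crossings.
Context {R : realType}.
Local Notation cnt := (@counting (measurableTypeR R) R).

(** Half-open, so that adjacent intervals share no crossing. *)
Definition crossing_set (z : R -> R) (a b : R) : set (measurableTypeR R) :=
  [set t : R | a < t <= b /\ z t = 0].

Definition crossing_sum (z k : R -> R) (a b : R) : \bar R :=
  (\int[cnt]_(t in crossing_set z a b) (k t)%:E)%E.

Lemma measurable_crossing_set (z : R -> R) a b : continuous z ->
  measurable (crossing_set z a b).
Proof.
move=> cz; rewrite (_ : crossing_set z a b = `]a, b] `&` (z @^-1` [set 0])).
  apply: measurableI; first exact: measurable_itv.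
  rewrite -[X in measurable X]setTI.
  exact: (measurable_realfun.continuous_measurable_fun cz).
by apply/seteqP; split => t /=; rewrite in_itv/=.
Qed.

Lemma crossing_sum_cat (z k : R -> R) a b c : continuous z -> continuous k ->
  (forall t, 0 <= k t) -> a <= b -> b <= c ->
  crossing_sum z k a c = (crossing_sum z k a b + crossing_sum z k b c)%E.
Proof.
move=> cz ck k0 ab bc; rewrite /crossing_sum -ge0_integral_setU.
- congr (integral _ _ _); apply/seteqP; split => t.
    move=> [/andP[h1 h2] h3]; have [tb|bt] := leP t b.
      by left; split => //; rewrite h1.
    by right; split => //; rewrite bt.
  by move=> [[/andP[h1 h2] h3]|[/andP[h1 h2] h3]]; split => //; apply/andP; split; lra.
- exact: measurable_crossing_set.
- exact: measurable_crossing_set.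
- apply: measurable_funTS; apply/measurable_EFinP.
  exact: measurable_realfun.continuous_measurable_fun.
- by move=> t _; rewrite lee_fin.
- by apply/disj_setPRL => t [/andP[h1 h2] _] /= [/andP[h3 h4] _]; lra.
Qed.

Lemma crossing_sum_ge0 z k a b : (forall t, 0 <= k t) -> (0 <= crossing_sum z k a b)%E.
Proof. by move=> k0; apply: integral_ge0 => t _; rewrite lee_fin. Qed.

Lemma crossing_sum0 z k a b :
  (forall t, a < t -> t <= b -> z t = 0 -> k t = 0) -> crossing_sum z k a b = 0%E.
Proof.
move=> h; rewrite /crossing_sum integral0_eq// => t [/andP[h1 h2] h3].
by rewrite h.
Qed.

Lemma crossing_sum1 z k a b t : a < t <= b -> z t = 0 ->
  (forall s, a < s -> s <= b -> z s = 0 -> s = t) -> crossing_sum z k a b = (k t)%:E.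
Proof.
move=> tab zt uniq_t; rewrite /crossing_sum.
have -> : crossing_set z a b = [set t].
  by apply/seteqP; split => [s [/andP[h1 h2] /uniq_t ->]|s ->].
rewrite (_ : (\int[_]_(s in _) _)%E = (\int[cnt]_(s in [set t]) (k t)%:E)%E).
  rewrite integral_cst//=.
  by rewrite /counting asboolT// fset_set1 finmap.cardfs1 mule1.
by apply: eq_integral => s; rewrite inE => ->.
Qed.

Variable chi : R -> R -> R.

(** Sign changes over the [2^j] dyadic cells, weighted at the left end of the cell. Only finitely
    many values of the paths enter, which gives measurability on the path space. Downward crossings
    go unseen; this agrees with the crossing sum once [chi] vanishes for slopes below [e]. *)
Fixpoint upcrossing_sum (z zd m : R -> R) j a b : R :=
  if j is j'.+1 then
    upcrossing_sum z zd m j' a ((a + b) / 2) + upcrossing_sum z zd m j' ((a + b) / 2) b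
  else ((z a < 0) && (0 <= z b))%:R * chi (zd a) (m a).

Lemma upcrossing_sum0 z zd m j a b : a <= b ->
  (forall t, a <= t <= b -> chi (zd t) (m t) = 0) -> upcrossing_sum z zd m j a b = 0.
Proof.
elim: j a b => [|j IH] a b ab h /=.
  by rewrite h ?mulr0// lexx.
rewrite !IH ?addr0//; try lra.
- by move=> t /andP[t1 t2]; apply: h; apply/andP; split; lra.
- by move=> t /andP[t1 t2]; apply: h; apply/andP; split; lra.
Qed.

(** When [z] is negative exactly before [t], the only contributing cell is the half-open one that
    contains [t]; [s] is its left end. *)
Lemma upcrossing_sum_threshold (z zd m : R -> R) j (a b t : R) : a <= b ->
  (forall s, a <= s <= b -> (z s < 0) = (s < t)) ->
  if a < t <= b then exists s, [/\ a <= s, s <= t, t - s <= (b - a) / 2 ^+ j &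
    upcrossing_sum z zd m j a b = chi (zd s) (m s)]
  else upcrossing_sum z zd m j a b = 0.
Proof.
elim: j a b => [|j IH] a b ab h /=.
  rewrite [0 <= z b]leNgt (h a) ?lexx// (h b) ?ab ?lexx//= -leNgt.
  case: ifPn => [/andP[at_ tb]|].
    by exists a; rewrite at_ tb expr0 divr1 mul1r; split => //; lra.
  by move=> /negbTE ->; rewrite mul0r.
pose c := (a + b) / 2; rewrite -/c.
have ac : a <= c by rewrite /c; lra.
have cb : c <= b by rewrite /c; lra.
have h1 s : a <= s <= c -> (z s < 0) = (s < t).
  by move=> /andP[? ?]; apply: h; apply/andP; split; lra.
have h2 s : c <= s <= b -> (z s < 0) = (s < t).
  by move=> /andP[? ?]; apply: h; apply/andP; split; lra.
have := IH a c ac h1; have := IH c b cb h2.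
have e1 : (c - a) / 2 ^+ j = (b - a) / 2 ^+ j.+1.
  by rewrite exprS invfM mulrA; congr (_ / _); rewrite /c; lra.
have e2 : (b - c) / 2 ^+ j = (b - a) / 2 ^+ j.+1.
  by rewrite exprS invfM mulrA; congr (_ / _); rewrite /c; lra.
have [at_|ta] := ltP a t; have [tc|ct] := leP t c; have [tb|bt] := leP t b => /=;
  rewrite ?(ltNge c t) ?tc /= ?ct /=; try lra.
- by move=> -> [s [s1 s2 s3 s4]]; exists s; rewrite -e1 addr0.
- by move=> [s [s1 s2 s3 s4]] ->; exists s; rewrite -e2 add0r; split => //; lra.
Qed.

Hypothesis chi_ge0 : forall u w, 0 <= chi u w.
Hypothesis chi_cont : continuous (fun p : R * R => chi p.1 p.2).
Variable e : R.
Hypothesis e_gt0 : 0 < e.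
Hypothesis chi_small : forall u w, u < e -> chi u w = 0.

(** By bisection it suffices to look near one time. Either the slope there is below [e], and both
    sides vanish, or it is positive, and [z] increases and has at most one zero. In the latter case
    the sample point of [upcrossing_sum_threshold] tends to this zero. *)
Lemma upcrossing_sum_cvg (z zd m : R -> R) (a b : R) : a <= b ->
  (forall t : R, is_derive t (1:R) z (zd t)) -> continuous zd -> continuous m ->
  (upcrossing_sum z zd m j a b)%:E @[j --> \oo] -->
  crossing_sum z (fun t => chi (zd t) (m t)) a b.
Proof.
move=> ab dz czd cm.
have cz : continuous z := is_derive_continuous dz.
pose k t := chi (zd t) (m t).
have ck : continuous k.
  exact: continuous_pair.
have k0 t : 0 <= k t by exact: chi_ge0.
apply: (@bisection_principle R (fun a b => (upcrossing_sum z zd m j a b)%:E @[j --> \oo] -->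
  crossing_sum z k a b) a b ab).
  move=> x y ax xy yb h1 h2.
  rewrite (@crossing_sum_cat z k x ((x + y) / 2) y)//; [|lra|lra].
  (* Depth [j.+1] on an interval is depth [j] on its two halves; this is why the bisection principle
     asks for additivity at midpoints only. *)
  rewrite -(cvg_shiftS (fun j => (upcrossing_sum z zd m j x y)%:E)) /=.
  under eq_fun do rewrite EFinD.
  by apply: cvgeD => //; apply: ge0_adde_def; rewrite inE; exact: crossing_sum_ge0.
move=> t /andP[at_ tb]; have [zt|zt] := ltP (zd t) e.
  have [d d0 hd] := continuous_near_lt czd zt; exists d => // x y ax xt ty yb yx.
  have kz s : x <= s <= y -> k s = 0.
    move=> /andP[xs sy]; apply: chi_small; apply: hd.
    by rewrite ltr_norml; apply/andP; split; lra.
  rewrite crossing_sum0; last first.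
    by move=> s h1 h2 _; apply: kz; rewrite h2 ltW.
  apply: cvg_near_cst; apply: nearW => j; rewrite upcrossing_sum0//; lra.
have [d d0 hd] := continuous_near_gt czd (lt_le_trans e_gt0 zt); exists d => // x y ax xt ty yb yx.
have xy : x <= y by lra.
have zpos s : x <= s <= y -> 0 < zd s.
  move=> /andP[xs sy]; apply: hd.
  by rewrite ltr_norml; apply/andP; split; lra.
have zincr := derive_pos_increasing dz zpos.
have zmono u v : x <= u -> u <= v -> v <= y -> z u <= z v.
  move=> xu; rewrite le_eqVlt => /predU1P[->//|uv vy].
  by apply/ltW; exact: zincr.
have [zx|zx] := leP 0 (z x).
  rewrite crossing_sum0; last first.
    by move=> s h1 h2 zs; have := zincr _ _ (lexx x) h1 h2; lra.
  apply: cvg_near_cst; apply: nearW => j.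
  have := @upcrossing_sum_threshold z zd m j x y x xy.
  rewrite ltxx /= => -> // s /andP[h1 h2].
  by rewrite !ltNge h1 (le_trans zx (zmono _ _ (lexx x) h1 h2)).
have [zy|zy] := ltP (z y) 0.
  rewrite crossing_sum0; last first.
    by move=> s h1 h2 zs; have := zmono _ _ (ltW h1) h2 (lexx y); lra.
  apply: cvg_near_cst; apply: nearW => j.
  (* Here [z] is negative throughout, and any threshold beyond [y] expresses this. *)
  have := @upcrossing_sum_threshold z zd m j x y (y + 1) xy.
  rewrite (_ : x < y + 1 <= y = false); last by apply/negbTE; rewrite negb_and -!ltNge; apply/orP; right; lra.
  move=> -> // s /andP[h1 h2].
  rewrite (le_lt_trans (zmono _ _ h1 h2 (lexx y)) zy); apply/esym; lra.
have [t0 + zt0] : exists2 c, c \in `[x, y] & z c = 0.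
  apply: IVT => //; first exact: continuous_subspaceT.
  by rewrite ge_min le_max (ltW zx) zy orbT.
rewrite in_itv/= => /andP[xt0 t0y].
have {}xt0 : x < t0.
  by rewrite lt_neqAle xt0 andbT; apply/eqP => xt0e; move: zx; rewrite xt0e zt0 ltxx.
rewrite (@crossing_sum1 z k x y t0)//; first last.
- move=> s xs sy zs; apply/eqP; rewrite eq_le !leNgt; apply/andP; split; apply/negP => h.
    by have := zincr _ _ (ltW xt0) h sy; lra.
  by have := zincr _ _ (ltW xs) h t0y; lra.
- by rewrite xt0.
apply: cvg_EFin; first exact: nearW.
have thr s : x <= s <= y -> (z s < 0) = (s < t0).
  move=> /andP[h1 h2]; have [st|ts] := ltP s t0.
    by rewrite -zt0; exact: zincr.
  by apply/negbTE; rewrite -leNgt -zt0; apply: zmono => //; exact: ltW.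
have /choice[s hs] : forall j, exists s, [/\ x <= s, s <= t0, t0 - s <= (y - x) / 2 ^+ j &
    upcrossing_sum z zd m j x y = k s].
  by move=> j; have := upcrossing_sum_threshold zd m j xy thr; rewrite xt0 t0y.
have st0 : s j @[j --> \oo] --> t0.
  apply: (@squeeze_cvgr _ _ _ _ (fun j => t0 - (y - x) / 2 ^+ j) (cst t0)).
  - by apply: nearW => j; have [h1 h2 h3 h4] := hs j; apply/andP; split => //=; lra.
  - rewrite -[X in _ --> X]subr0; apply: cvgB; first exact: cvg_cst.
    rewrite -[X in _ --> X](mulr0 (y - x)); apply: cvgMr.
    under eq_fun do rewrite -exprVn.
    by apply: cvg_expr; rewrite ger0_norm// invf_lt1// ltr1n.
  - exact: cvg_cst.
have -> : fine \o (fun j => (upcrossing_sum z zd m j x y)%:E) = k \o s.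
  by apply/funext => j /=; have [_ _ _ ->] := hs j.
exact: (cvg_comp _ _ st0 (ck t0)).
Qed.

End crossings.

(** * Area formula *)

Section substitution.
Context {R : realType}.
Local Notation leb := (@lebesgue_measure R).
Variables F f : R -> R.
Hypothesis dF : forall x : R, is_derive x (1:R) F (f x).
Hypothesis cf : continuous f.

Lemma substitution_decreasing (G : R -> R) a b : a <= b ->
  (forall t, a <= t <= b -> f t < 0) -> {within `[F b, F a], continuous G} ->
  (\int[leb]_(x in `[F b, F a]) (G x)%:E = \int[leb]_(t in `[a, b]) (G (F t) * - f t)%:E)%E.
Proof.
move=> ab fneg cG.
have eF : F^`()%classic = f := is_derive_derive1 dF.
have decF := derive_pos_increasing (fun x => is_deriveN (dF x)) (x := a) (y := b).
rewrite integration_by_substitution_decreasing//.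
- by rewrite eF.
- move=> x y; rewrite !in_itv/= => /andP[h1 h2] /andP[h3 h4] xy.
  by rewrite -ltrN2; apply: decF => // t /fneg; rewrite oppr_gt0.
- by rewrite eF => x _; exact: cf.
- by rewrite eF; apply/cvg_ex; exists (f a); apply: cvg_at_right_filter; exact: cf.
- by rewrite eF; apply/cvg_ex; exists (f b); apply: cvg_at_left_filter; exact: cf.
- exact: is_derive_LRcontinuous dF.
Qed.

Lemma substitution_increasing (G : R -> R) a b : a <= b ->
  (forall t, a <= t <= b -> 0 < f t) -> {within `[F a, F b], continuous G} ->
  (\int[leb]_(x in `[F a, F b]) (G x)%:E = \int[leb]_(t in `[a, b]) (G (F t) * f t)%:E)%E.
Proof.
move=> ab fpos cG.
have eF : F^`()%classic = f := is_derive_derive1 dF.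
rewrite integration_by_substitution_increasing//.
- by rewrite eF.
- move=> x y; rewrite !in_itv/= => /andP[h1 h2] /andP[h3 h4] xy.
  exact: (derive_pos_increasing dF fpos).
- by rewrite eF => x _; exact: cf.
- by rewrite eF; apply/cvg_ex; exists (f a); apply: cvg_at_right_filter; exact: cf.
- by rewrite eF; apply/cvg_ex; exists (f b); apply: cvg_at_left_filter; exact: cf.
- exact: is_derive_LRcontinuous dF.
Qed.

End substitution.

Section area.
Context {R : realType}.
Local Notation leb := (@lebesgue_measure R).
Variables G Gd k phi : R -> R.
Hypothesis dG : forall t : R, is_derive t (1:R) G (Gd t).
Hypothesis cGd : continuous Gd.
Hypothesis k_ge0 : forall t, 0 <= k t.
Hypothesis ck : continuous k.
Hypothesis phi_ge0 : forall x, 0 <= phi x.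
Hypothesis cphi : continuous phi.

Let cG : continuous G := is_derive_continuous dG.
Let level a b x : \bar R := crossing_sum (fun t => G t - x) k a b.
(** Measurability in the level travels with the identity, because adding two pieces requires it. *)
Let holds a b := measurable_fun [set: measurableTypeR R] (level a b) /\
  (\int[leb]_x (level a b x * (phi x)%:E) =
   \int[leb]_(t in `]a, b]) (k t * phi (G t) * - Gd t)%:E)%E.

(** A decreasing [G] meets each level at most once, so the crossing sum is [k] composed with the
    inverse of [G], and the identity is a change of variables. The level [G p] is left out of the
    range since it is attained at the excluded time [p]. *)
Let area_decreasing p q : p <= q -> (forall t, p <= t <= q -> Gd t < 0) -> holds p q.
Proof.
move=> pq Gneg.
have dec u v : p <= u -> u < v -> v <= q -> G v < G u.
  move=> pu uv vq; rewrite -ltrN2.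
  apply: (derive_pos_increasing (fun x => is_deriveN (dG x)) (x := p) (y := q)) => //.
  by move=> t /Gneg; rewrite oppr_gt0.
have decw u v : p <= u -> u <= v -> v <= q -> G v <= G u.
  move=> pu; rewrite le_eqVlt => /predU1P[->//|uv vq].
  by apply/ltW; exact: dec.
have inj u v : p <= u <= q -> p <= v <= q -> G u = G v -> u = v.
  move=> /andP[pu uq] /andP[pv vq] guv; apply/eqP; rewrite eq_le !leNgt.
  by apply/andP; split; apply/negP => h; [have := dec _ _ pv h uq|have := dec _ _ pu h vq];
    rewrite guv ltxx.
(* The inverse of [G] on its range; the default value [p] is taken outside it. *)
pose H (u : R) : R := xget p [set t | p <= t <= q /\ G t = u].
have GK : {in `[p, q], cancel G H}.
  move=> t; rewrite in_itv/= => tpq; apply: xget_unique => [//|s [spq gs]].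
  exact: inj.
have cH : {within `[G q, G p], continuous H}.
  apply: segment_can_ge_continuous => //.
  exact: continuous_subspaceT.
have levelE u : level p q u = (((k \o H) \_ `[G q, G p[) u)%:E.
  rewrite patchE /level; case: ifPn => [|].
    rewrite inE/= in_itv/= => /andP[gqu ugp].
    have [t0 + zt0] : exists2 c, c \in `[p, q] & G c = u.
      apply: IVT => //; first exact: continuous_subspaceT.
      by rewrite ge_min le_max gqu (ltW ugp) !orbT.
    move=> t0pq; move: (t0pq); rewrite in_itv/= => /andP[pt0 t0q].
    rewrite -zt0 GK//.
    apply: (@crossing_sum1 _ _ _ _ _ t0).
    - rewrite t0q andbT lt_neqAle pt0 andbT; apply/eqP => pe.
      by move: ugp; rewrite -zt0 pe ltxx.
    - by rewrite subrr.
    - move=> s ps sq /eqP; rewrite subr_eq0 => /eqP gs.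
      by apply: inj => //; rewrite ?(ltW ps) ?pt0.
  rewrite notin_setE/= in_itv/= => nu; apply: crossing_sum0 => t pt tq /eqP.
  rewrite subr_eq0 => /eqP gt; exfalso; apply: nu.
  by rewrite -gt (decw t q) ?(ltW pt)//= dec.
have gqp : G q <= G p by exact: decw.
have ckH : {within `[G q, G p], continuous (k \o H)}.
  by apply: within_continuous_comp cH => x _; exact: ck.
have mkH : measurable_fun (`[G q, G p] : set (measurableTypeR R)) (k \o H).
  by apply: subspace_continuous_measurable_fun => //; exact: measurable_itv.
have mlevel : measurable_fun [set: measurableTypeR R] ((k \o H) \_ `[G q, G p[).
  apply/(measurable_restrictT _ (measurable_itv _)).
  apply: measurable_funS mkH; first exact: measurable_itv.
  by apply: subset_itvl; rewrite bnd_simp.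
split.
  rewrite (_ : level p q = EFin \o ((k \o H) \_ `[G q, G p[)); last by apply/funext => u /=.
  exact/measurable_EFinP.
transitivity (\int[leb]_(x in `[G q, G p]) (k (H x) * phi x)%:E)%E.
  rewrite -integral_itv_bndo_bndc; last first.
    apply/measurable_EFinP; apply: measurable_funM; last first.
      by apply: measurable_funTS; exact: measurable_realfun.continuous_measurable_fun.
    apply: measurable_funS mkH; first exact: measurable_itv.
    by apply: subset_itvl; rewrite bnd_simp.
  rewrite [RHS]integral_mkcond; apply: eq_integral => x _.
  by rewrite levelE !patchE; case: ifP; rewrite /= ?EFinM// mul0e.
have ckHp : {within `[G q, G p], continuous (fun x => k (H x) * phi x)}.
  have cphi' : {within `[G q, G p], continuous phi} by exact: continuous_subspaceT.
  move=> x; have h1 := ckH x; have h2 := cphi' x; move: h1 h2.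
  rewrite /prop_for /continuous_at /from_subspace => h1 h2.
  exact: (cvgM h1 h2).
rewrite (substitution_decreasing dG cGd pq Gneg ckHp).
rewrite -integral_itv_obnd_cbnd//; last first.
  apply/measurable_EFinP.
  have m1 : measurable_fun [set: measurableTypeR R] (fun t => k t * phi (G t) * - Gd t).
    apply: measurable_realfun.continuous_measurable_fun => t.
    apply: cvgM; last by apply: cvgN; exact: cGd.
    apply: cvgM; first exact: ck.
    by apply: continuous_comp; [exact: cG|exact: cphi].
  apply: (eq_measurable_fun (fun t => k t * phi (G t) * - Gd t)).
    move=> t; rewrite inE/= in_itv/= => /andP[pt tq]; rewrite GK// in_itv/=.
    by rewrite (ltW pt).
  exact: measurable_funTS.
apply: eq_integral => t; rewrite inE/= in_itv/= => /andP[pt tq].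
by rewrite GK// in_itv/= (ltW pt).
Qed.

Let area_zero p q : (forall t, p <= t <= q -> k t = 0) -> holds p q.
Proof.
move=> k0.
have l0 u : level p q u = 0%E.
  by apply: crossing_sum0 => t pt tq _; apply: k0; rewrite (ltW pt).
split.
  by rewrite (_ : level p q = cst 0%E)//; exact/funext.
rewrite !integral0_eq// => [t|u _]; last by rewrite l0 mul0e.
by rewrite /= in_itv/= => /andP[pt tq]; rewrite k0 ?mul0r// (ltW pt).
Qed.

(** Only downward crossings of [G] carry weight: in the application the path is [rho (u - G)], which
    crosses 0 upwards exactly when [G] crosses [u] downwards. Near any time either [G] decreases or
    [k] vanishes, so the two preceding cases suffice. *)
Lemma area_formula a b : a <= b ->
  (forall t, a <= t <= b -> Gd t < 0 \/ \forall s \near t, k s = 0) ->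
  (\int[leb]_x (crossing_sum (fun t => G t - x)%R k a b * (phi x)%:E) =
   \int[leb]_(t in `]a, b]) (k t * phi (G t) * - Gd t)%:E)%E.
Proof.
move=> ab k_supp; suff [] : holds a b by [].
apply: (bisection_principle ab) => [x y ax xy yb [m1 e1] [m2 e2]|t tab].
  set c := (x + y) / 2 in m1 e1 m2 e2 *.
  have xc : x <= c by rewrite /c; lra.
  have cy : c <= y by rewrite /c; lra.
  have lc u : level x y u = (level x c u + level c y u)%E.
    apply: crossing_sum_cat => // t; apply: cvgB; [exact: cG|exact: cvg_cst].
  split.
    rewrite (_ : level x y = fun u => (level x c u + level c y u)%E); last exact/funext.
    exact: emeasurable_funD.
  have l0 p q u : (0 <= level p q u)%E by exact: crossing_sum_ge0.
  have mphi : measurable_fun [set: measurableTypeR R] (fun x => (phi x)%:E).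
    by apply/measurable_EFinP; exact: measurable_realfun.continuous_measurable_fun.
  under eq_integral do rewrite lc ge0_muleDl//.
  rewrite ge0_integralD//=.
  - rewrite e1 e2 -ge0_integral_setU//.
    + by rewrite -itv_bndbnd_setU ?bnd_simp.
    + apply/measurable_EFinP; apply: (@measurable_funTS _ _ (measurableTypeR R)).
      apply: measurable_realfun.continuous_measurable_fun => s.
      apply: cvgM; last by apply: cvgN; exact: cGd.
      apply: cvgM; first exact: ck.
      by apply: continuous_comp; [exact: cG|exact: cphi].
    + move=> s; rewrite -itv_bndbnd_setU ?bnd_simp//= in_itv/= => /andP[xs sy].
      rewrite lee_fin; have [|gs|/nbhs_singleton ->] := k_supp s; first lra.
        by rewrite !mulr_ge0// oppr_ge0 ltW.
      by rewrite !mul0r.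
    + apply/disj_setPRL => s; rewrite /= !in_itv/= => /andP[h1 h2] /andP[h3 h4]; lra.
  - by move=> u _; rewrite mule_ge0// lee_fin.
  - exact: emeasurable_funM.
  - by move=> u _; rewrite mule_ge0// lee_fin.
  - exact: emeasurable_funM.
have [gt|] := k_supp t tab.
  have [d d0 hd] := continuous_near_lt cGd gt; exists d => // x y ax xt ty yb yx.
  apply: area_decreasing => [|s /andP[xs sy]]; first lra.
  by apply: hd; rewrite ltr_norml; apply/andP; split; lra.
move=> /nbhs_ballP[d /= d0 hd]; exists d => // x y ax xt ty yb yx.
apply: area_zero => s /andP[xs sy].
by apply: hd; rewrite /ball/= ltr_norml; apply/andP; split; lra.
Qed.

End area.

(** * Integrals of almost everywhere measurable functions *)

Lemma limn_esup_ge0 (R : realType) (u : (\bar R)^nat) : (forall n, 0 <= u n)%E ->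
  (0 <= limn_esup u)%E.
Proof.
move=> u0; rewrite limn_esup_lim; apply: lime_ge; first exact: is_cvg_esups.
apply: nearW => n; apply: (le_trans (u0 n)); apply: ereal_sup_ubound.
by exists n => //=.
Qed.

Section ae_integral.
Context d (T : measurableType d) (R : realType) (mu : measure T R).

(* The library's integral of a nonnegative function is a lower integral: the
   value is still the expected one for a function which is only almost
   everywhere equal to a measurable one. *)
Lemma integral_ae_measurable (F g : T -> \bar R) :
  (forall o, 0 <= F o)%E -> measurable_fun setT g -> (forall o, 0 <= g o)%E ->
  {ae mu, forall o, F o = g o} -> (\int[mu]_o F o = \int[mu]_o g o)%E.
Proof.
move=> F0 mg g0 [N [mN N0 hN]].
have mono (f h : T -> \bar R) : (forall o, 0 <= f o)%E -> (forall o, 0 <= h o)%E ->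
    (forall o, f o <= h o)%E -> (\int[mu]_o f o <= \int[mu]_o h o)%E.
  move=> f0 h0 fh; rewrite !ge0_integralTE//; apply: ereal_sup_le.
  by move=> _ [s hs <-]; exists s => // o; exact: le_trans (hs o) (fh o).
(* [F] lies between [v 0] and [v +oo], two measurable functions that differ only on the null set
   [N]; comparing the integrals by [mono] does not involve the measurability of [F]. *)
pose v (c : \bar R) o : \bar R := if o \in N then c else g o.
have mv c : measurable_fun setT (v c).
  apply: measurable_fun_if => //.
    apply: (measurable_fun_bool true); rewrite setTI.
    rewrite (_ : _ @^-1` _ = N)//; apply/seteqP; split => o /=; first exact: set_mem.
    exact: mem_set.
  by apply: measurable_funTS.
have v0 c o : (0 <= c)%E -> (0 <= v c o)%E by rewrite /v; case: ifP.
have ve c : (0 <= c)%E -> (\int[mu]_o v c o = \int[mu]_o g o)%E.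
  move=> c0; apply: ge0_ae_eq_integral => //; first by move=> o _; exact: v0.
  exists N; split => // o /=; apply: contra_notP => oN _.
  by rewrite /v memNset.
apply/eqP; rewrite eq_le -{1}(ve +oo%E)// -(ve 0%E)//; apply/andP; split; apply: mono => //.
- by move=> o; exact: v0.
- move=> o; rewrite /v; case: ifPn => [_|]; first exact: leey.
  rewrite notin_setE => oN; rewrite le_eqVlt; apply/orP; left; apply/eqP.
  by apply: contra_notP oN => h; exact: hN.
- by move=> o; exact: v0.
- move=> o; rewrite /v; case: ifPn => [_|]; first exact: F0.
  rewrite notin_setE => oN; rewrite le_eqVlt; apply/orP; left; apply/eqP.
  by apply: contra_notP oN => h; apply: hN => /= e; apply: h.
Qed.

(** A statement on the integral of [F] that is insensitive to exceptional paths, where a count of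
    crossings need not be measurable. *)
Definition ae_integral (F : T -> \bar R) (c : \bar R) := exists g : T -> \bar R,
  [/\ measurable_fun setT g, forall o, (0 <= g o)%E, {ae mu, forall o, F o = g o} &
      (\int[mu]_o g o = c)%E].

Lemma ae_integralE F c : (forall o, 0 <= F o)%E -> ae_integral F c ->
  (\int[mu]_o F o = c)%E.
Proof. by move=> F0 [g [mg g0 Fg <-]]; exact: integral_ae_measurable. Qed.

Lemma ae_integralD F G c c' : ae_integral F c -> ae_integral G c' ->
  ae_integral (fun o => F o + G o)%E (c + c')%E.
Proof.
move=> [f [mf f0 Ff <-]] [g [mg g0 Gg <-]]; exists (fun o => f o + g o)%E; split.
- exact: emeasurable_funD.
- by move=> o; exact: adde_ge0.
- by apply: filterS2 Ff Gg => o -> ->.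
- by rewrite ge0_integralD.
Qed.

Lemma ae_integral_eq F G c : {ae mu, forall o, F o = G o} -> ae_integral F c ->
  ae_integral G c.
Proof.
move=> FG [f [mf f0 Ff <-]]; exists f; split => //.
by apply: filterS2 FG Ff => o <-.
Qed.

(** Convergence is asked only where [F_ 0] is finite: this holds almost everywhere because [c_ 0] is
    finite, and it is what dominated convergence along a single path will need. The upper limit
    supplies a measurable version of [F]. *)
Lemma ae_integral_dominated (F_ : nat -> T -> \bar R) F c_ c :
  (forall n, ae_integral (F_ n) (c_ n)) -> (c_ 0%N < +oo)%E ->
  {ae mu, forall o n, (F_ n o <= F_ 0%N o)%E} ->
  {ae mu, forall o, (F_ 0%N o < +oo)%E -> F_ n o @[n --> \oo] --> F o} ->
  (c_ n @[n --> \oo] --> c) -> ae_integral F c.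
Proof.
move=> /choice[f hf] c0 dom Fcvg c_cvg.
have mf n : measurable_fun setT (f n) by have [] := hf n.
have f0 n o : (0 <= f n o)%E by have [] := hf n.
have fc n : (\int[mu]_o f n o = c_ n)%E by have [] := hf n.
have if0 : mu.-integrable setT (f 0%N).
  apply/integrableP; split => //; rewrite (le_lt_trans _ c0)// -fc.
  by apply: ge0_le_integral => // [|o _]; [exact: measurableT_comp|rewrite gee0_abs].
have Ff : {ae mu, forall o n, F_ n o = f n o}.
  by apply: ae_foralln => n; have [] := hf n.
have f0fin : {ae mu, forall o, (f 0%N o < +oo)%E}.
  have := integrable_ae measurableT if0; apply: filterS => o /(_ Logic.I).
  by rewrite ltey_eq => ->.
have mlim : measurable_fun setT (fun o => limn_esup (f^~ o)) by exact: measurable_fun_limn_esup.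
have fcvg : {ae mu, forall o, f n o @[n --> \oo] --> F o}.
  apply: filterS3 Ff f0fin Fcvg => o e fin h.
  by rewrite -(_ : F_^~ o = f^~ o); [apply: h; rewrite e|exact/funext].
exists (fun o => limn_esup (f^~ o)); split => //.
- by move=> o; exact: limn_esup_ge0.
- by apply: filterS fcvg => o /cvg_limn_einf_sup[_ ->].
have h1 : {ae mu, forall o, setT o -> f n o @[n --> \oo] --> limn_esup (f^~ o)}.
  by apply: filterS fcvg => o h _; have [_ ->] := cvg_limn_einf_sup h.
have h2 : {ae mu, forall o n, setT o -> (`|f n o| <= f 0%N o)%E}.
  by apply: filterS2 Ff dom => o e h n _; rewrite gee0_abs// -!e.
have [_ _] := @dominated_convergence _ _ _ mu setT measurableT f
  (fun o => limn_esup (f^~ o)) (f 0%N) mf mlim h1 if0 h2.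
under eq_fun do rewrite fc.
by move=> h; exact: (cvg_unique _ h c_cvg).
Qed.

Lemma ae_integral_monotone (F_ : nat -> T -> \bar R) F c_ c :
  (forall n, ae_integral (F_ n) (c_ n)) ->
  {ae mu, forall o n, (F_ n o <= F_ n.+1 o)%E} ->
  {ae mu, forall o, F_ n o @[n --> \oo] --> F o} ->
  (c_ n @[n --> \oo] --> c) -> ae_integral F c.
Proof.
move=> /choice[f hf] incr Fcvg c_cvg.
have mf n : measurable_fun setT (f n) by have [] := hf n.
have f0 n o : (0 <= f n o)%E by have [] := hf n.
have fc n : (\int[mu]_o f n o = c_ n)%E by have [] := hf n.
have Ff : {ae mu, forall o n, F_ n o = f n o}.
  by apply: ae_foralln => n; have [] := hf n.
(* The running maximum is monotone for every outcome, and it equals [f n] almost everywhere. *)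
pose h := fix h n o : \bar R := if n is n'.+1 then maxe (h n' o) (f n o) else f 0%N o.
have mh n : measurable_fun setT (h n).
  by elim: n => [|n IH]; [exact: mf|exact: measurable_maxe].
have h0 n o : (0 <= h n o)%E.
  by elim: n => [|n IH]; [exact: f0|rewrite /= le_max IH].
have hmono o : nondecreasing_seq (h^~ o).
  by apply/nondecreasing_seqP => n; rewrite /= le_max lexx.
have hf_eq : {ae mu, forall o n, h n o = f n o}.
  apply: filterS2 Ff incr => o e i; elim=> [//|n IH] /=.
  by rewrite IH; apply/max_idPr; rewrite -!e.
have Fh : {ae mu, forall o, h n o @[n --> \oo] --> F o}.
  apply: filterS3 Ff hf_eq Fcvg => o e1 e2.
  by rewrite (_ : h^~ o = F_^~ o)//; apply/funext => n; rewrite e1 e2.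
exists (fun o => limn (h^~ o)); split => //.
- rewrite (_ : (fun o => _) = fun o => limn_esup (h^~ o)); first exact: measurable_fun_limn_esup.
  by apply/funext => o; rewrite is_cvg_limn_esupE//; exact: ereal_nondecreasing_is_cvgn.
- by move=> o; apply: lime_ge; [exact: ereal_nondecreasing_is_cvgn|exact: nearW].
- by apply: filterS Fh => o; move/cvg_lim => ->.
have := @cvg_monotone_convergence _ _ _ mu setT measurableT h mh (fun n o _ => h0 n o)
  (fun o _ => hmono o).
rewrite (_ : (fun n => _) = c_); first by move=> hh; exact: (cvg_unique _ hh c_cvg).
apply/funext => n; rewrite -fc; apply: ge0_ae_eq_integral => //.
by apply: filterS hf_eq => o ->.
Qed.

End ae_integral.

(* Sampling the time on the grid [int / n.+1] makes a path-continuous family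
   jointly measurable. *)
Lemma joint_version d (T : measurableType d) (R : realType) (mu : measure T R)
    (h : R -> T -> R) :
  (forall t, measurable_fun setT (h t)) -> (forall t o, 0 <= h t o) ->
  {ae mu, forall o, continuous (h^~ o)} ->
  exists g : measurableTypeR R * T -> \bar R, [/\ measurable_fun setT g,
    forall p, (0 <= g p)%E & {ae mu, forall o, forall t, g (t, o) = (h t o)%:E}].
Proof.
move=> mh h0 ch.
pose fl n (t : R) : int := Num.floor (t * n.+1%:R).
pose g_ n (p : measurableTypeR R * T) : \bar R := (h ((fl n p.1)%:~R / n.+1%:R) p.2)%:E.
have mg n : measurable_fun setT (g_ n).
  apply/measurable_EFinP => _ A mA; rewrite setTI.
  rewrite (_ : _ @^-1` A = \bigcup_k ([set t | fl n t = k] `*`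
      (h (k%:~R / n.+1%:R) @^-1` A))); last first.
    apply/seteqP; split => [[t o] /= hA|[t o] [k _] [/= <- //]].
    by exists (fl n t).
  apply: countable_bigcupT_measurable => [|k].
    exact: countableP.
  apply: measurableX; last by rewrite -[X in measurable X]setTI; exact: mh.
  rewrite (_ : [set t | _] = `[k%:~R / n.+1%:R, (k + 1)%:~R / n.+1%:R[%classic).
    exact: measurable_itv.
  apply/seteqP; split => t /=; rewrite in_itv/= ler_pdivrMr// ltr_pdivlMr// -floor_eq.
    by move/eqP.
  by move/eqP.
exists (fun p => limn_esup (g_^~ p)); split.
- exact: measurable_fun_limn_esup.
- by move=> p; apply: limn_esup_ge0 => n; rewrite lee_fin.
- apply: filterS ch => o co t.
  suff : g_ n (t, o) @[n --> \oo] --> (h t o)%:E by move/cvg_limn_einf_sup => [].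
  apply: cvg_EFin; first exact: nearW.
  have flt : (fl n t)%:~R / n.+1%:R @[n --> \oo] --> t.
    apply: (@squeeze_cvgr _ _ _ _ (fun n => t - n.+1%:R^-1) (cst t)).
    - apply: nearW => n; have /andP[h1 h2] := floor_itv (t * n.+1%:R).
      rewrite /cst/= ler_pdivrMr// h1 andbT ler_pdivlMr// mulrBl mulVf// lerBlDr.
      by move: h2; rewrite intrD => /ltW.
    - rewrite -[X in _ --> X]subr0; apply: cvgB; first exact: cvg_cst.
      exact: cvg_harmonic.
    - exact: cvg_cst.
  exact: (cvg_comp _ _ flt (co t)).
Qed.

(** If [h1 0 < h2 0], the points [m1 < m2] at one and two thirds of the gap separate the two
    functions on a short [[0, e]], and the integrals over it would differ. *)
Lemma eq_at0_of_integrals (R : realType) (h1 h2 : R -> R) :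
  continuous h1 -> continuous h2 ->
  (forall e : R, 0 < e -> e <= 1 -> (\int[lebesgue_measure]_(x in `[0%R, e]) (h1 x)%:E =
     \int[lebesgue_measure]_(x in `[0%R, e]) (h2 x)%:E)%E) ->
  (forall x, 0 <= h1 x) -> (forall x, 0 <= h2 x) -> h1 0 = h2 0.
Proof.
wlog : h1 h2 / h1 0 < h2 0.
  move=> wl c1 c2 h12 p1 p2; apply/eqP; rewrite eq_le !leNgt; apply/andP.
  split; apply/negP => lt; [have := wl h2 h1 lt c2 c1 _ p2 p1|have := wl h1 h2 lt c1 c2 h12 p1 p2].
    by move=> e; move: lt; rewrite e ?ltxx// => x x0 /(h12 _ x0).
  by move=> e; move: lt; rewrite e ltxx.
move=> lt c1 c2 h12 p1 p2; exfalso.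
set m1 := (2 * h1 0 + h2 0) / 3; set m2 := (h1 0 + 2 * h2 0) / 3.
have [d1 d10 hd1] := continuous_near_lt (t := 0) (c := m1) c1 ltac:(rewrite /m1; lra).
have [d2 d20 hd2] := continuous_near_gt (t := 0) (c := m2) c2 ltac:(rewrite /m2; lra).
pose e := Num.min 1 (Num.min d1 d2) / 2.
have e0 : 0 < e by rewrite divr_gt0// !lt_min ltr01 d10.
have [e1 ed1 ed2] : [/\ e <= 1, e < d1 & e < d2].
  have k1 : Num.min 1 (Num.min d1 d2) <= 1 by rewrite ge_min lexx.
  have k2 : Num.min 1 (Num.min d1 d2) <= d1 by rewrite !ge_min lexx orbT.
  have k3 : Num.min 1 (Num.min d1 d2) <= d2 by rewrite !ge_min lexx !orbT.
  by move: e0; rewrite /e; split; lra.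
have mh (h : R -> R) : continuous h -> measurable_fun (`[0, e]%classic : set (measurableTypeR R)) (EFin \o h).
  move=> ch; apply/measurable_EFinP; apply: measurable_funTS.
  exact: measurable_realfun.continuous_measurable_fun.
have cst_e m : (\int[lebesgue_measure]_(x in `[0%R, e]) m%:E = (m * e)%:E)%E.
  rewrite integral_cst; last exact: measurable_itv.
  by rewrite /= lebesgue_measure_itv/= lte_fin e0 oppr0 adde0.
have u : (\int[lebesgue_measure]_(x in `[0%R, e]) (h1 x)%:E <= (m1 * e)%:E)%E.
  rewrite -cst_e; apply: ge0_le_integral.
  - exact: measurable_itv.
  - by move=> x _; rewrite lee_fin.
  - exact: mh.
  - exact: measurable_cst.
  - move=> x; rewrite /= in_itv/= => /andP[x0 xe]; rewrite lee_fin ltW//.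
    by apply: hd1; rewrite sub0r normrN ger0_norm// (le_lt_trans xe).
have l : ((m2 * e)%:E <= \int[lebesgue_measure]_(x in `[0%R, e]) (h2 x)%:E)%E.
  rewrite -cst_e; apply: ge0_le_integral.
  - exact: measurable_itv.
  - by move=> x _; rewrite lee_fin /m2; have := p1 0; have := p2 0; lra.
  - exact: measurable_cst.
  - exact: mh.
  - move=> x; rewrite /= in_itv/= => /andP[x0 xe]; rewrite lee_fin ltW//.
    by apply: hd2; rewrite sub0r normrN ger0_norm// (le_lt_trans xe).
have := le_trans l (eq_ind _ (fun z => (z <= _)%E) u _ (h12 e e0 e1)).
by rewrite lee_fin ler_pM2r// leNgt => /negP; apply; rewrite /m1 /m2; lra.
Qed.

(** * Gaussian regression *)

Section product_law.
Context d1 d2 (T1 : measurableType d1) (T2 : measurableType d2) (R : realType).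
Variables (m1 : {finite_measure set T1 -> \bar R}) (m2 : {finite_measure set T2 -> \bar R}).

Lemma product_finite_ex : exists Q : {finite_measure set (T1 * T2)%type -> \bar R},
  forall A, Q A = (m1 \x m2)%E A.
Proof. exact: (measure_finite_ex (product_measure_lty m1 m2)). Qed.

Lemma Rintegral_product (f : T1 * T2 -> R) (C : R) : measurable_fun setT f ->
  (forall x, `|f x| <= C) ->
  \int[(m1 \x m2)%E]_x f x = \int[m1]_x (\int[m2]_y f (x, y)).
Proof.
move=> mf fC; have if_ := bounded_integrable2 m1 m2 mf fC.
rewrite /Rintegral; congr fine.
rewrite -(integral12_prod_meas1 if_) /fubini_F; apply: eq_integral => x _.
rewrite fineK//; apply: integrable_fin_num => //.
apply: (@bounded_integrable _ _ _ _ _ C) => //.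
exact: measurableT_comp.
Qed.

End product_law.

Section regression.
Context d (T : measurableType d) (R : realType) (P : probability T R).
Variable W : R -> R -> {RV P >-> R}.
Variable K : R -> R -> R.
Hypothesis W_gauss : gaussian_field W.
Hypothesis W_mean : forall x t : R, ('E_P[W x t] = 0)%E.
Hypothesis W_cov : forall x t xi tau : R,
  ('E_P[fun o => (W x t o * W (x + xi)%R (t + tau)%R o)%R] = (K xi tau)%:E)%E.

Variables (I : Type) (V : I -> T -> R) (xi : T -> R) (s : R).
Hypothesis V_gspace : forall i, in_gspace W (V i).
Hypothesis xi_gspace : in_gspace W xi.
Hypothesis s_neq0 : s != 0.
Hypothesis s_var : s ^+ 2 = covar P xi xi.

Let c i := covar P (V i) xi / s ^+ 2.
Let V' i (p : T * measurableTypeR R) : R := V i p.1 + c i * (p.2 - xi p.1).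

Let mxi := gspace_measurable xi_gspace.

(* The regression coefficients [c i] make [V i - c i * xi] uncorrelated with,
   hence independent of, [xi]; [xi] may then be replaced by an independent
   copy of itself. *)
Lemma gaussian_regression (Phi : path_space R I -> \bar R) : measurable_fun setT Phi ->
  (forall w, (0 <= Phi w)%E) ->
  (\int[P]_o Phi (V^~ o) =
   \int[P]_o \int[normal_prob 0 s]_u Phi (fun i => V i o + c i * (u - xi o))%R)%E.
Proof.
move=> mPhi Phi0.
have mV' i : measurable_fun setT (V' i).
  apply: measurable_funD.
    exact: (measurableT_comp (gspace_measurable (V_gspace i)) measurable_fst).
  apply: measurable_funM => //; apply: measurable_funB => //.
  exact: (measurableT_comp mxi measurable_fst).
have mV i : measurable_fun setT (V i) by exact: gspace_measurable (V_gspace i).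
have [Q hQ] := product_finite_ex P (normal_prob 0 s).
have char_eq (ls : seq (R * I)) b : \int[P]_o cos (lin V ls o + b) =
    \int[Q]_p cos (lin V' ls p + b).
  have -> : \int[Q]_p cos (lin V' ls p + b) =
      \int[(P \x normal_prob 0 s)%E]_p cos (lin V' ls p + b).
    by rewrite /Rintegral; congr fine; apply: eq_measure_integral => A mA _; exact: hQ.
  pose L := lin V ls; pose a := \sum_(p <- ls) p.1 * c p.2.
  have gL : in_gspace W L by exact: gspace_lin.
  have linE p : lin V' ls p = L p.1 + a * (p.2 - xi p.1).
    rewrite /lin /L /lin /a mulr_suml -big_split /=; apply: eq_bigr => q _.
    by rewrite /V' mulrDr mulrA.
  have aE : covar P L xi = a * s ^+ 2.
    rewrite /L /a; elim: ls {linE L gL a}.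
      rewrite big_nil mul0r /covar.
      by under eq_Rintegral do rewrite /lin big_nil mul0r; rewrite Rintegral_cst// mul0r.
    move=> q ls IH; rewrite big_cons mulrDl -IH.
    have e1 : lin V (q :: ls) = fun o => q.1 * V q.2 o + lin V ls o.
      by apply/funext => o; rewrite /lin big_cons.
    rewrite e1 (covarDl W_gauss W_mean W_cov) => //; [|exact: gspaceZ|exact: gspace_lin].
    rewrite (covarZl W_gauss W_mean W_cov)//; congr (_ + _).
    by rewrite /c -mulrA divfK// sqrf_eq0.
  rewrite (@Rintegral_product _ _ _ _ _ _ _ _ 1)//; last 2 first.
  - apply: measurable_fun_cos.
    by apply: measurable_funD => //; exact: measurable_lin.
  - by move=> p; rewrite ler_norml cos_geN1 cos_le1.
  have inner o : \int[normal_prob 0 s]_u cos (lin V' ls (o, u) + b) =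
      cos (L o + (- a) * xi o + b) * expR (- (s ^+ 2 * a ^+ 2) / 2).
    rewrite -(Rintegral_normal_prob_cos 0 s_neq0); apply: eq_Rintegral => u _.
    by rewrite linE/=; congr (cos _); ring.
  transitivity (\int[P]_o (cos (L o + - a * xi o + b) * expR (- (s ^+ 2 * a ^+ 2) / 2)));
    last by apply: eq_Rintegral => o _; rewrite -inner.
  (* Since [a s^2] is the covariance of [L] and [xi], the variance of [L] is that of [L - a xi] plus
     [a^2 s^2]: what is lost by removing [xi] is restored by the independent copy. *)
  have gY : in_gspace W (fun o => L o + - a * xi o) by apply: gspaceD => //; exact: gspaceZ.
  rewrite RintegralZr//; last first.
    by apply: integrable_cos; apply: measurable_funD => //; exact: gspace_measurable gY.
  rewrite (gspace_cos W_gauss W_mean W_cov b gL) (gspace_cos W_gauss W_mean W_cov b gY).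
  rewrite -mulrA -expRD; congr (_ * expR _).
  rewrite !covarXX (covarDD W_gauss W_mean W_cov)//; last exact: gspaceZ.
  rewrite (covarZl W_gauss W_mean W_cov)//; last exact: gspaceZ.
  rewrite ![covar P _ (fun o => - a * xi o)]covarC !(covarZl W_gauss W_mean W_cov)//.
  rewrite (covarC P xi L) aE -s_var; by field.
rewrite (law_eq mV mV' char_eq mPhi Phi0).
transitivity (\int[(P \x normal_prob 0 s)%E]_p Phi (V'^~ p))%E.
  by apply: eq_measure_integral => A mA _; exact: hQ.
rewrite fubini_tonelli1//.
exact: (measurableT_comp mPhi (measurable_to_path mV')).
Qed.

End regression.

(** * Derivatives of the field along the path of the ship *)

Lemma is_derive_cvg (R : realType) (f : R -> R) (t l : R) :
  is_derive t (1:R) f l <-> h^-1 * (f (h + t) - f t) @[h --> 0^'] --> l.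
Proof.
have e : (fun h : R => h^-1 *: ((f \o shift t) (h *: (1:R)) - f t)) =
    (fun h => h^-1 * (f (h + t) - f t)).
  by apply/funext => h; rewrite /= !regular_scaleE mulr1.
split => [[der <-]|h].
  by move: der; rewrite /derivable /derive e => /cvg_ex[l' cl]; rewrite (cvg_lim _ cl).
have hl : (fun h : R => h^-1 *: ((f \o shift t) (h *: (1:R)) - f t)) @ 0^' --> l by rewrite e.
apply: DeriveDef; first by apply/cvg_ex; exists l.
by rewrite /derive; exact: cvg_lim hl.
Qed.

Lemma is_derive_cvg_harmonic (R : realType) (f : R -> R) (t l : R) :
  is_derive t (1:R) f l -> n.+1%:R * (f (t + n.+1%:R^-1) - f t) @[n --> \oo] --> l.
Proof.
move=> /is_derive_cvg /cvgr_dnbhsP /(_ (fun n => n.+1%:R^-1)) h.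
have -> : (fun n => n.+1%:R * (f (t + n.+1%:R^-1) - f t)) =
    (fun n => (n.+1%:R^-1)^-1 * (f (n.+1%:R^-1 + t) - f t)).
  by apply/funext => n; rewrite invrK [t + _]addrC.
by apply: h; split => [n|]; [rewrite invr_eq0|exact: cvg_harmonic].
Qed.

(** The increment is split along the two axes and the mean value theorem is applied on each; the
    intermediate points [c h] and [e h] converge, and continuity of the partial derivatives
    concludes. *)
Lemma is_derive_line (R : realType) (w wx wt : R -> R -> R) (v t : R) :
  (forall x t : R, is_derive x (1:R) (w^~ t) (wx x t)) ->
  (forall x t : R, is_derive t (1:R) (w x) (wt x t)) ->
  continuous (fun p : R * R => wx p.1 p.2) -> continuous (fun p : R * R => wt p.1 p.2) ->
  is_derive t (1:R) (fun s => w (v * s) s) (v * wx (v * t) t + wt (v * t) t).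
Proof.
move=> dx dt cx ct; apply/is_derive_cvg.
have mv (g g' : R -> R) a b : (forall x : R, is_derive x (1:R) g (g' x)) ->
    exists2 c, `|c - a| <= `|b - a| & g b - g a = g' c * (b - a).
  move=> dg; have [ab|ba|->] := ltgtP a b; last first.
  - by exists b; rewrite ?subrr ?normr0 ?mulr0.
  - have [c + e] := MVT ba (fun x _ => dg x)
      (continuous_subspaceT (is_derive_continuous dg)).
    rewrite in_itv/= => /andP[bc ca]; exists c.
      by rewrite ![`|_ - a|]distrC !ger0_norm; lra.
    by rewrite -opprB e; ring.
  - have [c + e] := MVT ab (fun x _ => dg x)
      (continuous_subspaceT (is_derive_continuous dg)).
    rewrite in_itv/= => /andP[ac cb]; exists c => //.
    by rewrite !ger0_norm; lra.
have /choice[c hc] : forall h, exists c, `|c - v * t| <= `|v * (h + t) - v * t| /\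
    w (v * (h + t)) (h + t) - w (v * t) (h + t) = wx c (h + t) * (v * (h + t) - v * t).
  by move=> h; have [c c1 c2] := mv _ _ (v * t) (v * (h + t)) (fun x => dx x (h + t)); exists c.
have /choice[e he] : forall h, exists e, `|e - t| <= `|h + t - t| /\
    w (v * t) (h + t) - w (v * t) t = wt (v * t) e * (h + t - t).
  by move=> h; have [e e1 e2] := mv _ _ t (h + t) (dt (v * t)); exists e.
have h0 : (h : R) @[h --> 0^'] --> (0 : R) by exact: cvg_within.
have ht : (h : R) + t @[h --> 0^'] --> t.
  by rewrite -[X in _ --> X]add0r; apply: cvgD => //; exact: cvg_cst.
have cc : c h @[h --> 0^'] --> v * t.
  apply/cvgrPdist_le => r r0.
  have : (v * h) @[h --> 0^'] --> v * 0 by apply: cvgMr.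
  rewrite mulr0 => /cvgrPdist_le /(_ r r0); apply: filterS => h.
  rewrite sub0r normrN => hr; rewrite distrC; have [h1 _] := hc h.
  by apply: le_trans h1 _; rewrite mulrDr addrK.
have ec : e h @[h --> 0^'] --> t.
  apply/cvgrPdist_le => r r0.
  move/cvgrPdist_le : (h0) => /(_ r r0); apply: filterS => h.
  rewrite sub0r normrN => hr; rewrite distrC; have [h1 _] := he h.
  by apply: le_trans h1 _; rewrite addrK.
have F := @dnbhs_filter R 0.
have k1 : wx (c h) (h + t) @[h --> 0^'] --> wx (v * t) t.
  exact: (cvg_comp _ _ (cvg_pair cc ht) (cx (v * t, t))).
have k2 : wt (v * t) (e h) @[h --> 0^'] --> wt (v * t) t.
  exact: (cvg_comp _ _ (cvg_pair (cvg_cst (v * t)) ec) (ct (v * t, t))).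
have k : v * wx (c h) (h + t) + wt (v * t) (e h) @[h --> 0^'] -->
    v * wx (v * t) t + wt (v * t) t.
  by apply: cvgD => //; exact: cvgMr.
apply: cvg_trans k; apply: near_eq_cvg.
near=> h; have h_neq0 : h != 0 by near: h; exact: nbhs_dnbhs_neq.
have [_ e1] := hc h; have [_ e2] := he h.
rewrite -[in RHS](subrK (w (v * t) (h + t)) (w (v * (h + t)) (h + t))) -addrA e1 e2.
by field.
Unshelve. all: end_near. Qed.

(** Reduces continuity in a real parameter to sequences, for which the convergence theorems are
    stated. *)
Lemma cvg_at_of_seq (R : realType) (f : R -> R) (t l : R) :
  (forall u : nat -> R, u n @[n --> \oo] --> t -> f (u n) @[n --> \oo] --> l) ->
  f x @[x --> t] --> l.
Proof.
move=> h; apply/cvgrPdist_lt => e e0; apply: contrapT => nnear.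
have /choice[u hu] : forall n : nat, exists x, `|t - x| < n.+1%:R^-1 /\ ~ `|l - f x| < e.
  move=> n; apply: contrapT => hn; apply: nnear.
  apply/nbhs_ballP; exists n.+1%:R^-1 => /=; first by rewrite invr_gt0.
  by move=> x tx; apply: contrapT => lx; apply: hn; exists x.
have ut : u n @[n --> \oo] --> t.
  apply/cvgrPdist_lt => r r0; near=> n.
  have [h1 _] := hu n; apply: lt_trans h1 _.
  by near: n; exact: (near_infty_natSinv_lt (PosNum r0)).
have /cvgrPdist_lt /(_ e e0) [n _ hn] := h u ut.
by have [_] := hu n; apply; exact: (hn n (leqnn n)).
Unshelve. all: end_near. Qed.

Section jets.
Context d (T : measurableType d) (R : realType) (P : probability T R).
Variables W Wx Wt : R -> R -> {RV P >-> R}.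
Variable K : R -> R -> R.
Hypothesis W_gauss : gaussian_field W.
Hypothesis W_mean : forall x t : R, ('E_P[W x t] = 0)%E.
Hypothesis W_cov : forall x t xi tau : R,
  ('E_P[fun o => (W x t o * W (x + xi)%R (t + tau)%R o)%R] = (K xi tau)%:E)%E.
Hypothesis W_C1 : as_C1_with W Wx Wt.

Definition jet (a b c : R) (p : R * R) (o : T) : R :=
  a * W p.1 p.2 o + b * Wx p.1 p.2 o + c * Wt p.1 p.2 o.

Let shift_comb (p : R * R) (L : comb R) : comb R :=
  [seq (x.1, (p.1 + x.2.1, p.2 + x.2.2)) | x <- L].

Let qform_shift p L : qform K (shift_comb p L) = qform K L.
Proof.
rewrite /qform big_map; apply: eq_bigr => x _; rewrite big_map.
by apply: eq_bigr => y _ /=; congr (_ * K _ _); ring.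
Qed.

(** The value of the field and two difference quotients of step [1 / (n + 1)], written at the origin
    and then shifted to [p]. *)
Let jet_comb (a b c : R) (p : R * R) (n : nat) : comb R :=
  let N : R := n.+1%:R in
  shift_comb p [:: (a, (0, 0)); (b * N, (N^-1, 0)); (- (b * N), (0, 0));
      (c * N, (0, N^-1)); (- (c * N), (0, 0))].

Let jet_comb_cvg a b c p : {ae P, forall o,
  lin (field_val W) (jet_comb a b c p n) o @[n --> \oo] --> jet a b c p o}.
Proof.
apply: filterS W_C1 => o [dx dt _ _].
have cx := is_derive_cvg_harmonic (dx p.1 p.2).
have ct := is_derive_cvg_harmonic (dt p.1 p.2).
rewrite (_ : (fun n => _) = fun n => a * W p.1 p.2 o +
    b * (n.+1%:R * (W (p.1 + n.+1%:R^-1) p.2 o - W p.1 p.2 o)) +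
    c * (n.+1%:R * (W p.1 (p.2 + n.+1%:R^-1) o - W p.1 p.2 o))).
  apply: cvgD; first by apply: cvgD; [exact: cvg_cst|exact: cvgMr].
  exact: cvgMr.
apply/funext => n; rewrite /lin /jet_comb /shift_comb big_map !big_cons big_nil /field_val /=.
by rewrite !addr0; ring.
Qed.

Lemma measurable_jet a b c p : measurable_fun setT (jet a b c p).
Proof.
by apply: measurable_funD; [apply: measurable_funD|]; exact: measurable_funM.
Qed.

Lemma jet_gspace a b c p : in_gspace W (jet a b c p).
Proof.
split; first exact: measurable_jet.
by exists (jet_comb a b c p); exact: jet_comb_cvg.
Qed.

(** The approximating combinations at [p] and at [q] have the same quadratic form, because the
    covariance depends on displacements only; equality of the transforms passes to the limit. *)
Lemma jet_char_shift a b c p q r :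
  \int[P]_o cos (jet a b c p o + r) = \int[P]_o cos (jet a b c q o + r).
Proof.
have mlin L : measurable_fun setT (lin (field_val W) L).
  by apply: measurable_lin; exact: measurable_field_val.
have h s : \int[P]_o cos (lin (field_val W) (jet_comb a b c s n) o + r) @[n --> \oo] -->
    \int[P]_o cos (jet a b c s o + r).
  apply: (@bounded_cvg_Rintegral _ _ _ _ _ _ 1).
  - by move=> n; apply: measurable_fun_cos; exact: measurable_funD.
  - by apply: measurable_fun_cos; apply: measurable_funD => //; exact: measurable_jet.
  - by move=> n o; rewrite ler_norml cos_geN1 cos_le1.
  - apply: filterS (jet_comb_cvg a b c s) => o ho.
    apply: (cvg_comp _ _ (cvgD ho (cvg_cst r))); exact: continuous_cos.
have e n : \int[P]_o cos (lin (field_val W) (jet_comb a b c p n) o + r) =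
    \int[P]_o cos (lin (field_val W) (jet_comb a b c q n) o + r).
  have gL L : in_gspace W (lin (field_val W) L).
    by apply: gspace_lin => i; exact: gspace_val.
  rewrite (gspace_cos W_gauss W_mean W_cov r (gL (jet_comb a b c p n))).
  rewrite (gspace_cos W_gauss W_mean W_cov r (gL (jet_comb a b c q n))).
  by rewrite !(lin_qform W_cov) /jet_comb !qform_shift.
have := h p; under eq_fun do rewrite e.
by move/(cvg_unique (@norm_hausdorff _ _)); apply; exact: h.
Qed.

Lemma jet_law_shift p q (h : R * R * R -> \bar R) : measurable_fun setT h ->
  (forall x, (0 <= h x)%E) ->
  (\int[P]_o h (Wx p.1 p.2 o, Wt p.1 p.2 o, W p.1 p.2 o) =
   \int[P]_o h (Wx q.1 q.2 o, Wt q.1 q.2 o, W q.1 q.2 o))%E.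
Proof.
move=> mh h0.
pose V (s : R * R) (i : option bool) : T -> R :=
  match i with None => W s.1 s.2 | Some true => Wx s.1 s.2 | Some false => Wt s.1 s.2 end.
have mV s i : measurable_fun setT (V s i) by case: i => [[]|].
pose Phi (w : path_space R (option bool)) := h (w (Some true), w (Some false), w None).
have mPhi : measurable_fun setT Phi.
  apply: (measurableT_comp mh); apply: measurable_fun_pair; last exact: measurable_eval.
  by apply: measurable_fun_pair; exact: measurable_eval.
have linE ls : exists a b c, forall s, lin (V s) ls = jet a b c s.
  elim: ls => [|[r i] ls [a [b [c IH]]]].
    exists 0, 0, 0 => s'; apply/funext => o.
    by rewrite /lin big_nil /jet !mul0r !addr0.
  have e s' o : lin (V s') ((r, i) :: ls) o = r * V s' i o + lin (V s') ls o.
    by rewrite /lin big_cons.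
  case: i e => [[]|] e; [exists a, (r + b), c|exists a, b, (r + c)|exists (r + a), b, c];
    move=> s'; apply/funext => o; rewrite e IH /jet /=; ring.
apply: (law_eq (mV p) (mV q) _ mPhi) => [ls r|w]; last exact: h0.
by have [a [b [c e]]] := linE ls; rewrite !e; exact: jet_char_shift.
Qed.

Lemma covar_continuous (X : R -> T -> R) xi : in_gspace W xi ->
  (forall t, in_gspace W (X t)) -> {ae P, forall o, continuous (X^~ o)} ->
  continuous (fun t => covar P (X t) xi).
Proof.
move=> gxi gX cX t; apply: cvg_at_of_seq => u ut.
apply: (covar_cvg W_gauss W_mean W_cov) => //.
apply: filterS cX => o co; exact: (cvg_comp _ _ ut (co t)).
Qed.

(** A difference quotient of covariances is the covariance of the difference quotient, which stays
    in the Gaussian space; [covar_cvg] then gives the limit. Regression coefficients inherit their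
    smoothness in this way. *)
Lemma covar_is_derive (X X' : R -> T -> R) xi : in_gspace W xi ->
  (forall t, in_gspace W (X t)) -> (forall t, in_gspace W (X' t)) ->
  {ae P, forall o, forall t : R, is_derive t (1:R) (X^~ o) (X' t o)} ->
  forall t : R, is_derive t (1:R) (fun t => covar P (X t) xi) (covar P (X' t) xi).
Proof.
move=> gxi gX gX' dX t; apply/is_derive_cvg/cvgr_dnbhsP => u u0.
have gq h : in_gspace W (fun o => h^-1 * (X (h + t) o - X t o)).
  by apply: gspaceZ; exact: gspaceB.
have -> : (fun n => (u n)^-1 * (covar P (X (u n + t)) xi - covar P (X t) xi)) =
    (fun n => covar P (fun o => (u n)^-1 * (X (u n + t) o - X t o)) xi).
  apply/funext => n.
  rewrite (covarZl W_gauss W_mean W_cov)//; last exact: gspaceB.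
  congr (_ * _).
  rewrite -[RHS](addrK (covar P (X t) xi)) -(covarDl W_gauss W_mean W_cov)//; last exact: gspaceB.
  congr (covar P _ xi - _); apply/funext => o; ring.
apply: (covar_cvg W_gauss W_mean W_cov) => //.
apply: filterS dX => o /(_ t) /is_derive_cvg /cvgr_dnbhsP; exact.
Qed.

End jets.

(** * Slices of the joint density *)

Section continuous_real.
Context {R : realType}.
Implicit Types f g : R -> R.

Lemma continuous_maxr f g : continuous f -> continuous g ->
  continuous (fun x => Num.max (f x) (g x)).
Proof. by move=> cf cg x; exact: (continuous_max (cf x) (cg x)). Qed.

Lemma continuous_minr f g : continuous f -> continuous g ->
  continuous (fun x => Num.min (f x) (g x)).
Proof. by move=> cf cg x; exact: (continuous_min (cf x) (cg x)). Qed.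

Lemma continuous_compr f g : continuous f -> continuous g -> continuous (fun x => g (f x)).
Proof. by move=> cf cg x; exact: (cvg_comp _ _ (cf x) (cg (f x))). Qed.

Lemma continuous_slice (f : R * R * R -> R) a b : continuous f ->
  continuous (fun r => f (a, b, r)).
Proof.
move=> cf r; have cab : (fun _ : R => (a, b)) @ r --> (a, b) by exact: cvg_cst.
have h := @cvg_pair _ _ _ _ _ _ (nbhs_filter r) (nbhs_filter (a, b))
  (nbhs_filter r) _ _ cab (@cvg_id _ _).
exact: (cvg_comp _ _ h (cf (a, b, r))).
Qed.

Lemma continuous_cvg_seq f (u : nat -> R) x : continuous f ->
  u n @[n --> \oo] --> x -> f (u n) @[n --> \oo] --> f x.
Proof. by move=> cf ux; exact: (cvg_comp _ _ ux (cf x)). Qed.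

Lemma continuous_measurableR f : continuous f -> measurable_fun [set: measurableTypeR R] f.
Proof. by move=> cf; exact: measurable_realfun.continuous_measurable_fun. Qed.

Lemma continuous_cstr (c : R) : continuous (fun _ : R => c).
Proof. by move=> x; exact: cvg_cst. Qed.

Lemma continuous_idr : continuous (fun x : R => x).
Proof. by move=> x; exact: cvg_id. Qed.

End continuous_real.

Section triple_fubini.
Context {R : realType}.
Local Notation leb := (@lebesgue_measure R).
Local Notation mR := (measurableTypeR R).

(* The library has no [sigma_finite] instance for a product of measures that
   are not subprobabilities. *)
Let leb2_sigma_finite_ex :
  exists Q : {sigma_finite_measure set (mR * mR)%type -> \bar R},
    (leb \x leb)%E = Q :> (set (mR * mR)%type -> \bar R).
Proof.
pose m := (leb \x leb)%E : {measure set (mR * mR)%type -> \bar R}.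
have sg : sigma_finite setT m.
  have /sigma_finiteP[F [TF ndF Foo]] := sigma_finiteT leb.
  exists (fun n => F n `*` F n).
    rewrite -setXTT TF; apply/seteqP; split => [[x y] [[i _ /= Fi] [j _ /= Fj]]|[x y] [i _ [? ?]]].
      exists (maxn i j) => //; split => /=.
        by apply: (subsetPset _ _ (ndF _ _ (leq_maxl i j))).
      by apply: (subsetPset _ _ (ndF _ _ (leq_maxr i j))).
    by split; exists i.
  move=> k; have [? ?] := Foo k; split; first exact: measurableX.
  by rewrite /m /= product_measure1E// lte_mul_pinfty// ge0_fin_numE.
pose H2 := isSFinite.Build _ _ _ _ (sfinite_measure_sigma_finite sg).
pose H3 := isSigmaFinite.Build _ _ _ _ sg.
by exists (HB.pack_for (SigmaFiniteMeasure.type (mR * mR)%type R) (Measure.sort m) H2 H3).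
Qed.

Lemma fubini_tonelli_slice (h : mR * mR * mR -> \bar R) : measurable_fun setT h ->
  (forall x, (0 <= h x)%E) ->
  (\int[(leb \x leb) \x leb]_q h q = \int[leb]_r \int[leb \x leb]_p h (p, r))%E.
Proof.
move=> mh h0; have [Q hQ] := leb2_sigma_finite_ex.
rewrite hQ; exact: (@fubini_tonelli2 _ _ _ _ R Q leb h mh h0).
Qed.

End triple_fubini.

Section slice.
Context d (T : measurableType d) (R : realType) (P : probability T R).
Local Notation leb := (@lebesgue_measure R).
Variables (Y A B : T -> R) (rho al be v s : R).
Hypotheses (mY : measurable_fun setT Y) (mA : measurable_fun setT A)
  (mB : measurable_fun setT B).
Hypothesis rho_gt0 : 0 < rho.
Hypothesis s_neq0 : s != 0.
Variable f : R * R * R -> R.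
Hypothesis mf : measurable_fun [set: R * R * R] f.
Hypothesis f_ge0 : forall q, 0 <= f q.
Hypothesis cf : continuous f.
Hypothesis law : forall h : R * R * R -> \bar R, measurable_fun setT h ->
  (forall x, (0 <= h x)%E) ->
  (\int[P]_o \int[normal_prob 0 s]_u h (B o + be * u, A o + al * u, Y o + rho * u)%R =
   \int[(leb \x leb) \x leb]_q (h (q.1.1, v * q.1.1 + q.1.2, q.2)%R * (f q)%:E))%E.
Variables psi phi : R -> R.
Hypotheses (cpsi : continuous psi) (cphi : continuous phi).
Hypotheses (psi_ge0 : forall x, 0 <= psi x) (phi_ge0 : forall x, 0 <= phi x).
Variable C : R.
Hypothesis (psi_supp : forall x, C < `|x| -> psi x = 0).
Hypothesis (phi_supp : forall x, C < `|x| -> phi x = 0).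
Hypotheses (psi_le : forall x, psi x <= C) (phi_le : forall x, phi x <= C).

(** With [u] the solution of [Y + rho u = r] and [1 / rho] the Jacobian, [j r o] is the density in
    the level [r] of the weighted law of [Y o + rho u], for a fixed outcome. *)
Let j (r : R) (o : T) : R := let u := (r - Y o) / rho in
  phi (B o + be * u) * psi (A o + al * u) * normal_pdf 0 s u / rho.
Local Notation mR := (measurableTypeR R).
Let leb2 := (leb \x leb)%E.
(** Truncating the level keeps the arguments of [f] in a compact set, on which [f] is bounded; the
    levels compared later lie in [[0, 1]], where nothing changes. *)
Let clamp (r : R) : R := Num.max (-1) (Num.min r 1).
Let k (r : R) (p : R * R) : R :=
  phi p.1 * psi (v * p.1 + p.2) * f (p.1, p.2, clamp r).

Let C0 : 0 <= C := le_trans (phi_ge0 0) (phi_le 0).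

Let j_ge0 r o : 0 <= j r o.
Proof.
by rewrite /j !mulr_ge0// ?normal_pdf_ge0// invr_ge0 ltW.
Qed.

Let j_le r o : j r o <= C * C * normal_peak s / rho.
Proof.
rewrite /j ler_pM2r ?invr_gt0//; apply: ler_pM; rewrite ?mulr_ge0 ?normal_pdf_ge0//.
  exact: ler_pM.
exact: normal_pdf_ub.
Qed.

Let mj2 : measurable_fun [set: measurableTypeR R * T] (fun p => j p.1 p.2).
Proof.
have mu : measurable_fun [set: measurableTypeR R * T] (fun p => (p.1 - Y p.2) / rho).
  apply: measurable_funM => //; apply: measurable_funB => //.
  exact: (measurableT_comp mY measurable_snd).
apply: measurable_funM => //; apply: measurable_funM; last first.
  exact: (measurableT_comp (measurable_normal_pdf _ _) mu).
apply: measurable_funM.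
  apply: (measurableT_comp (continuous_measurableR cphi)); apply: measurable_funD.
    exact: (measurableT_comp mB measurable_snd).
  exact: measurable_funM.
apply: (measurableT_comp (continuous_measurableR cpsi)); apply: measurable_funD.
  exact: (measurableT_comp mA measurable_snd).
exact: measurable_funM.
Qed.

Let mj r : measurable_fun setT (j r).
Proof. exact: (measurableT_comp mj2 (measurable_pair1 r)). Qed.

Let cj o : continuous (j^~ o).
Proof.
have cu : continuous (fun r : R => (r - Y o) / rho).
  by move=> r; apply: cvgMl; apply: cvgB => //; exact: cvg_cst.
have aff (a b : R) : continuous (fun r : R => a + b * ((r - Y o) / rho)).
  by move=> r; apply: cvgD; [exact: cvg_cst|apply: cvgMr; exact: cu].
have cB : continuous (fun r : R => phi (B o + be * ((r - Y o) / rho))).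
  exact: continuous_compr (aff (B o) be) cphi.
have cA : continuous (fun r : R => psi (A o + al * ((r - Y o) / rho))).
  exact: continuous_compr (aff (A o) al) cpsi.
have cN : continuous (fun r : R => normal_pdf 0 s ((r - Y o) / rho)).
  exact: continuous_compr cu (@continuous_normal_pdf _ 0 s s_neq0).
by move=> r; apply: cvgMl; exact: (cvgM (cvgM (cB r) (cA r)) (cN r)).
Qed.

Let jI r : (\int[P]_o (j r o)%:E = (\int[P]_o j r o)%:E)%E.
Proof.
rewrite /Rintegral fineK//; apply: integrable_fin_num => //.
apply: (@bounded_integrable _ _ _ _ _ (C * C * normal_peak s / rho)) => // o.
by rewrite ger0_norm.
Qed.

Let cJ : continuous (fun r => \int[P]_o j r o).
Proof.
move=> r; apply: cvg_at_of_seq => u ur.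
apply: (@bounded_cvg_Rintegral _ _ _ _ _ _ (C * C * normal_peak s / rho)) => //.
  by move=> n o; rewrite ger0_norm.
apply: aeW => o; have h := continuous_cvg_seq (cj (o := o)) ur.
exact: h.
Qed.

Let clamp_id r : 0 <= r <= 1 -> clamp r = r.
Proof.
move=> /andP[r0 r1]; rewrite /clamp (min_idPl r1); apply/max_idPr; lra.
Qed.

Let clamp_itv r : -1 <= clamp r <= 1.
Proof. by rewrite /clamp le_max lexx /= ge_max; apply/andP; split; [lra|rewrite ge_min lexx orbT]. Qed.

Let cclamp : continuous clamp.
Proof.
apply: continuous_maxr; first exact: continuous_cstr.
by apply: continuous_minr; [exact: continuous_idr|exact: continuous_cstr].
Qed.

(** From [|w_x| <= C] and [|v w_x + w_t| <= C] follows [|w_t| <= D], so the integrand of the slice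
    lives on [box]. *)
Let D := C + `|v| * C.
Let box : set (measurableTypeR R * measurableTypeR R) := `[- D, D] `*` `[- D, D].

Let f_bounded : exists M, forall p r, box p -> -1 <= r <= 1 -> f (p.1, p.2, r) <= M.
Proof.
have cK : compact ((`[- D, D] `*` `[- D, D]) `*` `[-1, 1] : set (R * R * R)).
  by apply: compact_setX; [apply: compact_setX|]; exact: segment_compact.
have cfK : compact (f @` ((`[- D, D] `*` `[- D, D]) `*` `[-1, 1])).
  apply: continuous_compact => //; exact: continuous_subspaceT.
have [M [_ hM]] := compact_bounded cfK; exists (M + 1) => p r [p1 p2] r1.
apply: le_trans (ler_norm _) _; apply: (hM (M + 1)); first by rewrite ltrDl.
by exists (p.1, p.2, r) => //=; rewrite in_itv.
Qed.

Let mk r : measurable_fun [set: measurableTypeR R * measurableTypeR R] (k r).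
Proof.
apply: measurable_funM; last first.
  apply: (measurableT_comp mf); apply: measurable_fun_pair => //.
  by apply: measurable_fun_pair.
apply: measurable_funM.
  exact: (measurableT_comp (continuous_measurableR cphi) measurable_fst).
apply: (measurableT_comp (continuous_measurableR cpsi)); apply: measurable_funD => //.
exact: measurable_funM.
Qed.

Let k_ge0 r p : 0 <= k r p.
Proof. by rewrite /k !mulr_ge0. Qed.

Let k_out r p : ~ box p -> k r p = 0.
Proof.
move=> np; rewrite /k; have [h1|h1] := ltP C `|p.1|; first by rewrite phi_supp ?mul0r.
have [h2|h2] := ltP C `|v * p.1 + p.2|; first by rewrite psi_supp ?mulr0 ?mul0r.
exfalso; apply: np; rewrite /box /D; split => /=; rewrite in_itv/= -ler_norml.
  by apply: le_trans h1 _; rewrite lerDl mulr_ge0.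
rewrite (_ : p.2 = (v * p.1 + p.2) - v * p.1); last by ring.
apply: le_trans (ler_normB _ _) _; apply: lerD => //.
by rewrite normrM ler_wpM2l.
Qed.

Let k_int r : [/\ leb2.-integrable setT (EFin \o k r),
  (\int[leb2]_p (k r p)%:E = (\int[leb2]_p k r p)%:E)%E &
  forall u : nat -> R, u n @[n --> \oo] --> r ->
    \int[leb2]_p k (u n) p @[n --> \oo] --> \int[leb2]_p k r p].
Proof.
have [M hM] := f_bounded.
pose g (p : mR * mR) : R := C * C * `|M| * \1_box p.
have mbox : measurable box by apply: measurableX; exact: measurable_itv.
have ig : leb2.-integrable setT (EFin \o g).
  have -> : EFin \o g = (fun p => ((C * C * `|M|)%:E * (\1_box p)%:E)%E).
    by apply/funext => p; rewrite /= EFinM.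
  apply: integrableZl => //; apply/integrableP; split.
    by apply/measurable_EFinP; exact: measurable_indic.
  rewrite (eq_integral (fun p => (\1_box p)%:E)); last first.
    by move=> p _; rewrite gee0_abs// lee_fin.
  rewrite integral_indic// setIT /= product_measure1E; try exact: measurable_itv.
  rewrite /= !lebesgue_measure_itv/=.
  by case: ifP; rewrite ?mul0e// -EFinD -EFinM ltry.
have kg r' p : `|k r' p| <= g p.
  rewrite ger0_norm ?k_ge0// /g indicE; have [|pb] := boolP (p \in box).
    rewrite inE mulr1 => pb; rewrite /k ler_pM ?mulr_ge0//; first exact: ler_pM.
    exact: le_trans (hM _ _ pb (clamp_itv _)) (ler_norm _).
  by rewrite mulr0 k_out//; move: pb; rewrite notin_setE.
have ik r' : leb2.-integrable setT (EFin \o k r').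
  apply: le_integrable ig => //; first by apply/measurable_EFinP; exact: mk.
  by move=> p _ /=; rewrite lee_fin; apply: le_trans (kg r' p) _; exact: ler_norm.
have kI r' : (\int[leb2]_p (k r' p)%:E = (\int[leb2]_p k r' p)%:E)%E.
  by rewrite /Rintegral fineK//; exact: (integrable_fin_num measurableT (ik r')).
split => // u ur.
apply: fine_cvg; rewrite -/(Rintegral leb2 setT (k r)) -kI.
have h1 : {ae leb2, forall p, setT p -> (EFin \o k (u n)) p @[n --> \oo] --> (EFin \o k r) p}.
  apply: aeW => p _; apply: cvg_EFin; first exact: nearW.
  have cu := continuous_cvg_seq cclamp ur.
  apply: cvgMr.
  have h := continuous_cvg_seq (@continuous_slice R f p.1 p.2 cf) cu.
  exact: h.
have h2 : {ae leb2, forall p n, setT p -> (`|(EFin \o k (u n)) p| <= (EFin \o g) p)%E}.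
  by apply: aeW => p n _; rewrite /= lee_fin.
have [_ _] := @dominated_convergence _ _ _ leb2 setT measurableT (fun n => EFin \o k (u n))
  (EFin \o k r) (EFin \o g) (fun n => measurable_int _ (ik (u n))) (measurable_int _ (ik r)) h1 ig h2.
exact.
Qed.

Let level_integral e o : 0 < e ->
  (\int[normal_prob 0 s]_u (phi (B o + be * u) * psi (A o + al * u) *
      \1_(`[0, e]%classic : set R) (Y o + rho * u))%:E =
   \int[leb]_(r in `[0%R, e]) (j r o)%:E)%E.
Proof.
move=> e0.
have dF (x : R) : is_derive x (1:R) (fun u => Y o + rho * u) rho.
  by apply: is_derive_eq; rewrite !regular_scaleE; ring.
have eF (u : R) : (Y o + rho * u - Y o) / rho = u.
  by rewrite [Y o + _]addrC addrK mulrC mulKf// gt_eqF.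
pose a := - Y o / rho; pose b := (e - Y o) / rho.
have Fa : Y o + rho * a = 0 by rewrite /a mulrCA divff ?gt_eqF// mulr1 subrr.
have Fb : Y o + rho * b = e by rewrite /b mulrCA divff ?gt_eqF// mulr1 addrC subrK.
have ab : a <= b by rewrite /a /b ler_pM2r ?invr_gt0// lerDr ltW.
have := @substitution_increasing _ (fun u => Y o + rho * u) (fun=> rho) dF
  (continuous_cstr (c := rho)) (j^~ o) a b ab (fun _ _ => rho_gt0)
  (continuous_subspaceT (cj (o := o))).
rewrite Fa Fb => ->.
rewrite (@ge0_integral_density _ _ _ leb _ (normal_pdf 0 s))//.
- rewrite [RHS]integral_mkcond; apply: eq_integral => u _.
  rewrite patchE indicE -EFinM; case: ifPn => uab.
    rewrite mem_set ?mulr1 /j ?eF ?divfK ?gt_eqF//.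
    move: uab; rewrite inE/= !in_itv/= => /andP[au ub].
    by rewrite -{1}Fa -{1}Fb !lerD2l !ler_pM2l// au.
  rewrite memNset ?mulr0 ?mul0r//= => h; move: uab; rewrite notin_setE; apply.
  by move: h; rewrite /= !in_itv/= -{1}Fa -{1}Fb !lerD2l !ler_pM2l.
- by move=> u; exact: normal_pdf_ge0.
- exact: measurable_normal_pdf.
- apply/measurable_EFinP; apply: measurable_funM.
    apply: measurable_funM; apply: continuous_measurableR.
      by apply: (continuous_compr _ cphi) => u; apply: cvgD; [exact: cvg_cst|exact: cvgMr].
    by apply: (continuous_compr _ cpsi) => u; apply: cvgD; [exact: cvg_cst|exact: cvgMr].
  have m1 : measurable_fun [set: mR] (\1_(`[0, e]%classic : set mR) : mR -> R).
    by apply: measurable_indic; exact: measurable_itv.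
  apply: (measurableT_comp m1); apply: continuous_measurableR => u.
  by apply: cvgD; [exact: cvg_cst|exact: cvgMr].
- by move=> u; rewrite lee_fin !mulr_ge0.
Qed.

(** Both sides are values at 0 of functions continuous in the level: the left one because [j] is
    continuous and bounded, the right one because [f] is bounded on a compact set. By [law] their
    integrals over every [[0, e]] agree. *)
Lemma slice_formula :
  (\int[P]_o (let u := (0 - Y o) / rho in
     phi (B o + be * u) * psi (A o + al * u) * normal_pdf 0 s u / rho)%:E =
   \int[leb \x leb]_q (phi q.1 * psi (v * q.1 + q.2) * f (q.1, q.2, 0))%:E)%E.
Proof.
have -> : (\int[leb \x leb]_q (phi q.1 * psi (v * q.1 + q.2) * f (q.1, q.2, 0))%:E =
    \int[leb2]_q (k 0 q)%:E)%E.
  by apply: eq_integral => q _; rewrite /k clamp_id// lexx ler01.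
have [_ kI _] := k_int 0; rewrite kI.
transitivity (\int[P]_o (j 0 o)%:E)%E; first by [].
rewrite jI; congr EFin.
apply: (eq_at0_of_integrals (h1 := fun r => \int[P]_o j r o)
  (h2 := fun r => \int[leb2]_q k r q)).
- exact: cJ.
- by move=> r; apply: cvg_at_of_seq; have [] := k_int r.
- move=> e e0 e1.
  under eq_integral do rewrite -jI.
  under [RHS]eq_integral => r _.
    have [_ <- _] := k_int r; over.
  have mD : measurable (`[0, e]%classic : set mR) by exact: measurable_itv.
  pose h (q : R * R * R) : \bar R := (phi q.1.1 * psi q.1.2 * \1_(`[0, e]%classic : set R) q.2)%:E.
  have mh : measurable_fun setT h.
    apply/measurable_EFinP; apply: measurable_funM.
      apply: measurable_funM.
        apply: (measurableT_comp (continuous_measurableR cphi)).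
        exact: (measurableT_comp measurable_fst measurable_fst).
      apply: (measurableT_comp (continuous_measurableR cpsi)).
      exact: (measurableT_comp measurable_snd measurable_fst).
    have m1 : measurable_fun [set: mR] (\1_(`[0, e]%classic : set mR) : mR -> R).
      exact: measurable_indic.
    exact: (measurableT_comp m1 measurable_snd).
  have h0 q : (0 <= h q)%E by rewrite lee_fin !mulr_ge0.
  have mF : measurable_fun [set: mR * T] (fun p => (j p.1 p.2 * \1_(`[0, e]%classic : set R) p.1)%:E).
    apply/measurable_EFinP; apply: measurable_funM => //.
    have m1 : measurable_fun [set: mR] (\1_(`[0, e]%classic : set mR) : mR -> R).
      exact: measurable_indic.
    exact: (measurableT_comp m1 measurable_fst).
  have patch_indic (g : R -> R) r : ((EFin \o g) \_ (`[0, e]%classic : set R)) r =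
      (g r * \1_(`[0, e]%classic : set R) r)%:E.
    by rewrite patchE indicE; case: ifP; rewrite ?mulr1 ?mulr0.
  transitivity (\int[P]_o \int[leb]_(r in `[0%R, e]) (j r o)%:E)%E.
    transitivity (\int[leb]_r \int[P]_o (j r o * \1_(`[0, e]%classic : set R) r)%:E)%E.
      rewrite integral_mkcond; apply: eq_integral => r _.
      rewrite patchE indicE; case: ifP => _; first by under [RHS]eq_integral do rewrite mulr1.
      by rewrite integral0_eq// => o _; rewrite mulr0.
    rewrite (@fubini_tonelli _ _ _ _ _ leb P _ mF); last first.
      by move=> p; rewrite lee_fin mulr_ge0.
    apply: eq_integral => o _; rewrite [RHS]integral_mkcond; apply: eq_integral => r _.
    by rewrite (patch_indic (j^~ o)).
  transitivity (\int[P]_o \int[normal_prob 0 s]_u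
      h (B o + be * u, A o + al * u, Y o + rho * u)%R)%E.
    by apply: eq_integral => o _; apply: esym; exact: (level_integral o e0).
  rewrite (law mh h0) fubini_tonelli_slice.
  + rewrite [RHS]integral_mkcond; apply: eq_integral => r _.
    rewrite patchE /h /=; case: ifP => rD.
      have r01 : 0 <= r <= 1.
        by move: rD; rewrite inE/= in_itv/= => /andP[r0 re]; rewrite r0 (le_trans re e1).
      by apply: eq_integral => -[q1 q2] _; rewrite -EFinM /k indicE rD mulr1 clamp_id.
    by rewrite integral0_eq// => q _; rewrite indicE rD mulr0 mul0e.
  + apply: emeasurable_funM; last exact/measurable_EFinP.
    apply: (measurableT_comp mh); apply: measurable_fun_pair => //.
    apply: measurable_fun_pair.
      exact: (measurableT_comp measurable_fst measurable_fst).
    apply: measurable_funD.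
      apply: measurable_funM => //.
      exact: (measurableT_comp measurable_fst measurable_fst).
    exact: (measurableT_comp measurable_snd measurable_fst).
  + by move=> q; rewrite mule_ge0// lee_fin.
- by move=> r; apply: Rintegral_ge0 => // o _.
- by move=> r; apply: Rintegral_ge0 => // q _.
Qed.

Lemma slice_lty :
  (\int[leb \x leb]_q (phi q.1 * psi (v * q.1 + q.2) * f (q.1, q.2, 0))%:E < +oo)%E.
Proof.
have -> : (\int[leb \x leb]_q (phi q.1 * psi (v * q.1 + q.2) * f (q.1, q.2, 0))%:E =
    \int[leb2]_q (k 0 q)%:E)%E.
  by apply: eq_integral => q _; rewrite /k clamp_id// lexx ler01.
by have [_ -> _] := k_int 0; exact: ltry.
Qed.

End slice.

(** * Rice's formula *)

Section reciprocal.
Context {R : realType}.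

(* The regression coefficient of Z(t) on Z(s) may vanish far from s; replacing its
   inverse by [recip] keeps the paths defined and C^1 on the whole line, without
   changing them where the coefficient is at least 1/2. *)
Definition recip (r : R) : R := if r < 2^-1 then 4 - 4 * r else r^-1.
Definition recip' (r : R) : R := - ((Num.max r 2^-1) ^+ 2)^-1.

Lemma recip_gt0 r : 0 < recip r.
Proof. by rewrite /recip; case: (ltP r) => h; [lra|rewrite invr_gt0; lra]. Qed.

Lemma recipE r : 2^-1 <= r -> recip r = r^-1.
Proof. by rewrite /recip leNgt => /negbTE ->. Qed.

Lemma recip'E r : 2^-1 <= r -> recip' r = - (r ^+ 2)^-1.
Proof. by rewrite /recip' => /max_idPl ->. Qed.

Lemma continuous_recip' : continuous recip'.
Proof.
have cm : continuous (fun r : R => Num.max r 2^-1).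
  by apply: continuous_maxr; [exact: continuous_idr|exact: continuous_cstr].
move=> r; apply: cvgN; apply: cvgV.
  by rewrite sqrf_eq0 gt_eqF// lt_max; apply/orP; right; lra.
by apply: (cvgM (cm r) (cm r)).
Qed.

(** The line [4 - 4 r] is the tangent to [1 / r] at [1 / 2]. A quadratic bound on the remainder
    across the junction yields differentiability everywhere without distinguishing one-sided limits.
    The constant is crude: in the third case 24 is [8 + 16]. *)
Let recip_quadratic r h : `|recip (r + h) - recip r - recip' r * h| <= 24 * h ^+ 2.
Proof.
have aux (x : R) : 2^-1 <= x -> 0 < x^-1 <= 2.
  move=> hx; have x0 : 0 < x by lra.
  by rewrite invr_gt0 x0 -[leRHS]invrK lef_pV2 ?posrE ?invr_gt0.
have aux2 (u z k : R) : 0 < u -> u <= 2 -> 0 <= z <= 2 * k -> u * z ^+ 2 <= 8 * k ^+ 2.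
  move=> u0 u2 /andP[z0 zk]; apply: (@le_trans _ _ (2 * z ^+ 2)).
    by rewrite ler_wpM2r ?sqr_ge0.
  have : z ^+ 2 <= (2 * k) ^+ 2 by rewrite ler_sqr// nnegrE; lra.
  rewrite exprMn; lra.
rewrite /recip; have [r1|r1] := ltP r 2^-1; have [r2|r2] := ltP (r + h) 2^-1.
- rewrite /recip' (max_idPr (ltW r1)).
  have -> : 4 - 4 * (r + h) - (4 - 4 * r) - - (2^-1 ^+ 2)^-1 * h = 0 by field.
  by rewrite normr0 mulr_ge0 ?sqr_ge0.
- rewrite /recip' (max_idPr (ltW r1)).
  have /andP[u0 u2] := aux _ r2; set u := (r + h)^-1 in u0 u2 *.
  have e : u - (4 - 4 * r) - - (2^-1 ^+ 2)^-1 * h = u * (2 * (r + h) - 1) ^+ 2.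
    by rewrite /u; field; lra.
  rewrite e ger0_norm; last by rewrite mulr_ge0 ?sqr_ge0// ltW.
  have h1 : 0 <= 2 * (r + h) - 1 <= 2 * h by apply/andP; split; lra.
  apply: le_trans (aux2 _ _ _ u0 u2 h1) _; have := sqr_ge0 h; lra.
- rewrite (recip'E r1); have /andP[u0 u2] := aux _ r1; set u := r^-1 in u0 u2 *.
  have ur : u * r = 1 by rewrite /u mulVf//; lra.
  have e : 4 - 4 * (r + h) - u - - (r ^+ 2)^-1 * h =
      - (u * (2 * r - 1) ^+ 2) + h * (1 - 2 * r) * (u ^+ 2 + 2 * u).
    by rewrite /u; field; lra.
  rewrite e.
  have h1 : 0 <= 2 * r - 1 <= 2 * - h by apply/andP; split; lra.
  have p1 := aux2 _ _ _ u0 u2 h1; rewrite sqrrN in p1.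
  have p1' : 0 <= u * (2 * r - 1) ^+ 2 by rewrite mulr_ge0 ?sqr_ge0// ltW.
  have p2 : 0 <= h * (1 - 2 * r) <= 2 * h ^+ 2.
    by case/andP: h1 => ? ?; apply/andP; split; rewrite ?expr2; nra.
  have p3 : 0 <= u ^+ 2 + 2 * u <= 8 by apply/andP; split; rewrite expr2; nra.
  move: p1 p1' p2 p3; set A := u * _; set B := h * _; set D := u ^+ 2 + _.
  move=> p1 p1' /andP[p2 p2'] /andP[p3 p3'].
  have q : B * D <= 2 * h ^+ 2 * 8 by exact: ler_pM.
  have q' : 0 <= B * D by exact: mulr_ge0.
  have h2 := sqr_ge0 h; rewrite ler_norml; apply/andP; split; lra.
- rewrite (recip'E r1); have /andP[u0 u2] := aux _ r1; have /andP[w0 w2] := aux _ r2.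
  have e : (r + h)^-1 - r^-1 - - (r ^+ 2)^-1 * h = h ^+ 2 * (r^-1 ^+ 2 * (r + h)^-1).
    by field; apply/andP; split; lra.
  set u := r^-1 in u0 u2 e *; set w := (r + h)^-1 in w0 w2 e *.
  rewrite e ger0_norm; last exact: mulr_ge0 (sqr_ge0 _) (mulr_ge0 (sqr_ge0 _) (ltW w0)).
  rewrite mulrC ler_wpM2r ?sqr_ge0//.
  have v4 : u ^+ 2 <= 4 by rewrite expr2; nra.
  have : u ^+ 2 * w <= 4 * 2 by apply: ler_pM => //; rewrite ?sqr_ge0// ltW.
  lra.
Qed.

Lemma is_derive_recip (r : R) : is_derive r (1:R) recip (recip' r).
Proof.
apply/is_derive_cvg/cvgr_dnbhsP => u [u0 ul].
apply: (@squeeze_cvgr _ _ _ _ (fun n => recip' r - 24 * `|u n|) (fun n => recip' r + 24 * `|u n|)).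
- apply: nearW => n; rewrite -ler_distl.
  have un0 : 0 < `|u n| by rewrite normr_gt0.
  rewrite -(ler_pM2r un0) -normrM -[24 * _ * _]mulrA -expr2 real_normK ?num_real//.
  rewrite mulrBl mulrAC mulVf// mul1r [_ + r]addrC.
  exact: recip_quadratic.
- rewrite -[X in _ --> X]subr0 -[X in _ - X](mulr0 24) -[X in _ * X](@normr0 _ R).
  by apply: cvgB; [exact: cvg_cst|apply: cvgMr; exact: cvg_norm].
- rewrite -[X in _ --> X]addr0 -[X in _ + X](mulr0 24) -[X in _ * X](@normr0 _ R).
  by apply: cvgD; [exact: cvg_cst|apply: cvgMr; exact: cvg_norm].
Qed.

End reciprocal.

Section upcrossing_measurable.
Context {R : realType} d (T : measurableType d).
Variables (a b : R -> R).
Hypotheses (ca : continuous a) (cb : continuous b).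

Lemma measurable_upcrossing_sum (z zd m : R -> T -> R) j x y :
  (forall t, measurable_fun setT (z t)) -> (forall t, measurable_fun setT (zd t)) ->
  (forall t, measurable_fun setT (m t)) ->
  measurable_fun setT (fun o =>
    upcrossing_sum (fun u w => a u * b w) (z^~ o) (zd^~ o) (m^~ o) j x y).
Proof.
move=> mz mzd mm; elim: j x y => [|j IH] x y /=; last exact: measurable_funD.
apply: measurable_funM; last first.
  by apply: measurable_funM; [exact: (measurableT_comp (continuous_measurableR ca) (mzd x))|
    exact: (measurableT_comp (continuous_measurableR cb) (mm x))].
apply: (measurableT_comp (f := fun c : bool => c%:R : R)) => //.
apply: measurable_and.
  exact: measurable_fun_ltr.
exact: measurable_fun_ler.
Qed.

Lemma upcrossing_sum_ge0 (chi : R -> R -> R) (z zd m : R -> R) j x y :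
  (forall u w, 0 <= chi u w) -> 0 <= upcrossing_sum chi z zd m j x y.
Proof.
by move=> chi0; elim: j x y => [|j IH] x y /=; [rewrite mulr_ge0|rewrite addr_ge0].
Qed.

End upcrossing_measurable.

Section derive_real.
Context {R : realType}.
Implicit Types (f g : R -> R) (t : R).

Lemma is_derive_mulr f g (f' g' : R) t : is_derive t (1:R) f f' -> is_derive t (1:R) g g' ->
  is_derive t (1:R) (fun x => f x * g x) (f' * g t + f t * g').
Proof. by move=> df dg; apply: is_derive_eq; rewrite !regular_scaleE; ring. Qed.

Lemma is_derive_subr f g (f' g' : R) t : is_derive t (1:R) f f' -> is_derive t (1:R) g g' ->
  is_derive t (1:R) (fun x => f x - g x) (f' - g').
Proof. by move=> df dg; exact: is_deriveB. Qed.

Lemma is_derive_compr f g (f' g' : R) t : is_derive t (1:R) f f' ->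
  is_derive (f t) (1:R) g g' -> is_derive t (1:R) (fun x => g (f x)) (g' * f').
Proof. by move=> df dg; exact: is_derive1_comp. Qed.

Lemma continuous_mulr f g : continuous f -> continuous g -> continuous (fun x => f x * g x).
Proof. by move=> cf cg x; exact: (cvgM (cf x) (cg x)). Qed.

Lemma continuous_addr f g : continuous f -> continuous g -> continuous (fun x => f x + g x).
Proof. by move=> cf cg x; exact: (cvgD (cf x) (cg x)). Qed.

Lemma continuous_subr f g : continuous f -> continuous g -> continuous (fun x => f x - g x).
Proof. by move=> cf cg x; exact: (cvgB (cf x) (cg x)). Qed.

Lemma continuous_oppr f : continuous f -> continuous (fun x => - f x).
Proof. by move=> cf x; exact: (cvgN (cf x)). Qed.

Lemma continuous_mul2 f g : continuous f -> continuous g ->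
  continuous (fun p : R * R => f p.1 * g p.2).
Proof.
move=> cf cg p.
have h1 : (fun x : R * R => f x.1) @ p --> f p.1.
  by apply: (cvg_comp fst f _ (cf p.1)); exact: cvg_fst.
have h2 : (fun x : R * R => g x.2) @ p --> g p.2.
  by apply: (cvg_comp snd g _ (cg p.2)); exact: cvg_snd.
exact: (cvgM h1 h2).
Qed.

End derive_real.

Section rice.
Context d (T : measurableType d) (R : realType) (P : probability T R).
Local Notation leb := (@lebesgue_measure R).
Local Notation mR := (measurableTypeR R).
Variables W Wx Wt : R -> R -> {RV P >-> R}.
Variable K : R -> R -> R.
Hypothesis W_gauss : gaussian_field W.
Hypothesis W_mean : forall x t : R, ('E_P[W x t] = 0)%E.
Hypothesis W_cov : forall x t xi tau : R,
  ('E_P[fun o => (W x t o * W (x + xi)%R (t + tau)%R o)%R] = (K xi tau)%:E)%E.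
Hypothesis W_C1 : as_C1_with W Wx Wt.
Variable v : R.
Variable f : R * R * R -> R.
Hypothesis f_density : joint_density3 P (Wx 0 0) (Wt 0 0) (W 0 0) f.
Hypothesis cf : continuous f.

Let Z := enc_sea W v.
Let Zd := enc_sea_t Wx Wt v.
Let M (t : R) : T -> R := Wx (v * t) t.

Let Z_jet t : Z t = jet W Wx Wt 1 0 0 (v * t, t).
Proof. by apply/funext => o; rewrite /Z /enc_sea /jet /=; ring. Qed.

Let Zd_jet t : Zd t = jet W Wx Wt 0 v 1 (v * t, t).
Proof. by apply/funext => o; rewrite /Zd /enc_sea_t /jet /=; ring. Qed.

Let M_jet t : M t = jet W Wx Wt 0 1 0 (v * t, t).
Proof. by apply/funext => o; rewrite /M /jet /=; ring. Qed.

Let gZ t : in_gspace W (Z t).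
Proof. by rewrite Z_jet; exact: jet_gspace. Qed.

Let gZd t : in_gspace W (Zd t).
Proof. by rewrite Zd_jet; exact: jet_gspace. Qed.

Let gM t : in_gspace W (M t).
Proof. by rewrite M_jet; exact: jet_gspace. Qed.

Definition good_path (o : T) : Prop :=
  [/\ forall t : R, is_derive t (1:R) (Z^~ o) (Zd t o), continuous (Zd^~ o) &
      continuous (M^~ o)].

Lemma good_path_ae : {ae P, forall o, good_path o}.
Proof.
apply: filterS W_C1 => o [dx dt cx ct].
have cv : continuous (fun t : R => v * t) by move=> t; apply: cvgMr; exact: cvg_id.
have cM : continuous (M^~ o)     by exact: (@continuous_pair R R (fun x t => Wx x t o) _ _ cx cv (@continuous_idr R)).
split => // [t|t]; first exact: (is_derive_line (wx := fun x t => Wx x t o)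
  (wt := fun x t => Wt x t o)).
apply: cvgD; first by apply: cvgMr; exact: cM.
exact: (@continuous_pair R R (fun x t => Wt x t o) _ _ ct cv (@continuous_idr R)).
Qed.

Let f_law (h : R * R * R -> \bar R) : measurable_fun setT h -> (forall q, (0 <= h q)%E) ->
  (\int[P]_o h (Wx 0 0 o, Wt 0 0 o, W 0 0 o) =
   \int[(leb \x leb) \x leb]_q (h q * (f q)%:E))%E.
Proof.
move=> mh h0; have [mf f0 fE] := f_density.
have mX : measurable_fun setT (fun o => ((Wx 0 0 o, Wt 0 0 o), W 0 0 o) : mR * mR * mR).
  have mr (X : {RV P >-> R}) : measurable_fun setT (X : T -> mR).
    have h1 : measurable_fun setT (X : T -> R) by [].
    exact: h1.
  by apply: measurable_fun_pair; [apply: measurable_fun_pair|]; exact: mr.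
have mh' : measurable_fun [set: mR * mR * mR] h := mh.
rewrite -(ge0_integral_image P mX mh' h0).
by apply: ge0_integral_density => // A mA; exact: fE.
Qed.

(** Stationarity moves the point [(v t, t)] to the origin. The shear from [w_t] to [v w_x + w_t] is
    left inside the test function, so [f] itself is never transformed. *)
Lemma ship_law t (h : R * R * R -> \bar R) : measurable_fun setT h ->
  (forall q, (0 <= h q)%E) ->
  (\int[P]_o h (M t o, Zd t o, Z t o) =
   \int[(leb \x leb) \x leb]_q (h (q.1.1, v * q.1.1 + q.1.2, q.2)%R * (f q)%:E))%E.
Proof.
move=> mh h0.
pose h' (q : R * R * R) := h (q.1.1, v * q.1.1 + q.1.2, q.2).
have mh' : measurable_fun setT h'.
  apply: (measurableT_comp mh); apply: measurable_fun_pair => //.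
  have m11 : measurable_fun setT (fun q : R * R * R => q.1.1).
    exact: (measurableT_comp measurable_fst measurable_fst).
  apply: measurable_fun_pair => //; apply: measurable_funD; first exact: measurable_funM.
  exact: (measurableT_comp measurable_snd measurable_fst).
rewrite -(f_law mh' (fun=> h0 _)).
exact: (jet_law_shift W_gauss W_mean W_cov W_C1 (v * t, t) (0, 0) mh' (fun=> h0 _)).
Qed.

(** The hyperplane [W = 0] is Lebesgue null. This serves twice: for the variance, and for a crossing
    at the initial time. *)
Lemma level_null : P [set o | W 0 0 o = 0] = 0%E.
Proof.
have [mf f0 fE] := f_density.
pose A : set (R * R * R) := setT `*` [set 0].
have mA : measurable A by apply: measurableX.
rewrite (_ : [set o | _] = [set o | A (Wx 0 0 o, Wt 0 0 o, W 0 0 o)]); last first.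
  by apply/seteqP; split => o /= => [|[]].
rewrite (fE _ mA).
have A0 : (((@lebesgue_measure R) \x (@lebesgue_measure R)) \x (@lebesgue_measure R))%E A = 0%E.
  rewrite product_measure1E//.
  have l0 : @lebesgue_measure R [set 0] = 0%E by exact: lebesgue_measure_set1.
  by rewrite /= l0 mule0.
apply: null_set_integral => //.
by apply: measurable_funTS; exact/measurable_EFinP.
Qed.

(** A vanishing variance would make [W 0 0] zero almost surely, against [level_null]. *)
Lemma variance_neq0 : K 0 0 != 0.
Proof.
apply/eqP => K0.
have : (\int[P]_o (W 0 0 o ^+ 2)%:E = 0)%E.
  have := W_cov 0 0 0 0; rewrite K0 unlock => e; apply: etrans e.
  by apply: eq_integral => o _ /=; rewrite !addr0.
rewrite (eq_integral (fun o => `|(W 0 0 o ^+ 2)%:E|%E)); last first.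
  by move=> o _; rewrite gee0_abs// lee_fin sqr_ge0.
move/(ae_eq_integral_abs P measurableT).
have m2 : measurable_fun setT (fun o => (W 0 0 o ^+ 2)%:E).
  by apply/measurable_EFinP; exact: measurable_funX.
move=> /(_ m2) ae0.
have : {ae P, forall o, ~ [set o | W 0 0 o = 0] o}.
  exists [set o | W 0 0 o = 0]; split; [|exact: level_null|by move=> o /= /contrapT].
  by rewrite (_ : [set o | _] = W 0 0 @^-1` [set 0]).
move=> nz; have : {ae P, forall o, False}.
  apply: filterS2 ae0 nz => o /(_ Logic.I) /= e; apply.
  by move: e => [] /eqP; rewrite sqrf_eq0 => /eqP.
move=> [N [mN N0 hN]].
have : (P setT <= P N)%E by apply: le_measure; rewrite ?inE// => o _; apply: hN => /=.
by rewrite N0 probability_setT leNgt lte01.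
Qed.

Variables (e C : R) (a b : R -> R).
Hypothesis e_gt0 : 0 < e.
Hypotheses (ca : continuous a) (cb : continuous b).
Hypotheses (a_ge0 : forall u, 0 <= a u) (b_ge0 : forall u, 0 <= b u).
Hypothesis a_small : forall u, u < e -> a u = 0.
Hypothesis a_supp : forall u, C < `|u| -> a u = 0.
Hypothesis b_supp : forall u, C < `|u| -> b u = 0.
Hypothesis a_le : forall u, u * a u <= C.
Hypothesis b_le : forall u, b u <= C.

(** The extra factor [u] is the crossing slope, produced by the Jacobian in the area formula. *)
Let psi (u : R) : R := u * a u.

Let psi_ge0 u : 0 <= psi u.
Proof.
have [u0|u0] := leP 0 u; first exact: mulr_ge0.
by rewrite /psi a_small ?mulr0// (lt_trans u0).
Qed.

Let cpsi : continuous psi.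
Proof. exact: continuous_mulr (@continuous_idr R) ca. Qed.

Let psi_supp u : C < `|u| -> psi u = 0.
Proof. by move=> /a_supp; rewrite /psi => ->; rewrite mulr0. Qed.

Definition crossing_mass (o : T) (x y : R) : \bar R :=
  crossing_sum (Z^~ o) (fun t => a (Zd t o) * b (M t o)) x y.

Definition slice_mass : \bar R :=
  (\int[leb \x leb]_q (b q.1 * (let u := v * q.1 + q.2 in u * a u) * f (q.1, q.2, 0))%:E)%E.

Let sg : R := Num.sqrt (K 0 0).

Let covar_W p : covar P (field_val W p) (field_val W p) = K 0 0.
Proof.
have := W_cov p.1 p.2 0 0; rewrite unlock => e0.
rewrite /covar /Rintegral -[RHS]/(fine (K 0 0)%:E) -e0; congr fine.
by apply: eq_integral => o _; rewrite !addr0.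
Qed.

Let sg2 s : sg ^+ 2 = covar P (Z s) (Z s).
Proof.
rewrite (covar_W (v * s, s)) sqr_sqrtr// -(covar_W (0, 0)); exact: covar_ge0.
Qed.

Let sg_neq0 : sg != 0.
Proof. by rewrite -sqrf_eq0 (sg2 0) (covar_W (v * 0, 0)) variance_neq0. Qed.

Section base_point.
Variable s : R.

Let xi : T -> R := Z s.
Let gxi : in_gspace W xi := gZ s.

(** All three paths form one family, so that the regression applies to functionals of entire
    paths. *)
Let V (i : R * option bool) : T -> R :=
  match i.2 with None => Z i.1 | Some true => Zd i.1 | Some false => M i.1 end.

Let gV i : in_gspace W (V i).
Proof. by case: i => t [[]|]; [exact: gZd|exact: gM|exact: gZ]. Qed.

Let coef i := covar P (V i) xi / sg ^+ 2.
Let rho t := coef (t, None).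
Let al t := coef (t, Some true).
Let be t := coef (t, Some false).

(** Rescaled so that each regression coefficient is a single covariance, as the continuity and
    derivative results require. *)
Let xi' (o : T) : R := (sg ^+ 2)^-1 * xi o.

Let gxi' : in_gspace W xi'.
Proof. exact: (gspaceZ _ gxi). Qed.

Let coefE i : coef i = covar P (V i) xi'.
Proof. by rewrite covarC (covarZl W_gauss W_mean W_cov)// covarC mulrC. Qed.

Let rho_s : rho s = 1.
Proof. by rewrite /rho /coef -sg2 divff// sqrf_eq0. Qed.

Let d_rho (t : R) : is_derive t (1:R) rho (al t).
Proof.
rewrite /al coefE (_ : rho = fun t => covar P (Z t) xi'); last by apply/funext => t'; exact: coefE.
apply: (covar_is_derive W_gauss W_mean W_cov (X := Z) (X' := Zd)) => //.
by apply: filterS good_path_ae => o [].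
Qed.

Let c_al : continuous al.
Proof.
rewrite (_ : al = fun t => covar P (Zd t) xi'); last by apply/funext => t'; exact: coefE.
apply: (covar_continuous W_gauss W_mean W_cov) => //.
by apply: filterS good_path_ae => o [].
Qed.

Let c_be : continuous be.
Proof.
rewrite (_ : be = fun t => covar P (M t) xi'); last by apply/funext => t'; exact: coefE.
apply: (covar_continuous W_gauss W_mean W_cov) => //.
by apply: filterS good_path_ae => o [].
Qed.

Let c_rho : continuous rho := is_derive_continuous d_rho.

(** [Y], [A] and [B] are the parts of [Z], its derivative and [W_x] that are uncorrelated with [xi].
    Where [rho >= 1/2], [G] is the value of [u] for which [Y + rho u] has a zero at time [t]; [q]
    and [m] are the slope and [W_x] at that zero, and [h] is the integrand that the area formula
    leaves. *)
Let Y t o := Z t o - rho t * xi o.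
Let A t o := Zd t o - al t * xi o.
Let B t o := M t o - be t * xi o.
Let g t := recip (rho t).
Let G t o := - Y t o * g t.
Let q t o := A t o + al t * G t o.
Let m t o := B t o + be t * G t o.
Let Gd t o := - A t o * g t + - Y t o * (recip' (rho t) * al t).
Let h t o := b (m t o) * psi (q t o) * normal_pdf 0 sg (G t o) * g t.

Let mY t : measurable_fun setT (Y t).
Proof.
by apply: measurable_funB; [exact: gspace_measurable (gZ t)|
  apply: measurable_funM => //; exact: gspace_measurable (gZ s)].
Qed.

Let mA t : measurable_fun setT (A t).
Proof.
by apply: measurable_funB; [exact: gspace_measurable (gZd t)|
  apply: measurable_funM => //; exact: gspace_measurable (gZ s)].
Qed.

Let mB t : measurable_fun setT (B t).
Proof.
by apply: measurable_funB; [exact: gspace_measurable (gM t)|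
  apply: measurable_funM => //; exact: gspace_measurable (gZ s)].
Qed.

Let d_g (t : R) : is_derive t (1:R) g (recip' (rho t) * al t).
Proof. exact: is_derive_compr (d_rho t) (is_derive_recip _). Qed.

Let c_g : continuous g := is_derive_continuous d_g.

Let d_Y o : good_path o -> forall t : R, is_derive t (1:R) (Y^~ o) (A t o).
Proof.
move=> [dz _ _] t; apply: is_derive_subr => //.
have := is_derive_mulr (d_rho t) (is_derive_cst (xi o) t (1:R)).
by rewrite mulr0 addr0.
Qed.

Let d_G o : good_path o -> forall t : R, is_derive t (1:R) (G^~ o) (Gd t o).
Proof.
move=> go t; apply: is_derive_mulr; last exact: d_g.
by apply: is_deriveN; exact: d_Y.
Qed.

Let c_xi (k : R -> R) o : continuous k -> continuous (fun t => k t * xi o).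
Proof. by move=> ck; exact: continuous_mulr ck (@continuous_cstr R _). Qed.

Let c_A o : good_path o -> continuous (A^~ o).
Proof. by move=> [_ cz _]; exact: continuous_subr cz (c_xi c_al). Qed.

Let c_B o : good_path o -> continuous (B^~ o).
Proof. by move=> [_ _ cm]; exact: continuous_subr cm (c_xi c_be). Qed.

Let c_G o : good_path o -> continuous (G^~ o).
Proof. by move=> go; exact: is_derive_continuous (d_G go). Qed.

Let c_Gd o : good_path o -> continuous (Gd^~ o).
Proof.
move=> go; apply: continuous_addr; apply: continuous_mulr.
- exact: continuous_oppr (c_A go).
- exact: c_g.
- exact: continuous_oppr (is_derive_continuous (d_Y go)).
- exact: continuous_mulr (continuous_compr c_rho (@continuous_recip' R)) c_al.
Qed.

Let c_q o : good_path o -> continuous (q^~ o).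
Proof. by move=> go; exact: continuous_addr (c_A go) (continuous_mulr c_al (c_G go)). Qed.

Let c_m o : good_path o -> continuous (m^~ o).
Proof. by move=> go; exact: continuous_addr (c_B go) (continuous_mulr c_be (c_G go)). Qed.

Let c_h o : good_path o -> continuous (h^~ o).
Proof.
move=> go; apply: continuous_mulr; last exact: c_g.
apply: continuous_mulr; last exact: continuous_compr (c_G go) (@continuous_normal_pdf _ 0 sg sg_neq0).
apply: continuous_mulr.
- exact: continuous_compr (c_m go) cb.
- exact: continuous_compr (c_q go) cpsi.
Qed.

Let h_ge0 t o : 0 <= h t o.
Proof.
exact: mulr_ge0 (mulr_ge0 (mulr_ge0 (b_ge0 _) (psi_ge0 _)) (normal_pdf_ge0 _ _ _))
  (ltW (recip_gt0 _)).
Qed.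

Let mG t : measurable_fun setT (G t).
Proof. by apply: measurable_funM => //; exact: measurableT_comp. Qed.

Let mh t : measurable_fun setT (h t).
Proof.
apply: measurable_funM => //; apply: measurable_funM; last first.
  exact: (measurableT_comp (measurable_normal_pdf _ _) (mG t)).
apply: measurable_funM.
  apply: (measurableT_comp (continuous_measurableR cb)).
  by apply: measurable_funD => //; exact: measurable_funM.
apply: (measurableT_comp (continuous_measurableR cpsi)).
by apply: measurable_funD => //; exact: measurable_funM.
Qed.

Let regression_law t (k : R * R * R -> \bar R) : measurable_fun setT k ->
  (forall x, (0 <= k x)%E) ->
  (\int[P]_o \int[normal_prob 0 sg]_u
     k (B t o + be t * u, A t o + al t * u, Y t o + rho t * u)%R =
   \int[(leb \x leb) \x leb]_p (k (p.1.1, v * p.1.1 + p.1.2, p.2)%R * (f p)%:E))%E.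
Proof.
move=> mk k0; rewrite -(ship_law t mk k0).
pose Phi (w : path_space R (R * option bool)) :=
  k (w (t, Some false), w (t, Some true), w (t, None)).
have mPhi : measurable_fun setT Phi.
  apply: (measurableT_comp mk); apply: measurable_fun_pair; last exact: measurable_eval.
  by apply: measurable_fun_pair; exact: measurable_eval.
have := gaussian_regression W_gauss W_mean W_cov gV (gZ s) sg_neq0 (sg2 s) mPhi (fun=> k0 _).
rewrite /Phi /= => ->; apply: eq_integral => o _; apply: eq_integral => u _.
by congr (k (_, _, _)); rewrite /A /B /Y -/(coef _) mulrBr addrAC addrA.
Qed.

Let slice_at t : 2^-1 <= rho t -> (\int[P]_o (h t o)%:E = slice_mass)%E.
Proof.
move=> rt; have r0 : 0 < rho t by apply: lt_le_trans rt; rewrite invr_gt0.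
have [mf f0 _] := f_density.
have sl := slice_formula (mY t) (mA t) (mB t) r0 sg_neq0 mf f0 cf (@regression_law t)
  cpsi cb psi_ge0 b_ge0 psi_supp b_supp a_le b_le.
apply: etrans sl; apply: eq_integral => o _; rewrite /h /m /q /G /g recipE//.
by rewrite sub0r.
Qed.

(** The upper limit is defined and measurable on all of path space, and equals the crossing sum on
    differentiable paths ([PhiE]). *)
Let Phi x y (w : path_space R (R * option bool)) : \bar R :=
  limn_esup (fun j => (upcrossing_sum (fun u z => a u * b z) (fun t => w (t, None))
    (fun t => w (t, Some true)) (fun t => w (t, Some false)) j x y)%:E).

Let mPhi x y : measurable_fun setT (Phi x y).
Proof.
apply: measurable_fun_limn_esup => j; apply/measurable_EFinP.
by apply: measurable_upcrossing_sum => // t; exact: measurable_eval.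
Qed.

Let Phi_ge0 x y w : (0 <= Phi x y w)%E.
Proof.
by apply: limn_esup_ge0 => j; rewrite lee_fin upcrossing_sum_ge0// => u z; exact: mulr_ge0.
Qed.

Let PhiE x y (z zd mm : R -> R) (w : path_space R (R * option bool)) : x <= y ->
  (forall t, w (t, None) = z t) -> (forall t, w (t, Some true) = zd t) ->
  (forall t, w (t, Some false) = mm t) ->
  (forall t : R, is_derive t (1:R) z (zd t)) -> continuous zd -> continuous mm ->
  Phi x y w = crossing_sum z (fun t => a (zd t) * b (mm t)) x y.
Proof.
move=> xy ez ezd em dz czd cm; rewrite /Phi.
have cvg := @upcrossing_sum_cvg R (fun u z => a u * b z) (fun u w => mulr_ge0 (a_ge0 u) (b_ge0 w))
  _ e e_gt0 _ z zd mm x y xy dz czd cm.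
rewrite (_ : (fun t => w (t, None)) = z); last exact/funext.
rewrite (_ : (fun t => w (t, Some true)) = zd); last exact/funext.
rewrite (_ : (fun t => w (t, Some false)) = mm); last exact/funext.
have [|//|_ ->//] := cvg_limn_einf_sup (cvg _ _).
  exact: continuous_mul2.
by move=> u u' ue; rewrite a_small// mul0r.
Qed.

Let regressed (o : T) (u : R) : path_space R (R * option bool) :=
  fun i => V i o + coef i * (u - xi o).

Let mregressed x y : measurable_fun [set: T * mR] (fun p => Phi x y (regressed p.1 p.2)).
Proof.
apply: (measurableT_comp (mPhi x y)).
have mX i : measurable_fun [set: T * mR] (fun p : T * mR => V i p.1 + coef i * (p.2 - xi p.1)).
  have m1 (X : T -> R) : in_gspace W X -> measurable_fun [set: T * mR] (fun p : T * mR => X p.1).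
    by move=> /gspace_measurable mX; exact: (measurableT_comp mX measurable_fst).
  apply: measurable_funD; first exact: m1 (gV i).
  by apply: measurable_funM => //; apply: measurable_funB => //; exact: m1 gxi.
exact: (measurable_to_path mX).
Qed.

(** For a fixed outcome the zeros of the regressed path with parameter [u] are the solutions of
    [G = u], and there its slope and [W_x] are [q] and [m], no longer dependent on [u]. The integral
    over [u] is then the left side of the area formula. *)
Let inner_area o x y : good_path o -> x <= y ->
  (forall t, x <= t <= y -> 2^-1 <= rho t) ->
  (\int[normal_prob 0 sg]_u Phi x y (regressed o u) =
   \int[leb]_(t in `]x, y]) (h t o)%:E)%E.
Proof.
move=> go xy rho_xy.
have aff (p c r u : R) : p + c * (u - r) = p - c * r + c * u by ring.
pose z u t := Y t o + rho t * u.
have zE u t : regressed o u (t, None) = z u t.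
  exact: aff.
pose zd u t := A t o + al t * u.
have zdE u t : regressed o u (t, Some true) = zd u t.
  exact: aff.
pose mm u t := B t o + be t * u.
have mmE u t : regressed o u (t, Some false) = mm u t.
  exact: aff.
pose k t := a (q t o) * b (m t o).
have PE u : Phi x y (regressed o u) = crossing_sum (fun t => G t o - u) k x y.
  have dz (t : R) : is_derive t (1:R) (z u) (zd u t).
    have h1 := is_derive_mulr (d_rho t) (is_derive_cst u t (1:R)).
    have := is_deriveD (d_Y go t) h1.
    by rewrite mulr0 addr0.
  have czd : continuous (zd u).
    exact: continuous_addr (c_A go) (continuous_mulr c_al (@continuous_cstr R _)).
  have cmm : continuous (mm u).
    exact: continuous_addr (c_B go) (continuous_mulr c_be (@continuous_cstr R _)).
  rewrite (PhiE xy (zE u) (zdE u) (mmE u) dz czd cmm).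
  have same t : x <= t <= y -> z u t = 0 <-> G t o - u = 0.
      move=> txy; have rt := rho_xy t txy; have r0 : rho t != 0.
        by rewrite gt_eqF// (lt_le_trans _ rt)// invr_gt0.
      rewrite /z /G /g recipE//; split => [/eqP|/eqP].
        rewrite addr_eq0 => /eqP ->; rewrite opprK mulrAC divff// mul1r subrr//.
      by rewrite subr_eq0 => /eqP <-; rewrite mulrCA divff// mulr1 subrr.
    rewrite /crossing_sum (_ : crossing_set (z u) x y = crossing_set (fun t => G t o - u) x y).
      apply: eq_integral => t; rewrite inE => -[_ /eqP]; rewrite subr_eq0 => /eqP gu.
      by rewrite /k /q /m gu.
    apply/seteqP; split => t [/andP[xt ty] h0]; split; rewrite ?xt//.
      by apply/same => //; rewrite (ltW xt).
    by apply/same => //; rewrite (ltW xt).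

have mreg : measurable_fun [set: mR] (fun u => Phi x y (regressed o u)).
  exact: (measurableT_comp (mregressed x y) (measurable_pair1 o)).
rewrite (@ge0_integral_density _ _ _ leb _ (normal_pdf 0 sg))//; last 2 first.
- by move=> u; exact: normal_pdf_ge0.
- exact: measurable_normal_pdf.
under eq_integral do rewrite PE.
have ck : continuous k.
  by apply: continuous_mulr; [exact: continuous_compr (c_q go) ca|exact: continuous_compr (c_m go) cb].
(* This converts the Jacobian [- Gd] of the area formula into the crossing slope times [1 / rho]. *)
have qE t : x <= t <= y -> q t o = - (rho t * Gd t o).
  move=> txy; have rt := rho_xy t txy; have r0 : rho t != 0.
    by rewrite gt_eqF// (lt_le_trans _ rt)// invr_gt0.
  by rewrite /q /Gd /G /g recipE// recip'E//; field.
rewrite (area_formula (d_G go) (c_Gd go) _ ck _ (@continuous_normal_pdf _ 0 sg sg_neq0) xy).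
- apply: eq_integral => t; rewrite inE/= in_itv/= => /andP[xt ty].
  have txy : x <= t <= y by rewrite (ltW xt).
  have rt := rho_xy t txy; have r0 : rho t != 0.
    by rewrite gt_eqF// (lt_le_trans _ rt)// invr_gt0.
  have Gq : - Gd t o = q t o * g t.
    by rewrite qE// /g recipE// mulNr mulrAC divff// mul1r.
  by rewrite Gq /k /h /psi; congr EFin; ring.
- by move=> t; exact: mulr_ge0.
- by move=> u; exact: normal_pdf_ge0.
(* Where [q < e] the weight vanishes nearby; otherwise [q] is positive and [qE] makes [Gd]
   negative. *)
- move=> t txy; have [qt|qt] := ltP (q t o) e.
    right; have [r r0 hr] := continuous_near_lt (c_q go) qt.
    apply/nbhs_ballP; exists r => // t' tt'.
    by rewrite /k a_small ?mul0r//; exact: hr.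
  left; have : 0 < q t o by exact: lt_le_trans qt.
  have rt : 0 < rho t by rewrite (lt_le_trans _ (rho_xy t txy))// invr_gt0.
  by rewrite qE// oppr_gt0 pmulr_rlt0.
Qed.

(** Regression replaces [Z s] by an independent variable, [inner_area] is applied outcome by
    outcome, and Tonelli moves the expectation inside the time integral. By [slice_at] its value is
    [slice_mass] at every time. *)
Let local_integral x y : x <= y -> (forall t, x <= t <= y -> 2^-1 <= rho t) ->
  ae_integral P (fun o => crossing_mass o x y) ((y - x)%:E * slice_mass)%E.
Proof.
move=> xy rho_xy.
have mV i : measurable_fun setT (V i) by exact: gspace_measurable (gV i).
exists (fun o => Phi x y (V^~ o)); split.
- exact: (measurableT_comp (mPhi x y) (measurable_to_path mV)).
- by move=> o; exact: Phi_ge0.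
- apply: filterS good_path_ae => o [dz czd cm]; apply: esym.
  exact: (PhiE xy (w := V^~ o) (z := Z^~ o) (zd := Zd^~ o) (mm := M^~ o)).
rewrite (gaussian_regression W_gauss W_mean W_cov gV gxi sg_neq0 (sg2 s) (mPhi x y)
  (@Phi_ge0 x y)).
(* Tonelli needs joint measurability in time and outcome, while [h] is known to be continuous in
   time on good paths only. *)
have [g2 [mg2 g2_ge0 g2E]] : exists g2 : mR * T -> \bar R, [/\ measurable_fun setT g2,
    forall p, (0 <= g2 p)%E & {ae P, forall o, forall t, g2 (t, o) = (h t o)%:E}].
  apply: joint_version => //.
  by apply: filterS good_path_ae => o; exact: c_h.
pose D : set mR := `]x, y]%classic.
have mD : measurable D by exact: measurable_itv.
pose g3 (p : mR * T) : \bar R := (g2 p * (\1_D p.1)%:E)%E.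
have g3_ge0 p : (0 <= g3 p)%E by rewrite mule_ge0// lee_fin.
have mg3 : measurable_fun setT g3.
  apply: emeasurable_funM => //; apply/measurable_EFinP.
  have m1 : measurable_fun [set: mR] (\1_D : mR -> R) by exact: measurable_indic.
  exact: (measurableT_comp m1 measurable_fst).
have g3D (k : R -> R) o : (forall t, g2 (t, o) = (k t)%:E) ->
    (\int[leb]_(t in D) (k t)%:E = \int[leb]_t g3 (t, o))%E.
  move=> e2; rewrite integral_mkcond; apply: eq_integral => t _.
  by rewrite patchE /g3 e2 indicE; case: ifP; rewrite ?mule1 ?mule0.
transitivity (\int[P]_o \int[leb]_t g3 (t, o))%E.
  apply: ge0_ae_eq_integral => //.
  - have h0 (p : T * mR) : (0 <= Phi x y (regressed p.1 p.2))%E by exact: Phi_ge0.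
    exact: (measurable_fun_fubini_tonelli_F (m2 := normal_prob 0 sg) _ (mregressed x y) h0).
  - exact: (measurable_fun_fubini_tonelli_G (m1 := leb) _ mg3 g3_ge0).
  - by move=> o _; apply: integral_ge0 => u _; exact: Phi_ge0.
  - by move=> o _; apply: integral_ge0.
  - apply: filterS2 good_path_ae g2E => o go e2 _.
    by rewrite -(g3D (h^~ o))// -(inner_area go xy rho_xy).
rewrite -(@fubini_tonelli _ _ _ _ _ leb P _ mg3 g3_ge0).
have ->: (\int[leb]_t \int[P]_o g3 (t, o) = \int[leb]_(t in D) slice_mass)%E.
  rewrite [RHS]integral_mkcond; apply: eq_integral => t _; rewrite patchE.
  case: ifPn => tD.
    rewrite -(slice_at (t := t)); last first.
      by apply: rho_xy; move: tD; rewrite inE /D/= in_itv/= => /andP[xt ->]; rewrite ltW.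
    apply: ge0_ae_eq_integral => //.
    - exact: (measurableT_comp mg3 (measurable_pair1 t)).
    - by apply/measurable_EFinP; exact: mh.
    - by move=> o _; rewrite lee_fin.
    - by apply: filterS g2E => o e2 _; rewrite /g3 indicE tD mule1 e2.
  by rewrite integral0_eq// => o _; rewrite /g3 indicE (negbTE tD) mule0.
rewrite integral_cst// muleC; congr (_ * _)%E.
rewrite /= lebesgue_measure_itv/= lte_fin; case: ltP => // yx.
by have -> : y = x; [apply/eqP; rewrite eq_le xy yx|rewrite subrr].
Qed.

Lemma local_rice : exists2 r, 0 < r & forall x y, x <= s -> s <= y -> y - x < r ->
  ae_integral P (fun o => crossing_mass o x y) ((y - x)%:E * slice_mass)%E.
Proof.
have rs : 2^-1 < rho s by rewrite rho_s invf_lt1// ltr1n.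
have [r r0 hr] := continuous_near_gt c_rho rs; exists r => // x y xs sy yx.
apply: local_integral => [|t /andP[xt ty]]; first exact: le_trans sy.
by apply/ltW/hr; rewrite ltr_norml; apply/andP; split; lra.
Qed.

End base_point.

(** The base point of the regression varies from one short interval to the next, but [slice_mass]
    does not depend on it, so the pieces add up. *)
Lemma rice_formula x y : x <= y ->
  ae_integral P (fun o => crossing_mass o x y) ((y - x)%:E * slice_mass)%E.
Proof.
move=> xy; apply: (bisection_principle (Q := fun x y =>
  ae_integral P (fun o => crossing_mass o x y) ((y - x)%:E * slice_mass)%E) xy).
  move=> x' y' _ xy' _; set c := (x' + y') / 2 => h1 h2.
  have xc : x' <= c by rewrite /c; lra.
  have cy : c <= y' by rewrite /c; lra.
  have -> : ((y' - x')%:E * slice_mass = (c - x')%:E * slice_mass + (y' - c)%:E * slice_mass)%E.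
    by rewrite -ge0_muleDl ?lee_fin ?subr_ge0// -EFinD; congr (_%:E * _)%E; ring.
  apply: ae_integral_eq (ae_integralD h1 h2).
  apply: filterS good_path_ae => o [dz czd cm]; apply: esym; apply: crossing_sum_cat => //.
  - exact: is_derive_continuous dz.
  - exact: continuous_mulr (continuous_compr czd ca) (continuous_compr cm cb).
  - by move=> t; exact: mulr_ge0.
move=> s _; have [r r0 hr] := local_rice s; exists r => // x' y' _ xs sy _.
exact: hr.
Qed.

End rice.

(** * Indicator test functions *)

Section test_functions.
Context d (T : measurableType d) (R : realType) (P : probability T R).
Local Notation leb := (@lebesgue_measure R).
Local Notation mR := (measurableTypeR R).
Local Notation cnt := (@counting mR R).
Variables W Wx Wt : R -> R -> {RV P >-> R}.
Hypothesis W_C1 : as_C1_with W Wx Wt.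
Variable v : R.
Variable f : R * R * R -> R.
Hypothesis f_density : joint_density3 P (Wx 0 0) (Wt 0 0) (W 0 0) f.

Let cross (o : T) : set mR := crossing_set ((enc_sea W v)^~ o) 0 1.
Let at_time (o : T) (t : R) : R * R := (enc_sea_t Wx Wt v t o, Wx (v * t) t o).

Definition test_mass (p : R * R -> R) (o : T) : \bar R :=
  (\int[cnt]_(t in cross o) (p (at_time o t))%:E)%E.

Let flux (p : R * R -> R) (q : R * R) : R :=
  let u := v * q.1 + q.2 in u * p (u, q.1) * f (q.1, q.2, 0).

Definition test_flux (p : R * R -> R) : \bar R := (\int[leb \x leb]_q (flux p q)%:E)%E.

Definition crossing_identity (p : R * R -> R) : Prop :=
  ae_integral P (test_mass p) (test_flux p).

Let m_cross o : good_path W Wx Wt v o -> measurable (cross o).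
Proof. by move=> [dz _ _]; apply: measurable_crossing_set; exact: is_derive_continuous dz. Qed.

Let m_at (p : R * R -> R) o : measurable_fun setT p -> good_path W Wx Wt v o ->
  measurable_fun (cross o) (fun t => (p (at_time o t))%:E).
Proof.
move=> mp [_ czd cm]; apply: measurable_funTS; apply/measurable_EFinP.
have m2 : measurable_fun [set: mR] (at_time o).
  by apply: measurable_fun_pair; exact: continuous_measurableR.
exact: (measurableT_comp mp m2).
Qed.

Let m_flux p : measurable_fun setT p -> measurable_fun [set: mR * mR] (flux p).
Proof.
move=> mp; have [mf _ _] := f_density.
have mu : measurable_fun [set: mR * mR] (fun q : mR * mR => v * q.1 + q.2).
  by apply: measurable_funD => //; exact: measurable_funM.
have mpu : measurable_fun [set: mR * mR] (fun q : mR * mR => p (v * q.1 + q.2, q.1)).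
  by apply: (measurableT_comp mp); exact: measurable_fun_pair.
have mfq : measurable_fun [set: mR * mR] (fun q : mR * mR => f (q.1, q.2, 0)).
  apply: (measurableT_comp mf); apply: measurable_fun_pair => //.
  exact: measurable_fun_pair.
by apply: measurable_funM => //; exact: measurable_funM.
Qed.

Let flux_ge0 p q : (forall q, 0 <= p q) -> (forall u w, u < 0 -> p (u, w) = 0) ->
  0 <= flux p q.
Proof.
move=> p0 pneg; have [_ f0 _] := f_density; rewrite mulr_ge0//.
have [u0|u0] := ltP (v * q.1 + q.2) 0; first by rewrite pneg ?mulr0.
exact: mulr_ge0.
Qed.

(** The finite flux of [p_ 0] serves as bound twice: directly for the fluxes, and through its
    identity, which makes the sum of [p_ 0] over the crossings finite on almost every path, for the
    sums along a path. *)
Lemma crossing_identity_dominated (p_ : nat -> R * R -> R) (p : R * R -> R) :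
  (forall n, measurable_fun setT (p_ n)) -> measurable_fun setT p ->
  (forall n q, 0 <= p_ n q <= p_ 0%N q) ->
  (forall n u w, u < 0 -> p_ n (u, w) = 0) ->
  (forall q, p_ n q @[n --> \oo] --> p q) -> (test_flux (p_ 0%N) < +oo)%E ->
  (forall n, crossing_identity (p_ n)) -> crossing_identity p.
Proof.
move=> mp_ mp p_dom pneg p_cvg fin h.
have p0 n q : 0 <= p_ n q by have /andP[] := p_dom n q.
have ple n q : p_ n q <= p_ 0%N q by have /andP[] := p_dom n q.
apply: (ae_integral_dominated (F_ := fun n => test_mass (p_ n)) h fin).
- apply: filterS (good_path_ae W_C1 v) => o go n; apply: ge0_le_integral.
  + exact: m_cross.
  + by move=> t _; rewrite lee_fin.
  + exact: m_at.
  + exact: m_at.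
  + by move=> t _; rewrite lee_fin.
- apply: filterS (good_path_ae W_C1 v) => o go fino.
  apply: (dominated_cvg (m_cross go) (g := fun t => (p_ 0%N (at_time o t))%:E)).
  + by move=> n; exact: m_at.
  + by move=> t _; apply: cvg_EFin; [exact: nearW|exact: p_cvg].
  + by [].
  + apply/integrableP; split; first exact: m_at.
    by under eq_integral do rewrite gee0_abs ?lee_fin//.
  + by move=> n t _; rewrite gee0_abs ?lee_fin.
- apply: (@dominated_cvg _ _ _ (leb \x leb)%E setT measurableT
    (fun n q => (flux (p_ n) q)%:E) (fun q => (flux p q)%:E) (fun q => (flux (p_ 0%N) q)%:E)).
  + by move=> n; apply/measurable_EFinP; exact: m_flux.
  + move=> q _; apply: cvg_EFin; first exact: nearW.
    by apply: cvgMl; apply: cvgMr; exact: p_cvg.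
  + by [].
  + apply/integrableP; split; first by apply/measurable_EFinP; exact: m_flux.
    rewrite (eq_integral (fun q : mR * mR => (flux (p_ 0%N) q)%:E)) => [|q _]; first exact: fin.
    by rewrite gee0_abs// lee_fin; apply: flux_ge0 => //; exact: pneg.
  + have [_ f0 _] := f_density.
    move=> n q _; rewrite gee0_abs ?lee_fin; last by apply: flux_ge0 => //; exact: pneg.
    rewrite ler_wpM2r//; have [u0|u0] := ltP (v * q.1 + q.2) 0; first by rewrite !pneg ?mulr0.
    exact: ler_wpM2l.
Qed.

Lemma crossing_identity_monotone (p_ : nat -> R * R -> R) (p : R * R -> R) :
  (forall n, measurable_fun setT (p_ n)) ->
  (forall n q, 0 <= p_ n q <= p_ n.+1 q) ->
  (forall n u w, u < 0 -> p_ n (u, w) = 0) ->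
  (forall q, p_ n q @[n --> \oo] --> p q) ->
  (forall n, crossing_identity (p_ n)) -> crossing_identity p.
Proof.
move=> mp_ p_mono pneg p_cvg h.
have p0 n q : 0 <= p_ n q by have /andP[] := p_mono n q.
have ple n q : p_ n q <= p_ n.+1 q by have /andP[] := p_mono n q.
have lim_eq (g : nat -> R) l : g n @[n --> \oo] --> l -> limn (fun n => (g n)%:E) = l%:E.
  move=> gl; apply/cvg_lim => //; apply: cvg_EFin => //; exact: nearW.
apply: (ae_integral_monotone (F_ := fun n => test_mass (p_ n)) h).
- apply: filterS (good_path_ae W_C1 v) => o go n; apply: ge0_le_integral.
  + exact: m_cross.
  + by move=> t _; rewrite lee_fin.
  + exact: m_at.
  + exact: m_at.
  + by move=> t _; rewrite lee_fin.
- apply: filterS (good_path_ae W_C1 v) => o go.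
  have := @cvg_monotone_convergence _ _ _ cnt _ (m_cross go)
    (fun n t => (p_ n (at_time o t))%:E) (fun n => m_at (mp_ n) go)
    (fun n t _ => (p0 n (at_time o t) : (0 <= (p_ n (at_time o t))%:E)%E)).
  rewrite /test_mass (eq_integral (fun t : mR => limn (fun n => (p_ n (at_time o t))%:E))
    (fun t : mR => (p (at_time o t))%:E)); last by move=> t _; rewrite (lim_eq _ _ (p_cvg _)).
  by apply => t _; apply/nondecreasing_seqP => n; rewrite lee_fin.
- have := @cvg_monotone_convergence _ _ _ (leb \x leb)%E setT measurableT
    (fun n q => (flux (p_ n) q)%:E).
  rewrite /test_flux (eq_integral (fun q : mR * mR => limn (fun n => (flux (p_ n) q)%:E))
    (fun q : mR * mR => (flux p q)%:E)); last first.
    by move=> q _; rewrite (lim_eq _ (flux p q))//; apply: cvgMl; apply: cvgMr; exact: p_cvg.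
  apply.
  + by move=> n; apply/measurable_EFinP; exact: m_flux.
  + by move=> n q _; rewrite lee_fin; apply: flux_ge0 => //; exact: pneg.
  + move=> q _; apply/nondecreasing_seqP => n; rewrite lee_fin.
    have [_ f0 _] := f_density.
    rewrite ler_wpM2r//; have [u0|u0] := ltP (v * q.1 + q.2) 0; first by rewrite !pneg ?mulr0.
    exact: ler_wpM2l.
Qed.

End test_functions.

Section trapezoid.
Context {R : realType}.
Variables (al be kap : R).
Hypothesis kap_gt0 : 0 < kap.

(** The distance to [[al, be]] when that interval is nonempty. If [be < al] the value is positive
    everywhere and the trapezoids tend to 0, as they should; this occurs below for very negative
    [w]. *)
Definition itv_dist (x : R) : R := Num.max 0 (Num.max (al - x) (x - be)).
(** These functions decrease in [j] to the indicator of the closed interval. The parameter [kap]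
    fixes a common support, the interval enlarged by [1 / kap] on each side. *)
Definition trapezoid (j : nat) (x : R) : R := Num.max 0 (1 - kap * j.+1%:R * itv_dist x).

Let dist_ge0 x : 0 <= itv_dist x.
Proof. by rewrite /itv_dist le_max lexx. Qed.

Let slope_ge0 j : 0 <= kap * j.+1%:R.
Proof. by rewrite mulr_ge0// ltW. Qed.

Lemma continuous_trapezoid j : continuous (trapezoid j).
Proof.
have c (k : R) := @continuous_cstr R k; have i := @continuous_idr R.
apply: continuous_maxr (c 0) _; apply: continuous_subr (c 1) _.
apply: continuous_mulr (c _) _; apply: continuous_maxr (c 0) _.
by apply: continuous_maxr; exact: continuous_subr.
Qed.

Lemma trapezoid_ge0 j x : 0 <= trapezoid j x.
Proof. by rewrite /trapezoid le_max lexx. Qed.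

Lemma trapezoid_le1 j x : trapezoid j x <= 1.
Proof. by rewrite /trapezoid ge_max ler01 gerBl mulr_ge0. Qed.

Lemma trapezoid_le0 j x : trapezoid j x <= trapezoid 0 x.
Proof.
rewrite /trapezoid ge_max !le_max lexx/=; apply/orP; right.
by rewrite lerD2l lerN2 ler_wpM2r// ler_pM2l// ler1n.
Qed.

Lemma trapezoid_supp j x : (x <= al - kap^-1) || (be + kap^-1 <= x) -> trapezoid j x = 0.
Proof.
move=> hx; apply/max_idPl; rewrite subr_le0.
have hd : kap^-1 <= itv_dist x.
  by rewrite /itv_dist !le_max; apply/orP; right; case/orP: hx => hx; apply/orP;
    [left|right]; lra.
apply: (@le_trans _ _ (kap * j.+1%:R * kap^-1)); last exact: ler_wpM2l.
by rewrite mulrAC divff ?gt_eqF// mul1r ler1n.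
Qed.

Lemma trapezoid_cvg x : trapezoid j x @[j --> \oo] --> ((al <= x <= be)%R%:R : R).
Proof.
case: (boolP (al <= x <= be)) => [/andP[h1 h2]|hx].
  apply: cvg_near_cst; apply: nearW => j; rewrite /trapezoid (_ : itv_dist x = 0).
    by rewrite mulr0 subr0; apply/max_idPr.
  by apply/max_idPl; rewrite ge_max; apply/andP; split; lra.
have d0 : 0 < itv_dist x.
  rewrite /itv_dist !lt_max; apply/orP; right; apply/orP.
  by move: hx; rewrite negb_and -!ltNge => /orP[?|?]; [left|right]; lra.
have kd : 0 < kap * itv_dist x by rewrite mulr_gt0.
apply: cvg_near_cst; near=> j; apply/max_idPl; rewrite subr_le0 mulrAC.
rewrite -ler_pdivrMr// mul1r; apply/ltW.
by near: j; exact: (near_infty_natSinv_lt (PosNum kd)).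
Unshelve. all: end_near. Qed.

End trapezoid.

(** * Counting the overtaking times *)

Section encountered.
Context d (T : measurableType d) (R : realType) (P : probability T R).
Local Notation mR := (measurableTypeR R).
Variables W Wx Wt : R -> R -> {RV P >-> R}.
Variable K : R -> R -> R.
Hypothesis W_gauss : gaussian_field W.
Hypothesis W_mean : forall x t : R, ('E_P[W x t] = 0)%E.
Hypothesis W_cov : forall x t xi tau : R,
  ('E_P[fun o => (W x t o * W (x + xi)%R (t + tau)%R o)%R] = (K xi tau)%:E)%E.
Hypothesis W_C1 : as_C1_with W Wx Wt.
Variable v : R.
Variable f : R * R * R -> R.
Hypothesis f_density : joint_density3 P (Wx 0 0) (Wt 0 0) (W 0 0) f.
Hypothesis cf : continuous f.
Variable w : R.

(** Compact boxes in the pair (slope of the encountered sea, [W_x]), exhausting [quadrant]. They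
    stay away from slope 0, as Rice's formula requires of its test functions. *)
Let box (n : nat) (q : R * R) : R :=
  (n.+1%:R^-1 <= q.1 <= n.+1%:R)%R%:R * (- n.+1%:R <= q.2 <= Num.min w (- n.+1%:R^-1))%R%:R.

Let m_indic_itv (a b : R) : measurable_fun setT (fun x : R => (a <= x <= b)%R%:R : R).
Proof.
rewrite (_ : (fun x => _) = \1_(`[a, b]%classic : set R)).
  by apply: measurable_indic.
apply/funext => x; rewrite indicE (_ : (x \in `[a, b]%classic) = (a <= x <= b))//.
by apply/idP/idP; rewrite inE/= in_itv.
Qed.

Let m_box n : measurable_fun setT (box n).
Proof.
apply: measurable_funM.
  exact: (measurableT_comp (m_indic_itv _ _) measurable_fst).
exact: (measurableT_comp (m_indic_itv _ _) measurable_snd).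
Qed.

Let box_identity n : crossing_identity W Wx Wt v f (box n).
Proof.
set N : R := n.+1%:R; have N0 : 0 < N by [].
have N1 : 1 <= N by rewrite ler1n.
have k0 : 0 < 2 * N by rewrite mulr_gt0.
have ik0 : 0 < (2 * N)^-1 by rewrite invr_gt0.
have [i [i0 i1 iE]] : exists i : R, [/\ 0 < i, i <= 1 & i = N^-1].
  by exists N^-1; rewrite invr_gt0 invf_le1.
have ik : (2 * N)^-1 = i / 2 by rewrite iE invfM mulrC.
(* The margin [1 / (2 N)] is half the distance [1 / N] from the box to slope 0, so [a] vanishes
   below [1 / (2 N)]; being less than 1, it also leaves the supports within [N + 1]. *)
pose a := trapezoid i N (2 * N); pose b := trapezoid (- N) (Num.min w (- i)) (2 * N).
have hmin : Num.min w (- i) <= - i by rewrite ge_min lexx orbT.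
have a_supp j u : N + 1 < `|u| -> a j u = 0.
  rewrite ltr_normr => h; apply: trapezoid_supp => //; rewrite ik.
  by case/orP: h => h; apply/orP; [right|left]; lra.
have b_supp j u : N + 1 < `|u| -> b j u = 0.
  rewrite ltr_normr => h; apply: trapezoid_supp => //; rewrite ik.
  by case/orP: h => h; apply/orP; [right|left]; lra.
have a_small j u : u < (2 * N)^-1 -> a j u = 0.
  by move=> h; apply: trapezoid_supp => //; rewrite ik in h *; apply/orP; left; lra.
have a_ge0 j u : 0 <= a j u by exact: trapezoid_ge0.
have b_ge0 j u : 0 <= b j u by exact: trapezoid_ge0.
have ca j : continuous (a j) by exact: continuous_trapezoid.
have cb j : continuous (b j) by exact: continuous_trapezoid.
have b_le j u : b j u <= N + 1.
  apply: (@le_trans _ _ 1); [exact: trapezoid_le1|lra].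
have a_le j u : u * a j u <= N + 1.
  have [h|h] := ltP (N + 1) `|u|; first by rewrite a_supp// mulr0; lra.
  have [u0|u0] := leP 0 u; last by rewrite a_small ?mulr0 ?(lt_trans u0)//; lra.
  rewrite -[leRHS]mulr1; apply: ler_pM => //; last exact: trapezoid_le1.
  exact: le_trans (ler_norm _) h.
pose p_ j (q : R * R) := a j q.1 * b j q.2.
have fluxE j : test_flux v f (p_ j) = slice_mass v f (a j) (b j).
  by apply: eq_integral => q _; rewrite /p_ /=; congr EFin; ring.
apply: (crossing_identity_dominated W_C1 f_density (p_ := p_)).
- move=> j; apply: measurable_funM.
    exact: (measurableT_comp (continuous_measurableR (ca j)) measurable_fst).
  exact: (measurableT_comp (continuous_measurableR (cb j)) measurable_snd).
- exact: m_box.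
- move=> j q; rewrite mulr_ge0//=; apply: ler_pM => //; exact: trapezoid_le0.
- by move=> j u m u0; rewrite /p_/= a_small ?mul0r// (lt_trans u0).
- by move=> q; rewrite /box -/N -iE; apply: cvgM; exact: trapezoid_cvg.
- rewrite fluxE; have [mf f0 _] := f_density.
  have psi_ge0 u : 0 <= u * a 0%N u.
    have [u0|u0] := leP 0 u; first exact: mulr_ge0.
    by rewrite a_small ?mulr0// (lt_trans u0).
  have c_psi := continuous_mulr (@continuous_idr R) (ca 0%N).
  have psi_supp u : N + 1 < `|u| -> u * a 0%N u = 0 by move=> /a_supp ->; rewrite mulr0.
  exact: (slice_lty v mf f0 cf c_psi (cb 0%N) psi_ge0 (b_ge0 0%N) psi_supp (b_supp 0%N)
    (a_le 0%N) (b_le 0%N)).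
- move=> j; have := rice_formula W_gauss W_mean W_cov W_C1 v f_density cf ik0 (ca j) (cb j)
    (a_ge0 j) (b_ge0 j) (a_small j) (a_supp j) (b_supp j) (a_le j) (b_le j) ler01.
  by rewrite subr0 mul1e -fluxE.
Qed.

Let quadrant (q : R * R) : R := ((0 < q.1) && (q.2 < 0) && (q.2 <= w))%R%:R.

(** A point of the quadrant lies in all boxes from some index on, a point outside it in none, so the
    boxes increase to the quadrant. *)
Let quadrant_identity : crossing_identity W Wx Wt v f quadrant.
Proof.
  have boxE n q : box n q = ((n.+1%:R^-1 <= q.1 <= n.+1%:R) &&
    (- n.+1%:R <= q.2 <= Num.min w (- n.+1%:R^-1)))%R%:R.
  by rewrite /box; do 2 case: (_ <= _ <= _); rewrite ?mulr1 ?mulr0.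
apply: (crossing_identity_monotone W_C1 f_density (p_ := box)).
- exact: m_box.
- move=> n q; apply/andP; split; first by rewrite boxE ler0n.
  rewrite !boxE ler_nat; case: andP => // -[/andP[h1 h2] /andP[h3]].
  rewrite le_min => /andP[h4 h5].
  have e1 : (n.+1%:R : R) <= n.+2%:R by rewrite ler_nat.
  have e2 : (n.+2%:R : R)^-1 <= n.+1%:R^-1 by rewrite lef_pV2// posrE.
  rewrite (le_trans e2 h1) (le_trans h2 e1) le_min h4.
  by rewrite (le_trans _ h3) ?lerN2// (le_trans h5)// lerN2.
- move=> n u m u0; rewrite boxE/= (_ : _ <= u = false)//.
  by apply/negbTE; rewrite -ltNge (lt_le_trans u0)// invr_ge0.
- move=> q; apply: cvg_near_cst.
  have [/andP[/andP[u0 m0] mw]|nq] := boolP ((0 < q.1) && (q.2 < 0) && (q.2 <= w)).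
    have iu0 : 0 < q.1^-1 by rewrite invr_gt0.
    have nm0 : 0 < - q.2 by rewrite oppr_gt0.
    have im0 : 0 < (- q.2)^-1 by rewrite invr_gt0.
    near=> n; rewrite boxE /quadrant u0 m0 mw/= le_min mw/=.
    have h1 : (n.+1%:R^-1 : R) < q.1 by near: n; exact: (near_infty_natSinv_lt (PosNum u0)).
    have h2 : (n.+1%:R^-1 : R) < q.1^-1 by near: n; exact: (near_infty_natSinv_lt (PosNum iu0)).
    have h3 : (n.+1%:R^-1 : R) < - q.2 by near: n; exact: (near_infty_natSinv_lt (PosNum nm0)).
    have h4 : (n.+1%:R^-1 : R) < (- q.2)^-1 by near: n; exact: (near_infty_natSinv_lt (PosNum im0)).
    rewrite ltf_pV2 ?posrE// in h2; rewrite ltf_pV2 ?posrE// in h4.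
    by rewrite (ltW h1) (ltW h2) lerNl (ltW h4) lerNr (ltW h3).
  apply: nearW => n; rewrite boxE /quadrant (negbTE nq).
  case: andP => // -[/andP[h1 h2] /andP[h3]]; rewrite le_min => /andP[h4 h5].
  exfalso; move/negP: nq; apply; rewrite h4 andbT; apply/andP; split.
    by apply: lt_le_trans h1; rewrite invr_gt0.
  by apply: le_lt_trans h5 _; rewrite oppr_lt0 invr_gt0.
- exact: box_identity.
Unshelve. all: end_near. Qed.

(** For [W_x < 0] the product of [(V - v)^+] and [W_x^-] is the positive part of [v W_x + W_t], the
    upcrossing slope in Rice's formula. The count is therefore the crossing sum of the indicator of
    [quadrant]. *)
Lemma expected_overtaking :
  (\int[P]_o counting (overtaking_times W Wx Wt v o `&` [set t | Wx (v * t) t o <= w]%R) =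
   cond_expectation_density0 f (fun wx wt : R =>
     pos_part (local_velocity wx wt - v) * neg_part wx * (wx <= w)%R%:R)%R)%E.
Proof.
apply: (ae_integralE (mu := P)); first by move=> o; exact: measure_ge0.
have -> : cond_expectation_density0 f (fun wx wt : R =>
    pos_part (local_velocity wx wt - v) * neg_part wx * (wx <= w)%R%:R)%R =
    test_flux v f quadrant.
  apply: eq_integral => -[wx wt] _ /=; congr EFin; congr (_ * _).
  rewrite /quadrant /pos_part /neg_part /local_velocity /=.
  (* At [wx = 0] the velocity is a division by zero; the factor [neg_part] annihilates it. *)
  have [wx0|wx0] := ltP wx 0; last first.
    have -> : Num.max (- wx) 0 = 0 by apply/max_idPr; rewrite oppr_le0.
    by rewrite andbF /= !mulr0 mul0r.
  have nwx : 0 <= - wx by rewrite oppr_ge0 ltW.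
  rewrite andbT [Num.max (- wx) 0](max_idPl nwx) maxr_pMl// mul0r.
  have -> : (- wt / wx - v) * - wx = v * wx + wt by field; rewrite lt_eqF.
  by have [u0|u0] := ltP 0 (v * wx + wt); rewrite ?mul0r ?mulr0.
apply: ae_integral_eq quadrant_identity.
(* The overtaking times range over [[0, 1]] but crossing sums over []0, 1]]; a zero at time 0 would
   mean [W 0 0 o = 0], a null event. *)
have W00 : {ae P, forall o, W 0 0 o != 0}.
  exists [set o | W 0 0 o = 0]; split; last by move=> o /= /negP; rewrite negbK => /eqP.
    by rewrite (_ : [set o | _] = W 0 0 @^-1` [set 0]).
  exact: level_null f_density.
apply: filterS2 (good_path_ae W_C1 v) W00 => o [dz czd cm] W0.
pose B : set mR := [set t | 0 < enc_sea_t Wx Wt v t o] `&` [set t | Wx (v * t) t o < 0]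
  `&` [set t | Wx (v * t) t o <= w].
have mpre (g : R -> R) (A : set mR) : continuous g -> measurable A -> measurable (g @^-1` A : set mR).
  by move=> cg mA; rewrite -[X in measurable X]setTI; exact: (continuous_measurableR cg).
have mB : measurable B.
  apply: measurableI; [apply: measurableI|].
  - rewrite (_ : [set t | _] = (enc_sea_t Wx Wt v)^~ o @^-1` `]0, +oo[%classic).
      by apply: mpre => //; exact: measurable_itv.
    by apply/seteqP; split => t /=; rewrite in_itv/= andbT.
  - rewrite (_ : [set t | _] = (fun t => Wx (v * t) t o) @^-1` `]-oo, 0[%classic).
      by apply: mpre => //; exact: measurable_itv.
    by apply/seteqP; split => t /=; rewrite in_itv.
  - rewrite (_ : [set t | _] = (fun t => Wx (v * t) t o) @^-1` `]-oo, w]%classic).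
      by apply: mpre => //; exact: measurable_itv.
    by apply/seteqP; split => t /=; rewrite in_itv.
rewrite /test_mass (eq_integral (fun t : mR => (\1_B t)%:E)); last first.
  move=> t _; rewrite /quadrant /= indicE (_ : (t \in B) = (0 < enc_sea_t Wx Wt v t o) &&
    (Wx (v * t) t o < 0) && (Wx (v * t) t o <= w))//.
  apply/idP/idP => [|/andP[/andP[h1 h2] h3]]; last by rewrite inE.
  by rewrite inE => -[[h1 h2] h3]; apply/andP; split => //; apply/andP.
rewrite integral_indic//; last first.
  by apply: measurable_crossing_set; exact: is_derive_continuous dz.
congr counting; apply/seteqP; split => t.
  move=> [[[h1 h2] h3] [/andP[t0 t1] zt]]; split => //; split => //.
  by rewrite in_itv/= (ltW t0).
move=> [[+ zt h1 h2] h3]; rewrite in_itv/= => /andP[t0 t1]; split => //; split => //.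
rewrite t1 andbT lt_neqAle t0 andbT; apply/eqP => te; move: zt W0.
by rewrite /enc_sea -te mulr0 => ->; rewrite eqxx.
Qed.

End encountered.

Unset Implicit Arguments.
Theorem corollary6p1 (d : measure_display) (T : measurableType d) (R : realType)
    (P : probability T R) (g : R) (S : R -> R -> R)
    (W Wx Wt : R -> R -> {RV P >-> R}) (v : R) (f : R * R * R -> R)
    (g_gt0 : 0 < g)
    (S_density : directional_spectral_density S)
    (W_sea : sea_model g S W)
    (W_C1 : as_C1_with W Wx Wt)
    (v_gt0 : 0 < v)
    (nondegenerate :
       has_density3 P (enc_sea W v 0) (enc_sea_t Wx Wt v 0) (Wx 0 0))
    (f_density : joint_density3 P (Wx 0 0) (Wt 0 0) (W 0 0) f)
    (f_continuous : continuous f)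
    (w : R) :
  F_enc W Wx Wt v w =
  (cond_expectation_density0 f (fun wx wt : R =>
     pos_part (local_velocity wx wt - v) * neg_part wx * (wx <= w)%R%:R)%R /
   cond_expectation_density0 f (fun wx wt : R =>
     pos_part (local_velocity wx wt - v) * neg_part wx)%R)%E.
Proof.
have [W_gauss _ W_mean W_cov] := W_sea.
have num := expected_overtaking W_gauss W_mean W_cov W_C1 v f_density f_continuous.
(* The denominator is the numerator at [w = 0], since only negative slopes count. *)
have den : (\int[P]_o counting (overtaking_times W Wx Wt v o) =
    cond_expectation_density0 f (fun wx wt : R =>
      pos_part (local_velocity wx wt - v) * neg_part wx)%R)%E.
  transitivity (\int[P]_o counting (overtaking_times W Wx Wt v o `&`
      [set t | Wx (v * t) t o <= 0]%R))%E.
    apply: eq_integral => o _; congr counting; apply/esym/setIidl => t [_ _ _ wx0].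
    exact: ltW.
  rewrite (num 0); apply: eq_integral => -[wx wt] _ /=; congr ((_ * _)%:E).
  have [wx0|wx0] := leP wx 0; first by rewrite mulr1.
  by rewrite /neg_part (max_idPr _) ?oppr_le0 ?ltW// !mulr0 ?mul0r.
by rewrite /F_enc num den.
Qed.
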